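(* Let $\varphi$ be a crystalline anisotropy on $\mathbb{R}^2$, let $\alpha>0$, and let $\Gamma^0$ be a closed admissible polygonal curve consisting of $n$ segments. Then there exist a unique family $\{\Gamma(t)\}_{t\in[0,+\infty)}$ of admissible polygonal curves with $\Gamma(0)=\Gamma^0$, an integer $0\le m<n$ and times $0=T_0^\dagger<T_1^\dagger<\dots<T_m^\dagger<T_{m+1}^\dagger=+\infty$ such that: (a) the map $t\mapsto\Gamma(t)$ is Kuratowski continuous in $[0,+\infty)$; (b) for any $i\in\{0,\dots,m\}$ the family $\{\Gamma(t):t\in[T_i^\dagger,T_{i+1}^\dagger)\}$ is the unique maximal crystalline elastic flow starting from $\Gamma(T_i^\dagger)$ (at time $T_i^\dagger$, after relabelling the segments of $\Gamma(T_i^\dagger)$); (c) for any $i\in\{0,\dots,m-1\}$, as $t\nearrow T_{i+1}^\dagger$ some segments of $\Gamma(t)$ with zero $\varphi$-curvature disappear (their length tends to $0$); (d) for any $i\in\{0,\dots,m-1\}$, as $t\nearrow T_{i+1}^\dagger$ the length of each segment of $\Gamma(t)$ with nonzero $\varphi$-curvature is bounded away from $0$; (e) for any $t\ge0$ the index of $\Gamma(t)$ is equal to the index of $\Gamma^0$.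
   Context: Anisotropy. An anisotropy is a convex, positively one-homogeneous function $\varphi:\mathbb{R}^2\to[0,\infty)$ with $c|x|\le\varphi(x)\le C|x|$ for some $0<c\le C<\infty$; $W^\varphi=\{\varphi\le1\}$ and $\varphi^o(x)=\max_{y\in W^\varphi}\langle x,y\rangle$. It is crystalline if $W^\varphi$ is a polygon, whose edges are called facets; $\partial W^\varphi$ is oriented so that the unit normal $\nu_F$ of each facet $F$ is outward. $\mathcal{H}^1$ is length. Polygonal curves. All curves are oriented and may self-intersect. A closed polygonal curve is a closed consecutive union $\Gamma=\bigcup_{i=1}^nS_i$ of finitely many segments of positive length, indices being cyclic ($S_0=S_n$, $S_{n+1}=S_1$, likewise for all indexed quantities); consecutive segments are not parallel. $\nu_{S_i}$ is the unit tangent (in the direction of the parametrization) rotated counterclockwise by $90^\circ$. The angle $\theta_i$ between $S_{i-1}$ and $S_i$ is taken in $(0,\pi)$ if $S_{i-1},S_i$ form a convex cone for which $\nu_{S_{i-1}},\nu_{S_i}$ are inner normals, and in $(\pi,2\pi)$ otherwise (for a convex polygon with outward normals, $\theta_i$ is $2\pi$ minus the interior angle). Admissibility. $\Gamma$ is admissible if (for a suitable orientation) each $\nu_{S_i}$ equals $\nu_{F_i}$ for a (unique) facet $F_i$ of $W^\varphi$, and for consecutive $S_{i-1},S_i$ the facets $F_{i-1},F_i$ have a common vertex. The transition number $c_i$ of $S_i$ is $+1$ if $\theta_i,\theta_{i+1}\in(\pi,2\pi)$, $-1$ if $\theta_i,\theta_{i+1}\in(0,\pi)$, and $0$ otherwise.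 The $\varphi$-curvature on $S_i$ is $c_i\mathcal{H}^1(F_i)/\mathcal{H}^1(S_i)$. Index. For an admissible curve let $N^0:\Gamma\to\partial W^\varphi$ be the field which at the common vertex of $S_{i-1},S_i$ equals the common vertex of $F_{i-1},F_i$ and is linearly interpolated along each segment. The index of $\Gamma$ is the signed number of complete turns of $N^0$ around $\partial W^\varphi$ as $\Gamma$ is traversed. Parallel curves and heights. $\bar\Gamma=\bigcup_{i=1}^n\bar S_i$ is parallel to $\Gamma=\bigcup_{i=1}^nS_i$ if each $\bar S_i$ is a nondegenerate segment parallel to $S_i$ with $\nu_{\bar S_i}=\nu_{S_i}$. For parallel segments $S,T$ on lines $\ell_S,\ell_T$, $H(S,T)$ is the vector orthogonal to them with $\ell_T=\ell_S+H(S,T)$. Flow. Set $\delta_j=\mathcal{H}^1(F_j)^2\varphi^o(\nu_{S_j})$. A family $\{\Gamma(t)\}_{t\in[0,T)}$, $T\in(0,+\infty]$, is a crystalline elastic flow starting from $\Gamma^0=\bigcup_{i=1}^nS_i^0$ if $\Gamma(t)=\bigcup_{i=1}^nS_i(t)$ is parallel to $\Gamma^0$ for all $t$, and $h_i(t)=\langle H(S_i^0,S_i(t)),\nu_{S_i^0}\rangle$ belong to $C^0([0,T))\cap C^1(0,T)$, $h_i(0)=0$, and for each $i$ $$\frac{h_i'}{\varphi^o(\nu_{S_i})}=-\frac{c_i\mathcal{H}^1(F_i)}{\mathcal{H}^1(S_i)}-\frac{\alpha}{\mathcal{H}^1(S_i)}\Big(\frac{c_{i-1}^2\delta_{i-1}}{\mathcal{H}^1(S_{i-1})^2\sin\theta_i}+\frac{c_i^2\delta_i[\cot\theta_i+\cot\theta_{i+1}]}{\mathcal{H}^1(S_i)^2}+\frac{c_{i+1}^2\delta_{i+1}}{\mathcal{H}^1(S_{i+1})^2\sin\theta_{i+1}}\Big)$$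 in $(0,T)$, where $S_j=S_j(t)$. The flow is maximal if it cannot be extended to a crystalline elastic flow (parallel to the same initial curve) on a larger time interval. At a time $T_i^\dagger$ the curve $\Gamma(T_i^\dagger)$ is regarded as an admissible polygonal curve with its segments relabelled (vanished segments removed and aligned consecutive segments merged). Kuratowski continuity refers to Kuratowski convergence of closed subsets of $\mathbb{R}^2$. *)

(* Defs.v *)
From mathcomp Require Import all_boot all_order all_algebra.
From mathcomp Require Import all_classical all_reals all_analysis.

Set Implicit Arguments.
Unset Strict Implicit.
Unset Printing Implicit Defensive.

Import Order.TTheory GRing.Theory Num.Theory.
Import numFieldNormedType.Exports.

Local Open Scope classical_set_scope.
Local Open Scope ring_scope.

(* The library norm of [R * R] is the sup norm, whence [enorm]. *)
Definition dot {R : realType} (u v : R * R) : R := u.1 * v.1 + u.2 * v.2.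

Definition enorm {R : realType} (u : R * R) : R := Num.sqrt (dot u u).

Definition cross {R : realType} (u v : R * R) : R := u.1 * v.2 - u.2 * v.1.

(* Oriented segments are pairs (start, end). *)
Definition seglen {R : realType} (S : (R * R) * (R * R)) : R :=
  enorm (S.2 - S.1).

Definition tangent {R : realType} (S : (R * R) * (R * R)) : R * R :=
  (seglen S)^-1 *: (S.2 - S.1).

(* The tangent rotated counterclockwise by a right angle. *)
Definition normal {R : realType} (S : (R * R) * (R * R)) : R * R :=
  (- (tangent S).2, (tangent S).1).

Definition segset {R : realType} (S : (R * R) * (R * R)) : set (R * R) :=
  [set x | exists s : R, 0 <= s <= 1 /\ x = (1 - s) *: S.1 + s *: S.2].

(* For parallel segments, the vector normal to them that moves the line of S
   onto the line of T. *)
Definition Hvec {R : realType} (S T : (R * R) * (R * R)) : R * R :=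
  dot (T.1 - S.1) (normal S) *: normal S.

Definition anisotropy {R : realType} (phi : R * R -> R) : Prop :=
  [/\ forall x, 0 <= phi x,
      convex_function (E := (R * R)%type) setT phi,
      forall (l : R) x, 0 < l -> phi (l *: x) = l * phi x &
      exists c C : R, 0 < c <= C /\
        forall x, c * enorm x <= phi x <= C * enorm x].

Definition wulff {R : realType} (phi : R * R -> R) : set (R * R) :=
  [set y | phi y <= 1].

Definition dual {R : realType} (phi : R * R -> R) (x : R * R) : R :=
  sup [set dot x y | y in wulff phi].

Definition convex_hull {R : realType} (V : seq (R * R)) : set (R * R) :=
  [set x | exists w : 'I_(size V) -> R,
    [/\ forall i, 0 <= w i, \sum_i w i = 1 & x = \sum_i w i *: V`_i]].

(* As [wulff phi] is a bounded neighbourhood of 0, this says that it is a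
   nondegenerate convex polygon. *)
Definition crystalline {R : realType} (phi : R * R -> R) : Prop :=
  exists V : seq (R * R), wulff phi = convex_hull V.

(* An edge of [wulff phi], i.e., a nondegenerate segment cut out by a
   supporting line, oriented so that its normal is the outer one; hence the
   boundary of [wulff phi] is traversed clockwise. *)
Definition facet {R : realType} (phi : R * R -> R) (F : (R * R) * (R * R)) :
    Prop :=
  F.1 != F.2 /\
  segset F = [set x | wulff phi x /\ dot x (normal F) = dual phi (normal F)].

(* A closed curve is the cyclic list of its vertices; all the quantities
   indexed by [i : nat] below depend on [i] only modulo [size G]. The segment
   [S_i] is [side G i], from vertex i to vertex i + 1, so that [S_{i-1}] and
   [S_i] meet at vertex i. *)
Definition vtx {R : realType} (G : seq (R * R)) (i : nat) : R * R :=
  G`_(i %% size G).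

Definition side {R : realType} (G : seq (R * R)) (i : nat) :
    (R * R) * (R * R) :=
  (vtx G i, vtx G i.+1).

Definition prev_idx {R : realType} (G : seq (R * R)) (i : nat) : nat :=
  (i + (size G).-1)%N.

Definition trace {R : realType} (G : seq (R * R)) : set (R * R) :=
  [set x | exists i, (i < size G)%N /\ segset (side G i) x].

(* Equality of oriented closed curves up to cyclic relabelling. *)
Definition same_curve {R : realType} (G G' : seq (R * R)) : Prop :=
  exists k : nat, G' = rot k G.

Definition polygonal {R : realType} (G : seq (R * R)) : Prop :=
  [/\ (0 < size G)%N,
      forall i, vtx G i != vtx G i.+1 &
      forall i, cross (tangent (side G i)) (tangent (side G i.+1)) != 0].

Definition angle {R : realType} (G : seq (R * R)) (i : nat) : R :=
  let S' := side G (prev_idx G i) in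
  let S := side G i in
  (* measure of the convex cone at vertex i *)
  let beta := acos (dot (- tangent S') (tangent S)) in
  if (0 < dot (tangent S) (normal S')) && (0 < dot (- tangent S') (normal S))
  then beta else 2 * pi - beta.

Definition cot {R : realType} (x : R) : R := cos x / sin x.

Definition transition {R : realType} (G : seq (R * R)) (i : nat) : R :=
  if (pi < angle G i < 2 * pi) && (pi < angle G i.+1 < 2 * pi) then 1
  else if (0 < angle G i < pi) && (0 < angle G i.+1 < pi) then -1
  else 0.

(* The facet F_i; it is unique because a facet is determined by its normal. *)
Definition facet_of {R : realType} (phi : R * R -> R) (G : seq (R * R))
    (i : nat) : (R * R) * (R * R) :=
  get [set F | facet phi F /\ normal F = normal (side G i)].

Definition common_vertex {R : realType} (F F' : (R * R) * (R * R))
    (v : R * R) : Prop :=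
  (v = F.1 \/ v = F.2) /\ (v = F'.1 \/ v = F'.2).

(* The orientation of G is meant to be a suitable one. *)
Definition admissible {R : realType} (phi : R * R -> R) (G : seq (R * R)) :
    Prop :=
  [/\ polygonal G,
      forall i, exists F, facet phi F /\ normal F = normal (side G i) &
      forall i, exists v, common_vertex (facet_of phi G i) (facet_of phi G i.+1) v].

Definition curvature {R : realType} (phi : R * R -> R) (G : seq (R * R))
    (i : nat) : R :=
  transition G i * seglen (facet_of phi G i) / seglen (side G i).

(* Value of the field N^0 at vertex i. *)
Definition N0_vertex {R : realType} (phi : R * R -> R) (G : seq (R * R))
    (i : nat) : R * R :=
  get [set v |
    common_vertex (facet_of phi G (prev_idx G i)) (facet_of phi G i) v].

(* Value of N^0 at the point (1 - r) S_i.1 + r S_i.2 of S_i; since the curve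
   may cross itself, N^0 is a function of the parameter (i, r). *)
Definition N0 {R : realType} (phi : R * R -> R) (G : seq (R * R))
    (i : nat) (r : R) : R * R :=
  (1 - r) *: N0_vertex phi G i + r *: N0_vertex phi G i.+1.

(* [theta (i + r)] is a continuous polar angle of N^0 at (i, r). Turns are
   counted positively in the direction in which the boundary of [wulff phi] is
   oriented, which is clockwise. *)
Definition is_index {R : realType} (phi : R * R -> R) (G : seq (R * R))
    (k : int) : Prop :=
  exists theta : R -> R,
    [/\ {within `[0, (size G)%:R], continuous theta},
        forall (i : nat) (r : R), (i < size G)%N -> 0 <= r <= 1 ->
          N0 phi G i r = enorm (N0 phi G i r) *:
            (cos (theta (i%:R + r)), sin (theta (i%:R + r))) &
        theta (size G)%:R - theta 0 = - (k%:~R * (2 * pi))].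

Definition parallel {R : realType} (G G' : seq (R * R)) : Prop :=
  size G' = size G /\
  forall i, vtx G' i != vtx G' i.+1 /\
            normal (side G' i) = normal (side G i).

Definition height {R : realType} (G0 : seq (R * R)) (G : R -> seq (R * R))
    (i : nat) (t : R) : R :=
  dot (Hvec (side G0 i) (side (G t) i)) (normal (side G0 i)).

Definition delta {R : realType} (phi : R * R -> R) (G : seq (R * R))
    (j : nat) : R :=
  seglen (facet_of phi G j) ^+ 2 * dual phi (normal (side G j)).

Definition elastic_rhs {R : realType} (phi : R * R -> R) (alpha : R)
    (G : seq (R * R)) (i : nat) : R :=
  let p := prev_idx G i in
  let w j := transition G j ^+ 2 * delta phi G j / seglen (side G j) ^+ 2 in
  - curvature phi G i
  - alpha / seglen (side G i) *
    (w p / sin (angle G i)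
     + w i * (cot (angle G i) + cot (angle G i.+1))
     + w i.+1 / sin (angle G i.+1)).

(* Only the values [G t] with 0 <= t < T are relevant. *)
Definition elastic_flow {R : realType} (phi : R * R -> R) (alpha : R)
    (G0 : seq (R * R)) (T : \bar R) (G : R -> seq (R * R)) : Prop :=
  [/\ (0 < T)%E,
      forall t : R, 0 <= t -> (t%:E < T)%E -> parallel G0 (G t) &
      forall i : nat, (i < size G0)%N ->
        let h := height G0 G i in
        [/\ h 0 = 0,
            {within [set t : R | 0 <= t /\ (t%:E < T)%E], continuous h},
            forall t : R, 0 < t -> (t%:E < T)%E -> derivable h t 1,
            {within [set t : R | 0 < t /\ (t%:E < T)%E], continuous (derive1 h)} &
            forall t : R, 0 < t -> (t%:E < T)%E ->
              derive1 h t / dual phi (normal (side (G t) i))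
              = elastic_rhs phi alpha (G t) i]].

Definition maximal_flow {R : realType} (phi : R * R -> R) (alpha : R)
    (G0 : seq (R * R)) (T : \bar R) (G : R -> seq (R * R)) : Prop :=
  elastic_flow phi alpha G0 T G /\
  ~ exists (T' : \bar R) (G' : R -> seq (R * R)),
      [/\ (T < T')%E, elastic_flow phi alpha G0 T' G' &
          forall t : R, 0 <= t -> (t%:E < T)%E -> G' t = G t].

Definition unique_maximal_flow {R : realType} (phi : R * R -> R) (alpha : R)
    (G0 : seq (R * R)) (T : \bar R) (G : R -> seq (R * R)) : Prop :=
  maximal_flow phi alpha G0 T G /\
  forall (T' : \bar R) (G' : R -> seq (R * R)),
    maximal_flow phi alpha G0 T' G' ->
    T' = T /\ forall t : R, 0 <= t -> (t%:E < T)%E -> G' t = G t.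

Definition kuratowski_liminf {R : realType} {I : Type} (F : set_system I)
    (K : I -> set (R * R)) : set (R * R) :=
  [set x | forall U, nbhs x U -> \forall i \near F, K i `&` U !=set0].

Definition kuratowski_limsup {R : realType} {I : Type} (F : set_system I)
    (K : I -> set (R * R)) : set (R * R) :=
  [set x | forall U, nbhs x U -> ~ (\forall i \near F, ~ (K i `&` U !=set0))].

Definition kuratowski_cvg {R : realType} {I : Type} (F : set_system I)
    (K : I -> set (R * R)) (L : set (R * R)) : Prop :=
  kuratowski_liminf F K = L /\ kuratowski_limsup F K = L.

Definition kuratowski_continuous {R : realType} (A : set R)
    (K : R -> set (R * R)) : Prop :=
  forall t, A t -> kuratowski_cvg (within A (nbhs t)) K (K t).

(* [q] lists the vertices of a closed curve some of whose segments may be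
   reduced to a point or aligned with the previous one. The former are removed
   by [drop_vanished], the latter merged by [merge_aligned]. *)
Definition drop_vanished {R : realType} (q : seq (R * R)) : seq (R * R) :=
  [seq vtx q j | j <- iota 0 (size q) & vtx q j != vtx q j.+1].

Definition merge_aligned {R : realType} (q : seq (R * R)) : seq (R * R) :=
  [seq vtx q j | j <- iota 0 (size q) &
    normal (side q (prev_idx q j)) != normal (side q j)].

(* [G1] is the curve to which [G t] converges as t increases to [T], with its
   segments relabelled. *)
Definition relabelled_limit {R : realType} (G : R -> seq (R * R)) (T : R)
    (G1 : seq (R * R)) : Prop :=
  exists q : seq (R * R),
    [/\ \forall t \near T^'-, size (G t) = size q,
        forall j, (j < size q)%N -> vtx (G t) j @[t --> T^'-] --> vtx q j &
        same_curve (merge_aligned (drop_vanished q)) G1].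

(* Right end of the i-th of the intervals [T_0, T_1[, ..., [T_m, +oo[. *)
Definition end_time {R : realType} (m : nat) (T : nat -> R) (i : nat) :
    \bar R :=
  if (i < m)%N then (T i.+1)%:E else +oo%E.

(* Only the values [Gam t] with 0 <= t and [T i] with i <= m are relevant. *)
Record elastic_evolution {R : realType} (phi : R * R -> R) (alpha : R)
    (G0 : seq (R * R)) (Gam : R -> seq (R * R)) (m : nat) (T : nat -> R) :
    Prop := ElasticEvolution {
  evol_admissible : forall t : R, 0 <= t -> admissible phi (Gam t);
  evol_init : Gam 0 = G0;
  evol_bound : (m < size G0)%N;
  evol_time0 : T 0%N = 0;
  evol_times : forall i, (i < m)%N -> T i < T i.+1;
  evol_relabel : forall i, (i < m)%N ->
    relabelled_limit Gam (T i.+1) (Gam (T i.+1));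
  evol_kuratowski :
    kuratowski_continuous [set t : R | 0 <= t] (fun t => trace (Gam t));
  evol_flow : forall i, (i <= m)%N ->
    unique_maximal_flow phi alpha (Gam (T i)) (end_time m T i - (T i)%:E)%E
      (fun s => Gam (T i + s));
  evol_vanish : forall i, (i < m)%N ->
    exists j, [/\ (j < size (Gam (T i)))%N,
      \forall t \near (T i.+1)^'-, curvature phi (Gam t) j = 0 &
      seglen (side (Gam t) j) @[t --> (T i.+1)^'-] --> (0 : R)];
  evol_bounded : forall i, (i < m)%N ->
    exists eps : R, 0 < eps /\
      \forall t \near (T i.+1)^'-, forall j, (j < size (Gam t))%N ->
        curvature phi (Gam t) j != 0 -> eps <= seglen (side (Gam t) j);
  evol_index : exists k : int, is_index phi G0 k /\
    forall t : R, 0 <= t -> is_index phi (Gam t) k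
}.

(* Main.v *)
(* In terms of the heights of its sides the flow is an ordinary differential
   system, locally Lipschitz as long as the lengths are positive. Let T < +oo be
   its maximal time. Since the linear map from heights to lengths is symmetric
   and the velocities contain the gradient of E = sum_i c_i^2 delta_i / L_i,
   completing the square gives E' <= E / (4 alpha); hence the sides with
   c_i <> 0 keep a length bounded below and a bounded speed. A side with c_i = 0
   lies between two parallel sides and moves so as to shorten the longer of them,
   where a side with c_j = 0 counts as infinitely long. Thus the sum of
   |L_j - L_l| over the sides with c <> 0, plus a large multiple of the lengths of
   the other sides, decreases, up to a bounded term, at a rate that dominates all
   speeds. Hence all heights converge as t tends to T, and some side with c_i = 0
   vanishes.

   The two ends of such a side have the same N^0, so that dropping it and merging
   aligned sides yields an admissible curve with fewer sides, the same trace and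
   the same total turning of N^0. One restarts from it, by induction on the number
   of sides. Uniqueness propagates from each stage to the next because flows and
   relabelled limits commute with the cyclic relabelling of a curve. *)

Require Import Defs.
From mathcomp Require Import all_boot all_order all_algebra.
From mathcomp Require Import all_classical all_reals all_analysis.
From mathcomp Require Import ring lra zify.

Set Implicit Arguments.
Unset Strict Implicit.
Unset Printing Implicit Defensive.

Import Order.TTheory GRing.Theory Num.Theory.
Import numFieldNormedType.Exports.

Local Open Scope classical_set_scope.
Local Open Scope ring_scope.

(** The obstacle at a finite maximal time: the speed of a side with [c i = 0] carries a factor
    [1 / L i], hence has no a priori bound just when that side vanishes, and only its integrability
    in time can be expected. The decreasing functional supplies it. Its derivative, transported by
    the symmetric map [adj], has at such a side the same factor [1 / L i] times a product of two
    differences between the neighbours of the side: one of the weights [dl / L ^+ 2], decreasing in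
    the length, one of the gradient of the functional, increasing in it. So the product is
    nonpositive; as the gradients differ by at least 1 wherever the weights differ, it absorbs the
    speed. Absolute values are not differentiable: [sqrt (x ^+ 2 + e ^+ 2)] replaces them, and [e]
    tends to 0 between two fixed times, where the lengths have a positive lower bound.

    The index is treated as the sum of the signed angles between consecutive vertex values of [N^0].
    A merged side sees only the two ends of one facet, and over two points an antisymmetric function
    telescopes, so the sum survives merging. *)

Section RealCalculus.
Context {R : realType}.
Implicit Types (f g : R -> R) (a b : R).

Lemma derive_le0_le f f' a b : a <= b -> {within `[a, b], continuous f} ->
  (forall t, a < t < b -> is_derive t 1 f (f' t)) ->
  (forall t, a < t < b -> f' t <= 0) -> f b <= f a.
Proof.
rewrite le_eqVlt => /predU1P[->//|ab] cf df f'0.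
have df' x : x \in `]a, b[%R -> is_derive x 1 f (f' x).
  by rewrite in_itv/=; exact: df.
have [c cab fE] := MVT ab df' cf.
rewrite -subr_le0 fE mulr_le0_ge0 ?subr_ge0 ?(ltW ab)//.
by apply: f'0; move: cab; rewrite in_itv.
Qed.

Lemma norm_derive_le f g f' g' a b : a <= b ->
  {within `[a, b], continuous f} -> {within `[a, b], continuous g} ->
  (forall t, a < t < b -> is_derive t 1 f (f' t)) ->
  (forall t, a < t < b -> is_derive t 1 g (g' t)) ->
  (forall t, a < t < b -> `|f' t| <= g' t) -> `|f b - f a| <= g b - g a.
Proof.
move=> ab cf cg df dg fg.
have H1 : f b - g b <= f a - g a.
  apply: (@derive_le0_le (f - g) (fun t => f' t - g' t)) => //.
  - by move=> x; apply: cvgB; [exact: cf|exact: cg].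
  - by move=> t tab; apply: is_deriveB; [exact: df|exact: dg].
  - by move=> t /fg; rewrite ler_norml subr_le0 => /andP[].
have H2 : - f b - g b <= - f a - g a.
  apply: (@derive_le0_le (- f - g) (fun t => - f' t - g' t)) => //.
  - move=> x; apply: cvgB; [apply: cvgN; exact: cf|exact: cg].
  - move=> t tab; apply: is_deriveB; last exact: dg.
    by apply: is_deriveN; exact: df.
  - by move=> t /fg; rewrite ler_norml subr_le0 lerNl => /andP[].
by rewrite ler_norml; apply/andP; split; lra.
Qed.

Lemma antiderivative_ex f : continuous f ->
  exists F : R -> R, F 0 = 0 /\ forall t : R, 0 <= t -> is_derive t 1 F (f t).
Proof.
(* Integrating from -1 makes 0 an interior point, so that the two-sided derivative exists there as
   well. *)
move=> cf; pose F0 (x : R) : R := (\int[lebesgue_measure]_(t in [set` `[-1, x]%R]) (f t)).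
exists (fun x => F0 x - F0 0); split => [|t t0]; first by rewrite subrr.
have tu : t < t + 1 by rewrite ltrDl.
have fi : lebesgue_measure.-integrable `[-1, t + 1] (EFin \o f).
  apply: continuous_compact_integrable; first exact: segment_compact.
  exact: continuous_subspaceT.
have [] := continuous_FTC1_closed tu fi _ (cf t).
  by rewrite (lt_le_trans _ t0)// ltrN10.
move=> /derivableP dF; rewrite derive1E => F'.
rewrite -[f t]subr0; apply: is_deriveB.
by rewrite F' in dF.
Qed.

Lemma is_derive_within_continuous f f' (a b : R) :
  (forall t, a <= t <= b -> is_derive t 1 f (f' t)) ->
  {within `[a, b], continuous f}.
Proof.
move=> df; apply: derivable_within_continuous => x; rewrite in_itv/= => xab.
by have [] := df x xab.
Qed.

(* The limit differs from the [k]-th term by the tail of the geometric series. *)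
Lemma geometric_limit (u : nat -> R) c :
  (forall k, `|u k.+1 - u k| <= c * 2 ^- k) ->
  exists l, forall k, `|u k - l| <= 2 * c * 2 ^- k.
Proof.
(* The intervals [[v k, w k]] around [u k] are nested; the limit is a common point of them. *)
move=> uc; pose v k := u k - 2 * c * 2 ^- k; pose w k := u k + 2 * c * 2 ^- k.
have half k : 2 ^- k.+1 = 2 ^- k / 2 :> R by rewrite exprSr invfM.
have vS k : v k <= v k.+1.
  by rewrite /v half; have := uc k; rewrite ler_norml => /andP[]; lra.
have wS k : w k.+1 <= w k.
  by rewrite /w half; have := uc k; rewrite ler_norml => /andP[]; lra.
have vh : {homo v : m n / (m <= n)%N >-> m <= n} by exact: homo_leq le_trans vS.
have wh : {homo w : m n / (m <= n)%N >-> n <= m}.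
  by apply: homo_leq wS => // x y z /[swap]; exact: le_trans.
have c0 : 0 <= c by have := uc 0%N; rewrite expr0 invr1 mulr1; apply: le_trans.
have vw k j : v k <= w j.
  have le1 : v k <= v (maxn k j) by apply: vh; exact: leq_maxl.
  have le2 : w (maxn k j) <= w j by apply: wh; exact: leq_maxr.
  apply: (le_trans le1); apply: le_trans le2.
  have : 0 <= c * 2 ^- maxn k j by rewrite mulr_ge0// invr_ge0 exprn_ge0.
  rewrite /v /w; lra.
exists (sup (range v)) => k.
have h1 : v k <= sup (range v).
  apply: ub_le_sup; last by exists k.
  by exists (w 0%N) => _ [j _ <-].
have h2 : sup (range v) <= w k.
  by apply: ge_sup; [exists (v 0%N), 0%N|move=> _ [j _ <-]].
by move: h1 h2; rewrite /v /w ler_norml => h1 h2; apply/andP; split; lra.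
Qed.

Lemma le_geometric_eq0 (x c : R) : (forall k, `|x| <= c * 2 ^- k) -> x = 0.
Proof.
move=> xc; apply/eqP; rewrite -normr_le0.
have c2 : c * 2 ^- k @[k --> \oo] --> c * 0.
  apply: cvgMr; rewrite (_ : (fun k => 2 ^- k) = (fun k => 2^-1 ^+ k)).
    by apply: cvg_expr; rewrite ger0_norm// invf_lt1// ltr1n.
  by apply/funext => k; rewrite exprVn.
rewrite mulr0 in c2.
rewrite -(cvg_lim _ c2)//; apply: limr_ge; first by apply/cvg_ex; exists 0.
by apply: nearW => k; exact: xc.
Qed.

End RealCalculus.

(** * Lipschitz differential equations *)

Section ODE.
Context {R : realType} {I : Type} (f : (I -> R) -> I -> R) (M K : R).
Hypotheses (K1 : 1 <= K) (M0 : 0 <= M).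
Hypothesis fM : forall x i, `|f x i| <= M.
Hypothesis fK : forall x y (d : R),
  (forall j, `|x j - y j| <= d) -> forall i, `|f x i - f y i| <= K * d.

Let K0 : 0 < K. Proof. exact: lt_le_trans ltr01 K1. Qed.

(** In the sup norm weighted by [expR (2 * K * t)] the Picard map contracts by a factor 2 on the
    whole half-line, so that global solutions are obtained at once, without gluing short time
    intervals. *)
Let bnd (k : nat) (t : R) : R := 2 * M * 2 ^- k * expR (2 * K * t).

Let is_derive_bnd k (t : R) : is_derive t 1 (bnd k) (bnd k t * (2 * K)).
Proof.
rewrite /bnd; apply: is_derive_eq.
by rewrite /GRing.scale/=; ring.
Qed.

Let bndS k t : K * bnd k t = bnd k.+1 t * (2 * K).
Proof. by rewrite /bnd exprSr invfM; field. Qed.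

Let bnd_ge0 k t : 0 <= bnd k t.
Proof. by rewrite /bnd !mulr_ge0 ?expR_ge0 ?invr_ge0 ?exprn_ge0. Qed.

Let M_le_bnd0 (t : R) : 0 <= t -> 2 * M <= bnd 0 t * (2 * K).
Proof.
move=> t0; rewrite /bnd expr0 invr1 mulr1 -[leLHS]mulr1 -[leRHS]mulrA.
rewrite ler_wpM2l ?mulr_ge0//.
have e1 : 1 <= expR (2 * K * t).
  by apply: le_trans (expR_ge1Dx _); rewrite lerDl !mulr_ge0// ltW.
by rewrite -[leLHS]mulr1 ler_pM//; move: K1; lra.
Qed.

(* Integrating [K * bnd k = bnd k.+1 * (2 * K)] gains a factor 2 at each step. *)
Let contract (g h g' h' : R -> R) k (b : R) : 0 <= b -> g 0 = h 0 ->
  {within `[0, b], continuous g} -> {within `[0, b], continuous h} ->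
  (forall t : R, 0 < t < b -> is_derive t 1 g (g' t)) ->
  (forall t : R, 0 < t < b -> is_derive t 1 h (h' t)) ->
  (forall t : R, 0 < t < b -> `|g' t - h' t| <= bnd k t * (2 * K)) ->
  `|g b - h b| <= bnd k b.
Proof.
move=> b0 gh cg ch dg dh gh'.
have : `|(g - h) b - (g - h) 0| <= bnd k b - bnd k 0.
  apply: (@norm_derive_le _ _ _ (fun t => g' t - h' t)
    (fun t => bnd k t * (2 * K))) => //.
  - by move=> x; apply: cvgB; [exact: cg|exact: ch].
  - by apply: is_derive_within_continuous.
  - by move=> t tb; apply: is_deriveB; [exact: dg|exact: dh].
have -> : (g - h) b - (g - h) 0 = g b - h b.
  by rewrite !fctE gh subrr subr0.
by move=> /le_trans; apply; rewrite lerBlDr lerDl.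
Qed.

(** Each pass through [contract] halves the bound on the difference of the two solutions. The bound
    on [f] starts the induction, without any bound on the solutions themselves. *)
Lemma ode_unique (b : R) (u v : I -> R -> R) :
  (forall i, u i 0 = v i 0) ->
  (forall i, {within `[0, b], continuous u i}) ->
  (forall i, {within `[0, b], continuous v i}) ->
  (forall i (t : R), 0 < t < b -> is_derive t 1 (u i) (f (u ^~ t) i)) ->
  (forall i (t : R), 0 < t < b -> is_derive t 1 (v i) (f (v ^~ t) i)) ->
  forall t : R, 0 <= t <= b -> forall i, u i t = v i t.
Proof.
move=> uv0 cu cv du dv.
have sub (t : R) : t <= b -> [set` `[0, t]] `<=` [set` `[0, b]].
  by move=> tb x /=; rewrite !in_itv/= => /andP[-> /le_trans->].
have uvk k : forall t : R, 0 <= t <= b -> forall i, `|u i t - v i t| <= bnd k t.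
  elim: k => [|k IH] t /andP[t0 tb] i;
    apply: (@contract _ _ (fun t => f (u ^~ t) i) (fun t => f (v ^~ t) i)) => //.
  - exact: continuous_subspaceW (sub _ tb) (cu i).
  - exact: continuous_subspaceW (sub _ tb) (cv i).
  - by move=> s /andP[s0 st]; apply: du; rewrite s0 (lt_le_trans st).
  - by move=> s /andP[s0 st]; apply: dv; rewrite s0 (lt_le_trans st).
  - move=> s /andP[s0 st]; apply: le_trans (M_le_bnd0 (ltW s0)).
    apply: (le_trans (ler_normB _ _)).
    by have := fM (u ^~ s) i; have := fM (v ^~ s) i; lra.
  - exact: continuous_subspaceW (sub _ tb) (cu i).
  - exact: continuous_subspaceW (sub _ tb) (cv i).
  - by move=> s /andP[s0 st]; apply: du; rewrite s0 (lt_le_trans st).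
  - by move=> s /andP[s0 st]; apply: dv; rewrite s0 (lt_le_trans st).
  - move=> s /andP[s0 st]; rewrite -bndS; apply: fK => j.
    by apply: IH; rewrite (ltW s0) ltW// (lt_le_trans st).
move=> t tb i; apply/subr0_eq.
apply: (@le_geometric_eq0 _ _ (2 * M * expR (2 * K * t))) => k.
by apply: (le_trans (uvk k t tb i)); rewrite /bnd mulrAC.
Qed.

Let lipschitz (u : I -> R -> R) :=
  forall i (t s : R), 0 <= t -> 0 <= s -> `|u i t - u i s| <= M * `|t - s|.

(** Freezing [u] at time 0 for negative times gives a function continuous on the whole line, as the
    antiderivative requires, although [lipschitz] only speaks of nonnegative times. *)
Let picard (u : I -> R -> R) (i : I) (t : R) := f (fun j => u j (Order.max t 0)) i.

Let picardE u i t : 0 <= t -> picard u i t = f (u ^~ t) i.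
Proof. by move=> t0; rewrite /picard max_l. Qed.

Let picard_continuous u i : lipschitz u -> continuous (picard u i).
Proof.
move=> ulip t; apply/cvgrPdist_le => e e0.
have KM : 0 < K * M + 1 by rewrite ltr_wpDl// mulr_ge0// ltW.
near=> s.
have d0 : `|Order.max t 0 - Order.max s 0| <= `|t - s|.
  have h1 := ler_norm (t - s); have h2 := ler_norm (s - t).
  rewrite distrC in h2; rewrite ler_norml /Order.max.
  by do 2 case: ltP => ?; apply/andP; split; lra.
apply: (@le_trans _ _ (K * (M * `|t - s|))).
  apply: fK => j; apply: (le_trans (ulip _ _ _ _ _)).
  - by rewrite le_max lexx orbT.
  - by rewrite le_max lexx orbT.
  - by rewrite ler_wpM2l.
rewrite mulrA; apply: (@le_trans _ _ ((K * M + 1) * `|t - s|)).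
  by rewrite ler_wpM2r// lerDl.
rewrite mulrC -ler_pdivlMr//; near: s.
by apply: cvgr_dist_le; [exact: cvg_id|exact: divr_gt0].
Unshelve. all: by end_near. Qed.

Let antid (x0 : R) (g : R -> R) : R -> R :=
  xget (cst x0) [set F : R -> R |
    F 0 = x0 /\ forall t : R, 0 <= t -> is_derive t 1 F (g t)].

Let antidP x0 g : continuous g -> antid x0 g 0 = x0 /\
  forall t : R, 0 <= t -> is_derive t 1 (antid x0 g) (g t).
Proof.
move=> cg; rewrite /antid; case: xgetP => [F _ //|noF]; exfalso.
have [F [F0 dF]] := antiderivative_ex cg.
apply: (noF (fun t => x0 + F t)); split; first by rewrite F0 addr0.
move=> t t0; rewrite -[g t]add0r.
by apply: (@is_deriveD _ _ _ (cst x0) F); last exact: dF.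
Qed.

Variable x0 : I -> R.

Let it := fix it k := if k is k'.+1 then
  fun i => antid (x0 i) (picard (it k') i) else fun i (_ : R) => x0 i.

Let antid_lipschitz (u : I -> R -> R) : lipschitz u ->
  lipschitz (fun i => antid (x0 i) (picard u i)).
Proof.
move=> ul i; suff H (s t : R) : 0 <= s -> s <= t ->
    `|antid (x0 i) (picard u i) t - antid (x0 i) (picard u i) s| <= M * (t - s).
  move=> t s t0 s0; have [st|/ltW st] := leP s t.
    by rewrite (ger0_norm (_ : 0 <= t - s)) ?subr_ge0// H.
  by rewrite distrC (distrC t) (ger0_norm (_ : 0 <= s - t)) ?subr_ge0// H.
move=> s0 st; rewrite mulrBr.
have [_ dA] := antidP (x0 i) (@picard_continuous u i ul).
apply: (@norm_derive_le _ _ (fun t => M * t) (picard u i) (fun=> M)) => //.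
- apply: is_derive_within_continuous => r /andP[sr _].
  by apply: dA; exact: le_trans sr.
- by apply: continuous_subspaceT => r; apply: cvgMl_tmp; exact: cvg_id.
- by move=> r /andP[sr _]; apply: dA; exact: le_trans (ltW sr).
- by move=> r _; apply: is_derive_eq; rewrite /GRing.scale/=; ring.
- by move=> r _; exact: fM.
Qed.

Let it_lipschitz k : lipschitz (it k).
Proof.
elim: k => [|k IH]; last exact: antid_lipschitz.
by move=> i t s _ _; rewrite subrr normr0 mulr_ge0.
Qed.

Let antid_contract (u v : I -> R -> R) k : lipschitz u -> lipschitz v ->
  (forall i (t : R), 0 <= t -> `|u i t - v i t| <= bnd k t) ->
  forall i (t : R), 0 <= t ->
    `|antid (x0 i) (picard u i) t - antid (x0 i) (picard v i) t| <= bnd k.+1 t.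
Proof.
move=> ul vl uv i t t0.
have [A0 dA] := antidP (x0 i) (@picard_continuous u i ul).
have [B0 dB] := antidP (x0 i) (@picard_continuous v i vl).
apply: (@contract _ _ (picard u i) (picard v i)) => //.
- by rewrite A0 B0.
- by apply: is_derive_within_continuous => s /andP[s0 _]; exact: dA.
- by apply: is_derive_within_continuous => s /andP[s0 _]; exact: dB.
- by move=> s /andP[/ltW s0 _]; exact: dA.
- by move=> s /andP[/ltW s0 _]; exact: dB.
move=> s /andP[/ltW s0 _]; rewrite -bndS !picardE//; apply: fK => j.
exact: uv.
Qed.

Let it_diff k : forall i (t : R), 0 <= t -> `|it k.+1 i t - it k i t| <= bnd k t.
Proof.
elim: k => [|k IH] i t t0; last first.
  exact: (@antid_contract (it k.+1) (it k) k).
have [A0 dA] := antidP (x0 i) (@picard_continuous _ i (@it_lipschitz 0)).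
apply: (@contract _ _ (picard (it 0%N) i) (fun=> 0)) => //=.
- by apply: is_derive_within_continuous => s /andP[s0 _]; exact: dA.
- by apply: continuous_subspaceT => r; exact: cvg_cst.
- by move=> s /andP[/ltW s0 _]; exact: dA.
move=> s /andP[/ltW s0 _]; rewrite subr0; apply: le_trans (M_le_bnd0 s0).
by apply: (le_trans (fM _ _)); move: M0; lra.
Qed.

Lemma ode_exists : exists u : I -> R -> R, (forall i, u i 0 = x0 i) /\
  forall i (t : R), 0 <= t -> is_derive t 1 (u i) (f (u ^~ t) i).
Proof.
pose c t := 2 * M * expR (2 * K * t).
have lim_ex i t : exists l, 0 <= t ->
    forall k, `|it k i t - l| <= 2 * c t * 2 ^- k.
  have [t0|] := boolP (0 <= t); last by exists 0.
  have [k|l lP] := @geometric_limit _ (fun k => it k i t) (c t).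
    by apply: (le_trans (it_diff k i t0)); rewrite /bnd /c mulrAC.
  by exists l.
have {lim_ex} [l lP] : exists l : I -> R -> R, forall i t, 0 <= t ->
    forall k, `|it k i t - l i t| <= 2 * c t * 2 ^- k.
  exists (fun i t => projT1 (cid (lim_ex i t))) => i t.
  by case: cid.
have ll : lipschitz l.
  move=> i t s t0 s0; rewrite -subr_le0 leNgt; apply/negP => gap.
  set g := (X in 0 < X) in gap.
  have : g = 0; last by move=> g0; rewrite g0 ltxx in gap.
  apply: (@le_geometric_eq0 _ _ (2 * c t + 2 * c s)) => k.
  rewrite ger0_norm ?(ltW gap)// /g lerBlDr mulrDl.
  have := @it_lipschitz k i t s t0 s0.
  have := lP i t t0 k; have := lP i s s0 k.
  rewrite (distrC (it k i t) (l i t)) => h1 h2 h3.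
  have -> : l i t - l i s = (l i t - it k i t) + (it k i t - it k i s)
     + (it k i s - l i s) by ring.
  apply: (le_trans (ler_normD _ _)).
  apply: (le_trans (lerD (ler_normD _ _) (lexx _))).
  by lra.
(* One more Picard step, applied to the limit [l]. The result is close to the late iterates too,
   hence equals [l], and no limit has to be taken under an integral sign. *)
pose u i := antid (x0 i) (picard l i).
have uP i := antidP (x0 i) (@picard_continuous _ i ll).
exists u; split => [i|i t t0]; first by have [] := uP i.
have ul j s : 0 <= s -> u j s = l j s.
  move=> s0; apply/subr0_eq.
  apply: (@le_geometric_eq0 _ _ (4 * c s)) => k.
  have h1 : `|it k.+2 j s - u j s| <= bnd k.+1 s.
    apply: (@antid_contract (it k.+1) l k (@it_lipschitz k.+1) ll _ j s s0).
    move=> j' s' s'0; apply: (le_trans (lP j' s' s'0 k.+1)).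
    by rewrite /bnd /c exprSr invfM le_eqVlt; apply/orP; left; apply/eqP; field.
  have h2 := lP j s s0 k.+2.
  have -> : u j s - l j s = (it k.+2 j s - l j s) - (it k.+2 j s - u j s) by ring.
  apply: (le_trans (ler_normB _ _)).
  have h3 : 0 <= c s * 2 ^- k by rewrite /c !mulr_ge0 ?expR_ge0.
  have h4 : bnd k.+1 s = c s * 2 ^- k / 2 by rewrite /bnd /c exprSr invfM; field.
  have h5 : 2 * c s / 2 ^+ k.+2 = c s * 2 ^- k / 2.
    by rewrite !exprSr !invfM; field.
  by rewrite h4 in h1; rewrite h5 in h2; lra.
rewrite (_ : f _ i = picard l i t); first by have [_] := uP i; exact.
rewrite picardE//; congr (f _ i); apply/funext => j; exact: ul.
Qed.

End ODE.

Lemma is_derive1_continuous {R : realType} (f : R -> R) (x df : R) :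
  is_derive x 1 f df -> {for x, continuous f}.
Proof. by move=> [dfx _]; exact/differentiable_continuous/derivable1_diffP. Qed.

Section FiniteMin.
Context {R : realType} {I : finType}.

Lemma finite_pos_lb (P : I -> R -> Prop) :
  (forall i, exists2 e, 0 < e & P i e) ->
  (forall i d e, d <= e -> P i e -> P i d) ->
  exists2 e, 0 < e & forall i, P i e.
Proof.
move=> Pe Pmono.
have {Pe} [e eP] : exists e : I -> R, forall i, 0 < e i /\ P i (e i).
  exists (fun i => projT1 (cid2 (Pe i))) => i.
  by case: cid2 => x /=.
exists (\big[Order.min/1]_i e i).
  by apply: lt_bigmin => // i _; have [] := eP i.
by move=> i; have [_] := eP i; apply: Pmono; exact: bigmin_le_cond.
Qed.

Lemma finite_ub (P : I -> R -> Prop) :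
  (forall i, exists e, P i e) ->
  (forall i d e, d <= e -> P i d -> P i e) ->
  exists2 e, 0 < e & forall i, P i e.
Proof.
move=> Pe Pmono.
have {Pe} [e eP] : exists e : I -> R, forall i, P i (e i).
  exists (fun i => projT1 (cid (Pe i))) => i.
  by case: cid => x /=.
exists (\big[Order.max/1]_i e i).
  by rewrite (lt_le_trans ltr01)//; exact: bigmax_ge_id.
by move=> i; apply: Pmono (eP i); exact: le_bigmax.
Qed.

End FiniteMin.

(** * Bounded and Lipschitz functions of a family of reals *)

Section Lipschitz.
Context {R : realType} {I : Type}.
Implicit Types (f g : (I -> R) -> R) (x y : I -> R).

(** The number [d] stands for the sup norm of the difference, so that no norm on [I -> R] has to be
    introduced. *)
Definition lipschitz_fct f := exists2 K, 0 <= K & forall x y d, 0 <= d ->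
  (forall j, `|x j - y j| <= d) -> `|f x - f y| <= K * d.

Definition bounded_fct f := exists2 M, 0 <= M & forall x, `|f x| <= M.

Definition bdlip f := bounded_fct f /\ lipschitz_fct f.

Lemma lipschitz_coord i : lipschitz_fct (fun x => x i).
Proof. by exists 1 => // x y d d0; rewrite mul1r; apply. Qed.

Lemma lipschitz_cst (a : R) : lipschitz_fct (fun=> a).
Proof. by exists 0 => // x y d d0 _; rewrite subrr normr0 mul0r. Qed.

Lemma lipschitzD f g : lipschitz_fct f -> lipschitz_fct g ->
  lipschitz_fct (fun x => f x + g x).
Proof.
move=> [K K0 fK] [L L0 gL]; exists (K + L) => [|x y d d0 xy]; first exact: addr_ge0.
rewrite opprD addrACA mulrDl.
by apply: (le_trans (ler_normD _ _)); rewrite lerD ?fK ?gL.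
Qed.

Lemma lipschitzZ (a : R) f : lipschitz_fct f -> lipschitz_fct (fun x => a * f x).
Proof.
move=> [K K0 fK]; exists (`|a| * K) => [|x y d d0 xy]; first exact: mulr_ge0.
by rewrite -mulrBr normrM -mulrA ler_wpM2l// fK.
Qed.

Lemma bdlip_cst (a : R) : bdlip (fun=> a).
Proof. by split; [exists `|a| |exact: lipschitz_cst]. Qed.

Lemma bdlipD f g : bdlip f -> bdlip g -> bdlip (fun x => f x + g x).
Proof.
move=> [[M M0 fM] fL] [[N N0 gN] gL]; split; last exact: lipschitzD.
exists (M + N) => [|x]; first exact: addr_ge0.
by apply: (le_trans (ler_normD _ _)); rewrite lerD.
Qed.

Lemma bdlipM f g : bdlip f -> bdlip g -> bdlip (fun x => f x * g x).
Proof.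
move=> [[M M0 fM] [K K0 fK]] [[N N0 gN] [L L0 gL]]; split.
  exists (M * N) => [|x]; first exact: mulr_ge0.
  by rewrite normrM ler_pM.
exists (M * L + K * N) => [|x y d d0 xy]; first by rewrite addr_ge0// mulr_ge0.
rewrite [X in `|X|](_ : _ = f x * (g x - g y) + (f x - f y) * g y); last by ring.
apply: (le_trans (ler_normD _ _)); rewrite !normrM mulrDl lerD//.
  by rewrite -mulrA ler_pM// gL.
by rewrite mulrAC ler_pM// fK.
Qed.

(* Truncating at [e] makes the reciprocal bounded and Lipschitz. *)
Definition inv_trunc (e a : R) : R := (Order.max a e)^-1.

Lemma bdlip_inv_trunc e f : 0 < e -> lipschitz_fct f ->
  bdlip (fun x => inv_trunc e (f x)).
Proof.
move=> e0 [K K0 fK].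
have m0 (a : R) : 0 < Order.max a e by rewrite lt_max e0 orbT.
have me (a : R) : (Order.max a e)^-1 <= e^-1.
  by rewrite lef_pV2 ?posrE// le_max lexx orbT.
split.
  exists e^-1 => [|x]; first by rewrite invr_ge0 ltW.
  by rewrite ger0_norm /inv_trunc ?invr_ge0 ?(ltW (m0 _)).
exists (e^-1 * e^-1 * K) => [|x y d d0 xy]; first by rewrite !mulr_ge0// invr_ge0 ltW.
rewrite /inv_trunc.
have -> : (Order.max (f x) e)^-1 - (Order.max (f y) e)^-1 =
    ((Order.max (f x) e)^-1 * (Order.max (f y) e)^-1) *
    (Order.max (f y) e - Order.max (f x) e).
  by field; rewrite !gt_eqF.
rewrite normrM -[leRHS]mulrA; apply: ler_pM => //.
  by rewrite ger0_norm ?mulr_ge0 ?invr_ge0 ?(ltW (m0 _))// ler_pM ?invr_ge0 ?(ltW (m0 _)).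
apply: le_trans (fK x y d d0 xy).
have h1 := ler_norm (f x - f y); have h2 := ler_norm (f y - f x).
rewrite distrC in h2; rewrite ler_norml /Order.max.
by do 2 case: ltP => ?; apply/andP; split; lra.
Qed.

End Lipschitz.

(** * The system for the heights of the sides *)

Section CurvatureSystem.
Context {R : realType} {I : finType} (nx pv : I -> I).
Hypotheses (nxK : cancel nx pv) (pvK : cancel pv nx).
(* At vertex [i], between the segments [pv i] and [i], [s i] and [k i] are the
   sine and the cotangent of the angle; [q], [F], [c], [dl], [l0] are the dual
   norm of the normal, the facet length, the transition number, the weight
   [delta] and the initial length. *)
Variables (q F c dl s k l0 : I -> R) (alpha : R).

(** One expression with two roles: applied to the heights it is the loss of length of side [i] (see
    [len]), applied to the weights [wgt] it is the bracket in the flow equation. *)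
Definition adj (x : I -> R) (i : I) : R :=
  x (pv i) / s i + x i * (k i + k (nx i)) + x (nx i) / s (nx i).

Definition len (x : I -> R) (i : I) : R := l0 i - adj x i.

Definition wgt (L : I -> R) (j : I) : R := c j ^+ 2 * dl j / L j ^+ 2.

Definition vel (L : I -> R) (i : I) : R :=
  - q i * (c i * F i / L i + alpha / L i * adj (wgt L) i).

Definition solution (T : \bar R) (h : I -> R -> R) : Prop :=
  [/\ forall i, h i 0 = 0,
      forall i, {within [set t : R | 0 <= t /\ (t%:E < T)%E], continuous (h i)},
      forall i (t : R), 0 < t -> (t%:E < T)%E ->
        is_derive t 1 (h i) (vel (len (h ^~ t)) i) &
      forall i (t : R), 0 <= t -> (t%:E < T)%E -> 0 < len (h ^~ t) i].

(** The coefficient that couples [i] and [nx i] is [1 / s (nx i)] seen from either side; reindexing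
    along [pv] exchanges the two off-diagonal sums. *)
Lemma adj_sym (x y : I -> R) : \sum_i y i * adj x i = \sum_i x i * adj y i.
Proof.
have E (u v : I -> R) : \sum_i v i * adj u i = \sum_i (v (nx i) * u i / s (nx i))
   + \sum_i (u i * v i * (k i + k (nx i))) + \sum_i (u (nx i) * v i / s (nx i)).
  rewrite [X in _ = X + _ + _](reindex_inj (can_inj pvK)) -!big_split /=.
  by apply: eq_bigr => i _; rewrite /adj pvK; ring.
rewrite !E addrAC [RHS]addrAC; congr (_ + _); last first.
  by apply: eq_bigr => i _; ring.
by rewrite addrC; congr (_ + _); apply: eq_bigr => i _; ring.
Qed.

(** The velocity with every reciprocal length truncated: bounded and Lipschitz everywhere, and equal
    to [vel] as long as all lengths are at least [e]. The inverse square is written as a product so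
    that [bdlipM] applies. *)
Let tvel e (x : I -> R) (i : I) : R :=
  - q i * (c i * F i * inv_trunc e (len x i) + alpha * inv_trunc e (len x i) *
   adj (fun j => c j ^+ 2 * dl j * (inv_trunc e (len x j) * inv_trunc e (len x j))) i).

Let tvel_vel e x : (forall i, e <= len x i) -> tvel e x = vel (len x).
Proof.
move=> ex; apply/funext => i; rewrite /tvel /vel /inv_trunc max_l//.
rewrite [adj _ i](_ : _ = adj (wgt (len x)) i)//; congr adj; apply/funext => j.
by rewrite max_l// /wgt -invfM -expr2.
Qed.

Lemma adj_lipschitz i : lipschitz_fct (adj ^~ i).
Proof.
apply: lipschitzD; first apply: lipschitzD.
- under [X in lipschitz_fct X]eq_fun do rewrite mulrC.
  by apply: lipschitzZ; exact: lipschitz_coord.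
- under [X in lipschitz_fct X]eq_fun do rewrite mulrC.
  by apply: lipschitzZ; exact: lipschitz_coord.
- under [X in lipschitz_fct X]eq_fun do rewrite mulrC.
  by apply: lipschitzZ; exact: lipschitz_coord.
Qed.

Lemma len_lipschitz i : lipschitz_fct (len ^~ i).
Proof.
apply: lipschitzD; first exact: lipschitz_cst.
under [X in lipschitz_fct X]eq_fun do rewrite -mulN1r.
by apply: lipschitzZ; exact: adj_lipschitz.
Qed.

Let tvel_bdlip e i : 0 < e -> bdlip (tvel e ^~ i).
Proof.
move=> e0; rewrite /tvel /adj.
have t j : bdlip (fun x => inv_trunc e (len x j)).
  by apply: bdlip_inv_trunc => //; exact: len_lipschitz.
by do ?[exact: t | exact: bdlip_cst | apply: bdlipD | apply: bdlipM].
Qed.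

Let tvel_bounds e : 0 < e -> exists MK : R * R, [/\ 1 <= MK.2, 0 <= MK.1,
  forall x i, `|tvel e x i| <= MK.1 &
  forall x y (d : R), (forall j, `|x j - y j| <= d) ->
    forall i, `|tvel e x i - tvel e y i| <= MK.2 * d].
Proof.
move=> e0.
have [M M0 tM] : exists2 M, 0 < M & forall i x, `|tvel e x i| <= M.
  apply: (@finite_ub _ _ (fun i M => forall x, `|tvel e x i| <= M)).
    by move=> i; have [[M _ tM] _] := tvel_bdlip i e0; exists M.
  by move=> i d b db tM x; exact: le_trans db.
have [K K0 tK] : exists2 K, 0 < K & forall i x y (d : R), 0 <= d ->
    (forall j, `|x j - y j| <= d) -> `|tvel e x i - tvel e y i| <= K * d.
  apply: (@finite_ub _ _ (fun i K => forall x y (d : R), 0 <= d ->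
    (forall j, `|x j - y j| <= d) -> `|tvel e x i - tvel e y i| <= K * d)).
    by move=> i; have [_ [K _ tK]] := tvel_bdlip i e0; exists K.
  move=> i K1 K2 K12 tK x y d d0 xy; apply: (le_trans (tK _ _ _ d0 xy)).
  by rewrite ler_wpM2r.
exists (M, Order.max 1 K); split => /=.
- by rewrite le_max lexx.
- exact: ltW.
- by move=> x i; exact: tM.
move=> x y d xy i.
have d0 : 0 <= d by apply: le_trans (xy i).
apply: (le_trans (tK i x y d d0 xy)).
by rewrite ler_wpM2r// le_max lexx orbT.
Qed.

Lemma lipschitz_cvg (S : Type) (G : set_system S) {FG : Filter G}
    (phi : (I -> R) -> R) (h : I -> S -> R) (a : I -> R) :
  lipschitz_fct phi -> (forall i, h i t @[t --> G] --> a i) ->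
  phi (h ^~ t) @[t --> G] --> phi a.
Proof.
move=> [K K0 phiK] ch; apply/cvgrPdist_le => e e0.
have K1 : 0 < K + 1 by rewrite ltr_wpDl.
have d0 : 0 < e / (K + 1) by rewrite divr_gt0.
have H i : \forall t \near G, `|a i - h i t| <= e / (K + 1).
  by have /cvgrPdist_le/(_ _ d0) := ch i.
have : \forall t \near G, forall i, `|a i - h i t| <= e / (K + 1).
  exact: filter_forall.
apply: filterS => t hxt; apply: (le_trans (phiK _ _ _ (ltW d0) hxt)).
by rewrite mulrA ler_pdivrMr// mulrC ler_wpM2l ?(ltW e0)// lerDl.
Qed.

Lemma len_continuous (h : I -> R -> R) (A : set R) i :
  (forall i, {within A, continuous (h i)}) ->
  {within A, continuous (fun t => len (h ^~ t) i)}.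
Proof.
move=> ch x; apply: (@lipschitz_cvg _ (nbhs (x : subspace A)) _ (len ^~ i) h (h ^~ x)).
  exact: len_lipschitz.
by move=> j; exact: ch.
Qed.

Lemma solution_len_lb T h (t : R) : solution T h -> 0 <= t -> (t%:E < T)%E ->
  exists2 e, 0 < e & forall r i, 0 <= r <= t -> e <= len (h ^~ r) i.
Proof.
move=> [_ ch _ hpos] t0 tT.
have [|i d e de He r rt|e e0 eP] := @finite_pos_lb R I
    (fun i e => forall r, 0 <= r <= t -> e <= len (h ^~ r) i).
- move=> i.
  have cl : {within `[0, t], continuous (fun t => len (h ^~ t) i)}.
    apply: len_continuous => j; apply: continuous_subspaceW (ch j) => r /=.
    rewrite in_itv/= => /andP[r0 rt]; split => //.
    by apply: le_lt_trans tT; rewrite lee_fin.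
  have [r] := EVT_min t0 cl; rewrite in_itv/= => /andP[r0 rt] rmin.
  exists (len (h ^~ r) i); last by move=> r' r't; apply: rmin; rewrite in_itv.
  by apply: hpos => //; apply: le_lt_trans tT; rewrite lee_fin.
- exact: le_trans (He r rt).
by exists e => // r i; exact: eP.
Qed.

Lemma solution_restrict T T' h : (0 < T')%E -> (T' <= T)%E -> solution T h ->
  solution T' h.
Proof.
move=> T'0 T'T [h0 ch dh hpos]; split => //.
- move=> i; apply: continuous_subspaceW (ch i) => t /= [t0 tT']; split => //.
  exact: lt_le_trans T'T.
- by move=> i t t0 tT'; apply: dh => //; exact: lt_le_trans T'T.
- by move=> i t t0 tT'; apply: hpos => //; exact: lt_le_trans T'T.
Qed.

Let trunc_unique e (b : R) (u v : I -> R -> R) : 0 < e ->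
  (forall i, u i 0 = v i 0) ->
  (forall i, {within `[0, b], continuous u i}) ->
  (forall i, {within `[0, b], continuous v i}) ->
  (forall i (t : R), 0 < t < b -> is_derive t 1 (u i) (tvel e (u ^~ t) i)) ->
  (forall i (t : R), 0 < t < b -> is_derive t 1 (v i) (tvel e (v ^~ t) i)) ->
  forall t : R, 0 <= t <= b -> forall i, u i t = v i t.
Proof.
move=> e0; have [[M K] [/= K1 M0 tM tK]] := tvel_bounds e0.
exact: (@ode_unique R I (tvel e) M K).
Qed.

Let solution_trunc e T h (b : R) : 0 < e -> solution T h -> (b%:E < T)%E ->
  (forall r i, 0 <= r <= b -> e <= len (h ^~ r) i) ->
  (forall i, {within `[0, b], continuous h i}) /\
  (forall i (t : R), 0 < t < b -> is_derive t 1 (h i) (tvel e (h ^~ t) i)).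
Proof.
move=> e0 [h0 ch dh hpos] bT be; split => [i|i t /andP[t0 tb]].
  apply: continuous_subspaceW (ch i) => r /=.
  rewrite in_itv/= => /andP[r0 rt]; split => //.
  by apply: le_lt_trans bT; rewrite lee_fin.
rewrite tvel_vel; last by move=> j; apply: be; rewrite !ltW.
by apply: dh => //; apply: lt_trans bT; rewrite lte_fin.
Qed.

(** Up to time [t] both solutions keep their lengths above a common positive level, where truncation
    at that level changes nothing; hence both solve the same truncated system. *)
Lemma solution_unique T T' h h' : solution T h -> solution T' h' ->
  forall t : R, 0 <= t -> (t%:E < T)%E -> (t%:E < T')%E -> h ^~ t = h' ^~ t.
Proof.
move=> sh sh' t t0 tT tT'; apply/funext => i.
have [e e0 eP] := solution_len_lb sh t0 tT.
have [e' e'0 e'P] := solution_len_lb sh' t0 tT'.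
have m0 : 0 < Order.min e e' by rewrite lt_min e0.
have [|ch dh] := solution_trunc m0 sh tT.
  by move=> r j rt; rewrite ge_min eP.
have [|ch' dh'] := solution_trunc m0 sh' tT'.
  by move=> r j rt; rewrite ge_min e'P ?orbT.
apply: (@trunc_unique (Order.min e e') t h h') => //; last by rewrite t0 lexx.
by move=> j; case: sh => ->; case: sh' => ->.
Qed.

Let trunc_global e : 0 < e -> exists u : I -> R -> R, (forall i, u i 0 = 0) /\
  forall i (t : R), 0 <= t -> is_derive t 1 (u i) (tvel e (u ^~ t) i).
Proof.
move=> e0; have [[M K] [/= K1 M0 tM tK]] := tvel_bounds e0.
exact: (@ode_exists R I (tvel e) M K K1 M0 tM tK (fun=> 0)).
Qed.

Let trunc_solution e (u : I -> R -> R) (b : R) : 0 < e -> (forall i, u i 0 = 0) ->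
  (forall i (t : R), 0 <= t -> is_derive t 1 (u i) (tvel e (u ^~ t) i)) ->
  (forall (t : R) i, 0 <= t -> t < b -> e <= len (u ^~ t) i) ->
  solution b%:E u.
Proof.
move=> e0 u0 du ue; split => //.
- move=> i; apply: continuous_in_subspaceT => t; rewrite inE/= => -[t0 _].
  exact: is_derive1_continuous (du i t t0).
- move=> i t t0; rewrite lte_fin => tb.
  rewrite -(@tvel_vel e); last by move=> j; apply: ue => //; exact: ltW.
  by apply: du; exact: ltW.
- by move=> i t t0; rewrite lte_fin => tb; apply: lt_le_trans (ue _ _ t0 tb).
Qed.

Let near_len_close (u : I -> R -> R) (x e : R) : 0 < e ->
  (forall i, {for x, continuous (u i)}) ->
  exists2 d, 0 < d & forall r : R, `|x - r| < d ->
    forall i, `|len (u ^~ x) i - len (u ^~ r) i| < e.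
Proof.
move=> e0 cu.
have H i : \forall r \near x, `|len (u ^~ x) i - len (u ^~ r) i| < e.
  have H := @lipschitz_cvg _ (nbhs x) (nbhs_filter x) (len ^~ i) u (u ^~ x) (len_lipschitz i) cu.
  by move/cvgrPdist_lt: H => /(_ _ e0).
have [d /= d0 dP] : \forall r \near x, forall i, `|len (u ^~ x) i - len (u ^~ r) i| < e.
  exact: (@filter_forall _ I _ _ (nbhs_filter x) H).
by exists d.
Qed.

(* A solution whose lengths stay above [e] solves the system truncated at
   [e / 2], and that system has a global solution. *)
Lemma solution_extend (T : R) h e : solution T%:E h -> 0 < T -> 0 < e ->
  (forall (t : R) i, 0 <= t -> t < T -> e <= len (h ^~ t) i) ->
  exists T' h', [/\ T < T', solution T'%:E h' & forall (t : R), 0 <= t < T -> h' ^~ t = h ^~ t].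
Proof.
move=> sh T0 e0 he.
have e20 : 0 < e / 2 by rewrite divr_gt0.
have [u [u0 du]] := trunc_global e20.
have uc i (t : R) : 0 <= t -> {for t, continuous (u i)}.
  by move=> t0; exact: is_derive1_continuous (du i t t0).
have uh (t : R) : 0 <= t < T -> u ^~ t = h ^~ t.
  move=> /andP[t0 tT]; apply/funext => i; symmetry.
  have tT' : (t%:E < T%:E)%E by rewrite lte_fin.
  have [|ch dh] := solution_trunc e20 sh tT'.
    move=> r j /andP[r0 rt]; apply: (@le_trans _ _ e); first by lra.
    by apply: he => //; exact: le_lt_trans tT.
  apply: (@trunc_unique (e / 2) t h u) => //; last by rewrite t0 lexx.
  - by move=> j; case: sh => ->.
  - move=> j; apply: is_derive_within_continuous => r /andP[r0 _]; exact: du.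
  - by move=> j r /andP[/ltW r0 _]; exact: du.
have [d d0 dP] := near_len_close (divr_gt0 e0 (ltr0Sn _ 3)) (fun i => uc i T (ltW T0)).
have T1 r i : 0 <= r -> T - r < d -> r < T + d -> e / 2 <= len (u ^~ r) i.
  move=> r0 rd1 rd2.
  have [rT|Tr] := ltP r T; first by rewrite uh ?r0//; apply: (@le_trans _ _ e); [lra|exact: he].
  (* No bound is given at [T] itself. It is carried over from a time [m < T] within [d / 2] of [T],
     losing [e / 4] from [m] to [T] and again [e / 4] from [T] to [r]. *)
  pose m := Order.max 0 (T - d / 2).
  have mT : m < T by rewrite gt_max T0/=; lra.
  have m0 : 0 <= m by rewrite le_max lexx.
  have mm : T - d / 2 <= m by rewrite le_max lexx orbT.
  have h1 := he m i m0 mT; rewrite -uh ?m0// in h1.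
  have /(_ i) h2 : forall i, `|len (u ^~ T) i - len (u ^~ m) i| < e / 4.
    by apply: dP; rewrite ger0_norm; lra.
  have /(_ i) h3 : forall i, `|len (u ^~ T) i - len (u ^~ r) i| < e / 4.
    by apply: dP; rewrite ler0_norm; lra.
  by move: h2 h3; rewrite !ltr_norml => /andP[? ?] /andP[? ?]; lra.
exists (T + d), u; split => //; first by rewrite ltrDl.
apply: (@trunc_solution (e / 2)) => // r i r0 rTd.
have [rT|Tr] := ltP r T; last by apply: T1 => //; lra.
by rewrite uh ?r0//; apply: (@le_trans _ _ e); [lra|exact: he].
Qed.

Lemma solution_local : (forall i, 0 < l0 i) ->
  exists (T : R) h, 0 < T /\ solution T%:E h.
Proof.
move=> l0pos.
have [e e0 eP] : exists2 e, 0 < e & forall i, e <= l0 i.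
  apply: (@finite_pos_lb _ _ (fun i e => e <= l0 i)); first by move=> i; exists (l0 i).
  by move=> i d e'; exact: le_trans.
have e20 : 0 < e / 2 by rewrite divr_gt0.
have [u [u0 du]] := trunc_global e20.
have cu i : {for 0, continuous (u i)} by exact: is_derive1_continuous (du i 0 (lexx 0)).
have len0 i : len (u ^~ 0) i = l0 i.
  by rewrite /len /adj !u0; ring.
have [d d0 dP] := near_len_close e20 cu.
exists d, u; split => //; apply: (@trunc_solution (e / 2)) => // r i r0 rd.
have := dP r; rewrite sub0r normrN ger0_norm// => /(_ rd i).
by rewrite len0 ltr_norml => /andP[_]; have := eP i; lra.
Qed.

(** Any two solutions agree where both are defined, so that at each time below the supremum any
    solution living longer can be used to define the common one. *)
Lemma maximal_solution_ex : (forall i, 0 < l0 i) -> exists T h,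
  [/\ (0 < T)%E, solution T h &
      forall T' h', (0 < T')%E -> solution T' h' -> (T' <= T)%E].
Proof.
move=> l0pos.
pose S := [set t : R | 0 < t /\ exists h, solution t%:E h].
pose T := ereal_sup [set t%:E | t in S].
have ST (t : R) : (t%:E < T)%E -> exists2 r, t < r & S r.
  move=> tT; have [_ [r Sr <-] tr] := ereal_sup_gt tT.
  by exists r => //; rewrite -lte_fin.
pose sel (t : R) : I -> R -> R := xget (fun=> cst 0)
  [set h | exists2 r, t < r & solution r%:E h].
have selP (t : R) : (t%:E < T)%E -> exists2 r, t < r & solution r%:E (sel t).
  move=> /ST[r tr [_ [h sh]]]; rewrite /sel.
  by case: xgetP => [h' _ //|/(_ h)[]]; exists r.
pose H (i : I) (t : R) : R := sel t i t.
have HE (r : R) h : 0 < r -> solution r%:E h -> (r%:E <= T)%E ->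
    forall t : R, 0 <= t < r -> H ^~ t = h ^~ t.
  move=> r0 sh rT t /andP[t0 tr].
  have [|r' tr' sr'] := selP t; first by apply: lt_le_trans rT; rewrite lte_fin.
  by rewrite -(solution_unique sr' sh) ?lte_fin.
have rT (r : R) h : 0 < r -> solution r%:E h -> (r%:E <= T)%E.
  by move=> r0 sh; apply: ereal_sup_ubound; exists r => //; split => //; exists h.
have T0 : (0 < T)%E.
  have [r [h [r0 sh]]] := solution_local l0pos.
  by apply: lt_le_trans (rT _ _ r0 sh); rewrite lte_fin.
exists T, H; split => //.
  split.
  - move=> i; have [r r0 [_ [h sh]]] := ST 0 T0.
    have := HE r h r0 sh (rT _ _ r0 sh) 0; rewrite lexx r0 => /(_ isT)/(congr1 (@^~ i))->.
    by case: sh => ->.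
  - move=> i; apply/subspace_continuousP => t /= [t0 tT].
    have [r tr [r0 [h sh]]] := ST t tT.
    have Hh := HE r h r0 sh (rT _ _ r0 sh).
    have : h i u @[u --> within [set t : R | 0 <= t /\ (t%:E < r%:E)%E] (nbhs t)] --> h i t.
      have [_ ch _ _] := sh; move/subspace_continuousP: (ch i); apply.
      by rewrite /= lte_fin.
    move=> /cvgrPdist_lt hu; apply/cvgrPdist_lt => e e0.
    have := hu e e0; rewrite !near_withinE.
    apply: filterS2 (lt_nbhsl tr) => u ur hue [u0 uT].
    have := hue (conj u0 _); rewrite lte_fin => /(_ ur).
    by rewrite -(congr1 (@^~ i) (Hh u _)) ?u0// -(congr1 (@^~ i) (Hh t _)) ?t0.
  - move=> i t t0 tT; have [r tr [r0 [h sh]]] := ST t tT.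
    have Hh := HE r h r0 sh (rT _ _ r0 sh).
    rewrite Hh ?(ltW t0)//.
    case: (sh) => _ _ dh _; apply: near_eq_is_derive (dh i t t0 _); rewrite ?lte_fin//.
    near=> u; symmetry; apply: (congr1 (@^~ i) (Hh u _)).
    by apply/andP; split; near: u; [exact: lt_le_nbhsr|exact: lt_nbhsl].
  - move=> i t t0 tT; have [r tr [r0 [h sh]]] := ST t tT.
    rewrite (HE r h) ?t0 ?rT//; first by case: sh => _ _ _; apply; rewrite ?lte_fin.
    exact: rT sh.
move=> T' h' T'0 sh'; apply: contrapT => /negP; rewrite -ltNge => TT'.
(* [T'] may be infinite, whereas the supremum that defines [T] runs over real times. *)
have [r [Tr rT']] : exists r : R, (T < r%:E)%E /\ (r%:E <= T')%E.
  case: T' TT' {T'0 sh'} => [r Tr| |]; [by exists r| |by case: (T)].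
  case: (T) T0 => [r _ _|//|//]; exists (r + 1).
  by rewrite lte_fin ltrDl leey.
have r0 : (0 < r%:E)%E by exact: lt_trans Tr.
have := rT r h' r0 (solution_restrict r0 rT' sh').
by rewrite leNgt Tr.
Unshelve. all: by end_near. Qed.

End CurvatureSystem.

(** * Left limits, sums of derivatives and a smooth absolute value *)

Lemma nonincreasing_left_cvg {R : realType} (f : R -> R) (a b m : R) : a < b ->
  (forall s t, a <= s -> s <= t -> t < b -> f t <= f s) ->
  (forall t, a <= t < b -> m <= f t) -> cvg (f t @[t --> b^'-]).
Proof.
move=> ab fdec fm.
have H : cvg ((- f t) @[t --> b^'-]).
  apply: nondecreasing_at_left_is_cvgr; near=> c.
    move=> x y; rewrite !in_itv/= => /andP[cx xb] /andP[cy yb] xy.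
    rewrite lerN2 fdec//; apply: le_trans (ltW cx); near: c.
    exact: nbhs_left_ge.
  exists (- m) => z /= [y]; rewrite in_itv/= => /andP[cy yb] <-.
  rewrite lerN2 fm// yb andbT; apply: le_trans (ltW cy); near: c.
  exact: nbhs_left_ge.
have -> : f = (fun t => - (- f t)) by apply/funext => t; rewrite opprK.
exact: is_cvgN.
Unshelve. all: by end_near. Qed.

Lemma is_derive1_sum {R : realType} (J : Type) (r : seq J) (P : pred J)
    (f : J -> R -> R) (df : J -> R) (t : R) :
  (forall j, P j -> is_derive t 1 (f j) (df j)) ->
  is_derive t 1 (fun x => \sum_(j <- r | P j) f j x) (\sum_(j <- r | P j) df j).
Proof.
move=> fdf; elim: r => [|j r IH].
  rewrite big_nil; under eq_fun do rewrite big_nil; exact: is_derive_cst.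
rewrite big_cons; under eq_fun do rewrite big_cons.
case: ifP => // Pj.
by have := @is_deriveD _ _ _ (f j) _ t 1 _ _ (fdf j Pj) IH; exact.
Qed.

Lemma is_derive1_inv {R : realType} (f : R -> R) (df t : R) : f t != 0 ->
  is_derive t 1 f df -> is_derive t 1 (fun x => (f x)^-1) (- df / f t ^+ 2).
Proof.
move=> f0 [fd <-]; apply: DeriveDef; first exact: derivableV.
by rewrite deriveV// /GRing.scale/= mulNr mulrC mulNr.
Qed.

(** At [e = 0] this is the absolute value, so that one functional covers both the smooth
    approximations and their limit. *)
Definition soft_abs {R : realType} (e x : R) : R := Num.sqrt (x ^+ 2 + e ^+ 2).

Definition soft_sg {R : realType} (e x : R) : R := x / soft_abs e x.

Lemma is_derive_soft_abs {R : realType} (e : R) (f : R -> R) (df t : R) : 0 < e ->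
  is_derive t 1 f df ->
  is_derive t 1 (fun x => soft_abs e (f x)) (soft_sg e (f t) * df).
Proof.
move=> e0 dft; rewrite /soft_abs.
have p0 : 0 < f t ^+ 2 + e ^+ 2 by rewrite ltr_wpDl ?sqr_ge0// exprn_gt0.
have H := is_derive1_sqrt p0.
apply: is_derive_eq.
rewrite /soft_sg /soft_abs /GRing.scale/=.
by field; rewrite gt_eqF// sqrtr_gt0.
Qed.

Lemma soft_abs_gt0 {R : realType} (e x : R) : 0 < e -> 0 < soft_abs e x.
Proof. by move=> e0; rewrite sqrtr_gt0 ltr_wpDl ?sqr_ge0// exprn_gt0. Qed.

Lemma soft_abs_ge {R : realType} (e x : R) : `|x| <= soft_abs e x.
Proof. by rewrite -sqrtr_sqr ler_wsqrtr// lerDl sqr_ge0. Qed.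

Lemma soft_abs_le {R : realType} (e x : R) : 0 < e -> soft_abs e x <= `|x| + e.
Proof.
move=> e0; rewrite -[leRHS]ger0_norm ?addr_ge0 ?(ltW e0)// -sqrtr_sqr ler_wsqrtr//.
by rewrite sqrrD -[`|x| ^+ 2]normrX ger0_norm ?sqr_ge0// lerD2r lerDl mulrn_wge0// mulr_ge0 ?(ltW e0).
Qed.

Lemma soft_sgN {R : realType} (e x : R) : soft_sg e (- x) = - soft_sg e x.
Proof. by rewrite /soft_sg /soft_abs sqrrN mulNr. Qed.

Lemma soft_sg_le1 {R : realType} (e x : R) : 0 < e -> `|soft_sg e x| <= 1.
Proof.
move=> e0; rewrite normrM normfV (gtr0_norm (soft_abs_gt0 x e0)).
by rewrite ler_pdivrMr ?soft_abs_gt0// mul1r soft_abs_ge.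
Qed.

Lemma soft_sg_mono {R : realType} (e x y : R) : 0 < e -> x <= y ->
  soft_sg e x <= soft_sg e y.
Proof.
move=> e0; have pos (a b : R) : 0 <= a -> a <= b -> soft_sg e a <= soft_sg e b.
  move=> a0 ab; have b0 : 0 <= b by exact: le_trans ab.
  have A0 := soft_abs_gt0 a e0; have B0 := soft_abs_gt0 b e0.
  have A2 : soft_abs e a ^+ 2 = a ^+ 2 + e ^+ 2 by rewrite sqr_sqrtr// addr_ge0 ?sqr_ge0.
  have B2 : soft_abs e b ^+ 2 = b ^+ 2 + e ^+ 2 by rewrite sqr_sqrtr// addr_ge0 ?sqr_ge0.
  have ab2 : a ^+ 2 <= b ^+ 2 by rewrite ler_pXn2r ?nnegrE.
  rewrite /soft_sg ler_pdivrMr// mulrAC ler_pdivlMr//.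
  have aB : 0 <= a * soft_abs e b by rewrite mulr_ge0// ltW.
  have bA : 0 <= b * soft_abs e a by rewrite mulr_ge0// ltW.
  rewrite -(@ler_pXn2r _ 2) ?nnegrE// !exprMn A2 B2 !mulrDr (mulrC (b ^+ 2) (a ^+ 2)).
  by rewrite lerD2l ler_wpM2r ?sqr_ge0.
move=> xy; have [x0|/ltW x0] := leP 0 x; first exact: pos.
have [y0|/ltW y0] := leP 0 y; last first.
  by rewrite -lerN2 -!soft_sgN pos ?oppr_ge0// lerN2.
apply: (@le_trans _ _ 0); last by rewrite mulr_ge0// invr_ge0 ltW// soft_abs_gt0.
by rewrite mulr_le0_ge0// invr_ge0 ltW// soft_abs_gt0.
Qed.

(** The price of the smoothing: where [soft_sg] is far from being a sign, [x] itself is of order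
    [e]. *)
Lemma soft_sg_defect {R : realType} (e x : R) : 0 < e ->
  `|x| * (1 - `|soft_sg e x|) <= e.
Proof.
move=> e0; have X0 := soft_abs_gt0 x e0.
rewrite normrM normfV (gtr0_norm X0).
have -> : `|x| * (1 - `|x| / soft_abs e x) = `|x| * (soft_abs e x - `|x|) / soft_abs e x.
  by field; rewrite gt_eqF.
rewrite ler_pdivrMr// mulrC ler_pM ?subr_ge0 ?soft_abs_ge//.
by rewrite lerBlDl soft_abs_le.
Qed.

(** * Behaviour at the maximal time *)

Section Estimates.
Context {R : realType} {I : finType} (nx pv : I -> I).
Hypotheses (nxK : cancel nx pv) (pvK : cancel pv nx).
Variables (q F c dl s k l0 : I -> R) (alpha : R).
Hypotheses (q0 : forall i, 0 < q i) (alpha0 : 0 < alpha).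
Hypotheses (F0 : forall i, 0 < F i) (dlE : forall i, dl i = F i ^+ 2 * q i).
Hypothesis c01 : forall i, c i = 0 \/ c i ^+ 2 = 1.
Hypotheses (s0 : forall i, s i != 0) (s1 : forall i, `|s i| <= 1).
(** A side with [c i = 0] makes opposite turns at its two ends, so that its neighbours have the same
    normal, hence the same facet and weight; see [flow_transition0]. *)
Hypothesis c_eq0 : forall i, c i = 0 ->
  [/\ s (nx i) = - s i, k i + k (nx i) = 0 & dl (pv i) = dl (nx i)].

Notation adj := (adj nx pv s k).
Notation len := (len nx pv s k l0).
Notation wgt := (wgt c dl).
Notation vel := (vel nx pv q F c dl s k alpha).
Notation solution := (solution nx pv q F c dl s k l0 alpha).

Let dl0 i : 0 < dl i. Proof. by rewrite dlE mulr_gt0// exprn_gt0. Qed.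

Lemma is_derive_adj (h : I -> R -> R) (v : I -> R) (t : R) i :
  (forall i, is_derive t 1 (h i) (v i)) ->
  is_derive t 1 (fun t => adj (h ^~ t) i) (adj v i).
Proof.
move=> dh; rewrite /(adj _ _).
apply: is_derive_eq.
by rewrite /GRing.scale/=; ring.
Qed.

Lemma is_derive_len (h : I -> R -> R) (v : I -> R) (t : R) i :
  (forall i, is_derive t 1 (h i) (v i)) ->
  is_derive t 1 (fun t => len (h ^~ t) i) (- adj v i).
Proof.
move=> dh; rewrite /(len _ _).
have da := is_derive_adj i dh.
have := @is_deriveB _ _ _ (cst (l0 i)) _ t 1 _ _ (is_derive_cst _ _ _) da.
by rewrite sub0r.
Qed.

Section Solution.
Context (T : R) (h : I -> R -> R) (a : R).
Hypotheses (sh : solution T%:E h) (a0 : 0 < a) (aT : a < T).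

Let L (t : R) := len (h ^~ t).

Let v (t : R) := vel (L t).

Let dh (t : R) i : 0 < t -> t < T -> is_derive t 1 (h i) (v t i).
Proof. by move=> t0 tT; case: sh => _ _ dh _; apply: dh; rewrite ?lte_fin. Qed.

Let L0 t i : 0 < t -> t < T -> 0 < L t i.
Proof. by move=> t0 tT; case: sh => _ _ _; apply; rewrite ?lte_fin// ltW. Qed.

Let dL (t : R) i : 0 < t -> t < T -> is_derive t 1 (fun t => L t i) (- adj (v t) i).
Proof. by move=> t0 tT; apply: is_derive_len => j; exact: dh. Qed.

Let energy (t : R) := \sum_i c i ^+ 2 * dl i / L t i.

Let d_energy (t : R) : 0 < t -> t < T ->
  is_derive t 1 energy (\sum_i v t i * adj (wgt (L t)) i).
Proof.
move=> t0 tT; rewrite (adj_sym pvK).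
apply: is_derive1_sum => i _.
have di := @is_derive1_inv _ (L ^~ i) _ _ (lt0r_neq0 (L0 i t0 tT)) (dL i t0 tT).
apply: is_derive_eq; rewrite /GRing.scale/= /(wgt _ _); field.
by rewrite gt_eqF// L0.
Qed.

(* Completing the square in [adj (wgt L) i]. *)
Let d_energy_le (t : R) : 0 < t -> t < T ->
  \sum_i v t i * adj (wgt (L t)) i <= energy t / (4 * alpha).
Proof.
move=> t0 tT; rewrite /energy mulr_suml; apply: ler_sum => i _.
rewrite /v /(vel _ _); set A := adj _ i.
rewrite -subr_ge0 dlE.
(* By [dlE] the constant left over by the square is exactly the term of index [i] of the energy
   divided by [4 * alpha]. *)
rewrite (_ : _ - _ = q i / L t i * alpha * (A + c i * F i / (2 * alpha)) ^+ 2).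
  by rewrite mulr_ge0 ?sqr_ge0// mulr_ge0 ?(ltW alpha0)// divr_ge0 ?ltW ?L0.
by field; rewrite !gt_eqF ?L0.
Qed.

Let energy_ge0 (t : R) : 0 < t -> t < T -> 0 <= energy t.
Proof.
move=> t0 tT; apply: sumr_ge0 => i _.
by rewrite divr_ge0 ?(ltW (L0 _ _ _))// mulr_ge0 ?sqr_ge0 ?(ltW (dl0 _)).
Qed.

(** Gronwall's inequality, started at a positive time [a] because the equation is only known at
    positive times. *)
Let energy_bound (t : R) : a <= t -> t < T ->
  energy t <= energy a * expR (t / (4 * alpha)).
Proof.
move=> at_ tT.
pose g (t : R) := energy t * expR (- t / (4 * alpha)).
pose b := (4 * alpha)^-1.
have gd (r : R) : a <= r <= t -> is_derive r 1 g
   ((\sum_i v r i * adj (wgt (L r)) i - energy r / (4 * alpha)) * expR (- r / (4 * alpha))).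
  move=> /andP[ar rt].
  have de := d_energy (lt_le_trans a0 ar) (le_lt_trans rt tT).
  by rewrite /g; apply: is_derive_eq; rewrite /GRing.scale/=; field; rewrite gt_eqF.
have : g t <= g a.
  apply: (derive_le0_le at_ (is_derive_within_continuous gd)).
    by move=> r /andP[ar rt]; apply: gd; rewrite !ltW.
  move=> r /andP[ar rt]; rewrite mulr_le0_ge0 ?expR_ge0// subr_le0 d_energy_le//.
    exact: lt_trans ar.
  exact: lt_trans tT.
rewrite /g !mulNr !expRN ler_pdivrMr ?expR_gt0// => /le_trans; apply.
rewrite ler_wpM2r ?expR_ge0// ler_pdivrMr ?expR_gt0// ler_peMr ?energy_ge0//.
apply: le_trans (expR_ge1Dx _).
by rewrite lerDl divr_ge0 ?mulr_ge0 ?ltW.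
Qed.

(** A side with [c i != 0] contributes [dl i / L t i] to the energy, which stays below [B]; the
    summand 1 only serves to make [B] positive. *)
Lemma len_lb_nonzero : exists2 e, 0 < e &
  forall (t : R) i, a <= t -> t < T -> c i != 0 -> e <= L t i.
Proof.
pose B := energy a * expR (T / (4 * alpha)) + 1.
have B0 : 0 < B by rewrite ltr_wpDl// mulr_ge0 ?energy_ge0 ?expR_ge0.
have [|i d e de He t at_ tT ci|e e0 eP] := @finite_pos_lb R I
    (fun i e => forall t, a <= t -> t < T -> c i != 0 -> e <= L t i).
- move=> i; exists (dl i / B); first exact: divr_gt0.
  move=> t at_ tT ci.
  have Lp := L0 i (lt_le_trans a0 at_) tT.
  rewrite ler_pdivrMr// mulrC -ler_pdivrMr//.
  have : energy t <= B.
    apply: (le_trans (energy_bound at_ tT)); rewrite /B ler_wpDr//.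
    rewrite ler_wpM2l ?energy_ge0// ler_expR ler_pM2r ?ltW//.
    by rewrite invr_gt0 mulr_gt0.
  apply: le_trans; rewrite /energy (bigD1 i)//=.
  have -> : c i ^+ 2 = 1 by case: (c01 i) => // ci0; rewrite ci0 eqxx in ci.
  rewrite mul1r lerDl sumr_ge0// => j _.
  rewrite divr_ge0 ?(ltW (L0 _ _ _)) ?(lt_le_trans a0)//.
  by rewrite mulr_ge0 ?sqr_ge0 ?(ltW (dl0 _)).
- exact: le_trans (He t at_ tT ci).
by exists e => // t i; exact: eP.
Qed.

Let c2 i : c i != 0 -> c i ^+ 2 = 1.
Proof. by case: (c01 i) => // ->; rewrite eqxx. Qed.

Let wgt0 t i : c i = 0 -> wgt (L t) i = 0.
Proof. by move=> ci; rewrite /(wgt _ _) ci expr0n/= !mul0r. Qed.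

Let wgtE t i : c i != 0 -> wgt (L t) i = dl i / L t i ^+ 2.
Proof. by move=> ci; rewrite /(wgt _ _) c2// mul1r. Qed.

Let adj_bound (x : I -> R) X i : (forall j, `|x j| <= X) ->
  `|adj x i| <= X * (`|s i|^-1 + `|k i + k (nx i)| + `|s (nx i)|^-1).
Proof.
move=> xX; rewrite !mulrDr; apply: (le_trans (ler_normD _ _)).
rewrite lerD//; last by rewrite normrM normfV ler_wpM2r ?invr_ge0.
apply: (le_trans (ler_normD _ _)).
by rewrite lerD// normrM ?normfV ler_wpM2r ?invr_ge0.
Qed.

Section LowerBound.
Context (m : R).
Hypothesis m0 : 0 < m.
Hypothesis Lm : forall (t : R) i, a <= t -> t < T -> c i != 0 -> m <= L t i.

Let wgt_bound : exists2 W, 0 < W & forall i t, a <= t -> t < T ->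
  `|wgt (L t) i| <= W.
Proof.
apply: (@finite_ub _ _ (fun i W => forall t, a <= t -> t < T -> `|wgt (L t) i| <= W)).
  move=> i; exists (dl i / m ^+ 2) => t at_ tT.
  have [ci|ci] := eqVneq (c i) 0.
    by rewrite wgt0// normr0 divr_ge0 ?ltW ?exprn_gt0.
  have Lp := L0 i (lt_le_trans a0 at_) tT.
  rewrite wgtE// ger0_norm ?divr_ge0 ?(ltW (dl0 _)) ?sqr_ge0//.
  rewrite ler_pM2l// lef_pV2 ?posrE ?exprn_gt0// ler_pXn2r ?nnegrE ?Lm// ltW//.
by move=> i d e de Hd t at_ tT; apply: le_trans de; exact: Hd.
Qed.

Let vel_bound : exists2 V, 0 < V & forall i t, a <= t -> t < T -> c i != 0 ->
  `|v t i| <= V.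
Proof.
have [W W0 wW] := wgt_bound.
apply: (@finite_ub _ _ (fun i V => forall t, a <= t -> t < T -> c i != 0 ->
  `|v t i| <= V)).
  move=> i; exists (q i * (`|c i * F i| * m^-1 + alpha * (m^-1 *
    (W * (`|s i|^-1 + `|k i + k (nx i)| + `|s (nx i)|^-1))))) => t at_ tT ci.
  have Lp := L0 i (lt_le_trans a0 at_) tT.
  have Li : `|(L t i)^-1| <= m^-1.
    by rewrite ger0_norm ?invr_ge0 ?(ltW Lp)// lef_pV2 ?posrE ?Lm.
  rewrite /v /(vel _ _) normrM normrN (gtr0_norm (q0 i)) ler_pM2l//.
  apply: (le_trans (ler_normD _ _)); apply: lerD.
    by rewrite normrM; apply: ler_wpM2l.
  rewrite !normrM -!mulrA (gtr0_norm alpha0) ler_pM2l//; apply: ler_pM => //.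
  by apply: adj_bound => j; exact: wW.
by move=> i d e de Hd t at_ tT ci; apply: le_trans de; exact: Hd.
Qed.

Let nz i := c i != 0.

Let N : R := #|I|%:R.

Let N0 : 0 <= N. Proof. exact: ler0n. Qed.

(** Each pair occurs twice in the double sum, so its gradient is at most [2 * N] in each coordinate.
    The coefficient [2 * N + 1] exceeds this by 1: a side of zero curvature thus ranks above every
    other, by a definite amount. *)
Let Psi (e t : R) : R :=
  \sum_(j | nz j) \sum_(l | nz l) soft_abs e (L t j - L t l)
  + (2 * N + 1) * \sum_(j | ~~ nz j) L t j.

(* The gradient of [Psi e] with respect to the lengths. *)
Let rho (e t : R) (j : I) : R :=
  if nz j then 2 * \sum_(l | nz l) soft_sg e (L t j - L t l) else 2 * N + 1.

Let sum_le_N (P : pred I) (f : I -> R) : (forall i, f i <= 1) ->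
  \sum_(i | P i) f i <= N.
Proof.
move=> f1; apply: (@le_trans _ _ (\sum_(i | P i) 1)).
  by apply: ler_sum => i _.
by rewrite sumr_const /N ler_nat max_card.
Qed.

Let rho_nz e t j : 0 < e -> nz j -> `|rho e t j| <= 2 * N.
Proof.
move=> e0 nj; rewrite /rho nj normrM ger0_norm// ler_wpM2l//.
apply: (le_trans (ler_norm_sum _ _ _)); apply: sum_le_N => i.
exact: soft_sg_le1.
Qed.

Let rho_bound e t j : 0 < e -> `|rho e t j| <= 2 * N + 1.
Proof.
move=> e0; have [nj|nj] := boolP (nz j).
  by apply: (le_trans (rho_nz t e0 nj)); rewrite lerDl.
by rewrite /rho (negbTE nj) ger0_norm// addr_ge0// mulr_ge0.
Qed.

Let d_Psi e (t : R) : 0 < e -> 0 < t -> t < T ->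
  is_derive t 1 (Psi e) (- \sum_i v t i * adj (rho e t) i).
Proof.
move=> e0 t0 tT; rewrite (adj_sym pvK).
have d1 j l : is_derive t 1 (fun t => soft_abs e (L t j - L t l))
   (soft_sg e (L t j - L t l) * (- adj (v t) j - - adj (v t) l)).
  have dj := dL j t0 tT; have dl' := dL l t0 tT.
  by apply: is_derive_soft_abs => //; exact: is_deriveB.
have d2 : is_derive t 1
    (fun t => \sum_(j | nz j) \sum_(l | nz l) soft_abs e (L t j - L t l))
    (\sum_(j | nz j) \sum_(l | nz l)
      soft_sg e (L t j - L t l) * (- adj (v t) j - - adj (v t) l)).
  by apply: is_derive1_sum => j _; apply: is_derive1_sum => l _; exact: d1.
have d3 : is_derive t 1 (fun t => \sum_(j | ~~ nz j) L t j)
    (\sum_(j | ~~ nz j) - adj (v t) j).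
  by apply: is_derive1_sum => j _; exact: dL.
apply: is_derive_eq; rewrite /GRing.scale/=.
rewrite [in RHS](bigID nz)/= opprD; congr (_ + _); last first.
  rewrite mulr_sumr -sumrN; apply: eq_bigr => i ni.
  by rewrite /rho (negbTE ni) mulrN.
under eq_bigr => j _ do under eq_bigr => l _ do rewrite mulrDr.
under eq_bigr => j _ do rewrite big_split/=.
rewrite big_split/= [X in _ + X]exchange_big/= -big_split/= -sumrN.
apply: eq_bigr => j nj; rewrite /rho nj -big_split/= -mulrA mulr_suml mulr_sumr -sumrN.
apply: eq_bigr => l nl; rewrite -[L t l - L t j]opprB soft_sgN; ring.
Qed.

(* Segments of nonzero curvature with lengths [x <= y] next to a segment of
   zero curvature. *)
Let pair_le (d e x y r : R) : 0 < e -> 0 <= d -> m <= x -> x <= y ->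
  r <= - soft_sg e (y - x) ->
  (d / x ^+ 2 - d / y ^+ 2) * r + (d / x ^+ 2 - d / y ^+ 2) <= 2 * d / m ^+ 3 * e.
Proof.
move=> e0 d0 mx xy rs.
have x0 : 0 < x by exact: lt_le_trans mx.
have y0 : 0 < y by exact: lt_le_trans xy.
(* The factor [y - x] is the one that [soft_sg_defect] controls; the remaining one is at most
   [2 / m ^+ 3]. *)
have E : d / x ^+ 2 - d / y ^+ 2 = d * (y - x) * (x^-1 * (y^-1 * y^-1) + (x^-1 * x^-1) * y^-1).
  by field; rewrite !gt_eqF.
have ix : x^-1 <= m^-1 by rewrite lef_pV2 ?posrE.
have iy : y^-1 <= m^-1 by rewrite lef_pV2 ?posrE// (le_trans mx).
have ix0 : 0 <= x^-1 by rewrite invr_ge0 ltW.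
have iy0 : 0 <= y^-1 by rewrite invr_ge0 ltW.
have B : x^-1 * (y^-1 * y^-1) + (x^-1 * x^-1) * y^-1 <= 2 * (m^-1 * (m^-1 * m^-1)).
  rewrite [leRHS]mulrDl !mul1r lerD//; first by rewrite !ler_pM// mulr_ge0.
  by rewrite -mulrA !ler_pM// mulr_ge0.
set w := _ - _ in E *; have w0 : 0 <= w.
  by rewrite E !mulr_ge0 ?subr_ge0// addr_ge0// !mulr_ge0.
apply: (@le_trans _ _ (w * (1 - soft_sg e (y - x)))).
  by rewrite mulrDr mulr1 mulrN addrC lerD2l -mulrN ler_wpM2l.
have sg1 : soft_sg e (y - x) <= 1 by apply: le_trans (ler_norm _) (soft_sg_le1 _ e0).
have -> : 2 * d / m ^+ 3 * e = d * (2 * (m^-1 * (m^-1 * m^-1))) * e.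
  by field; rewrite gt_eqF.
rewrite E; set B' := (_ + _) in B *; set M := 2 * _ in B *.
have -> : d * (y - x) * B' * (1 - soft_sg e (y - x)) =
  d * (B' * ((y - x) * (1 - soft_sg e (y - x)))) by ring.
rewrite -[leRHS]mulrA; apply: ler_wpM2l => //; apply: ler_pM => //.
- by rewrite addr_ge0// !mulr_ge0.
- by rewrite mulr_ge0 ?subr_ge0.
have := soft_sg_defect (y - x) e0; rewrite !ger0_norm ?subr_ge0//.
by rewrite mulr_ge0 ?subr_ge0// invr_ge0 ltW// soft_abs_gt0.
Qed.

(** All terms of the difference are nonpositive since [soft_sg] is nondecreasing, and the term
    [l = i] alone already gives the bound. *)
Let rho_diff e t i j : 0 < e -> nz i -> nz j -> L t i <= L t j ->
  rho e t i - rho e t j <= - soft_sg e (L t j - L t i).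
Proof.
move=> e0 ni nj Lij; rewrite /rho ni nj -mulrBr -sumrB (bigD1 i)//=.
set S := \sum_(_ | _) _; have S0 : S <= 0.
  apply: sumr_le0 => l _; rewrite subr_le0 soft_sg_mono//.
  by rewrite lerD2r.
have sg0 : 0 <= soft_sg e (L t j - L t i).
  by rewrite /soft_sg mulr_ge0 ?subr_ge0// invr_ge0 ltW// soft_abs_gt0.
rewrite subrr {1}/soft_sg mul0r sub0r; lra.
Qed.

(** Of two sides the one with the larger weight has the smaller gradient, and up to the smoothing
    the gradients differ by at least 1; the product therefore outweighs the difference of the
    weights. If only one of the sides has [c = 0], this is [2 * N + 1] against [2 * N], without
    error. *)
Let pair_bound : exists2 D, 0 < D & forall e t i j, 0 < e -> a <= t -> t < T ->
  dl i = dl j -> (wgt (L t) i - wgt (L t) j) * (rho e t i - rho e t j)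
    + `|wgt (L t) i - wgt (L t) j| <= D * e.
Proof.
have [D D0 DP] : exists2 D, 0 < D & forall i, 2 * dl i / m ^+ 3 <= D.
  apply: (@finite_ub _ _ (fun i D => 2 * dl i / m ^+ 3 <= D)); last first.
    by move=> i d e de /le_trans; apply.
  by move=> i; eexists.
exists D => // e t i j e0 at_ tT dij.
have Lp l := L0 l (lt_le_trans a0 at_) tT.
have De0 : 0 <= D * e by rewrite mulr_ge0 ?ltW.
have [ci|ni] := eqVneq (c i) 0; have [cj|nj] := eqVneq (c j) 0.
- by rewrite !wgt0// subrr normr0 mul0r addr0.
- have w0 : 0 <= wgt (L t) j by rewrite wgtE// divr_ge0 ?sqr_ge0 ?ltW.
  apply: le_trans De0; rewrite (wgt0 _ ci) sub0r normrN ger0_norm//.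
  have := rho_nz t e0 nj; rewrite ler_norml => /andP[_ r2].
  have -> : rho e t i = 2 * N + 1 by rewrite /rho /nz ci eqxx.
  set w := wgt _ _ in w0 *; set r := rho _ _ _ in r2 *.
  have -> : - w * (2 * N + 1 - r) + w = - (w * (2 * N - r)) by ring.
  by rewrite oppr_le0 mulr_ge0// subr_ge0.
- have w0 : 0 <= wgt (L t) i by rewrite wgtE// divr_ge0 ?sqr_ge0 ?ltW.
  apply: le_trans De0; rewrite (wgt0 _ cj) subr0 ger0_norm//.
  have := rho_nz t e0 ni; rewrite ler_norml => /andP[_ r2].
  have -> : rho e t j = 2 * N + 1 by rewrite /rho /nz cj eqxx.
  set w := wgt _ _ in w0 *; set r := rho _ _ _ in r2 *.
  have -> : w * (r - (2 * N + 1)) + w = - (w * (2 * N - r)) by ring.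
  by rewrite oppr_le0 mulr_ge0// subr_ge0.
rewrite !wgtE//.
have mono x y d : 0 < x -> x <= y -> 0 <= d -> 0 <= d / x ^+ 2 - d / y ^+ 2 :> R.
  move=> x0 xy d0; have y0 := lt_le_trans x0 xy.
  rewrite subr_ge0 ler_wpM2l// lef_pV2 ?posrE ?exprn_gt0//.
  by rewrite ler_pXn2r// nnegrE ltW.
have [Lij|/ltW Lij] := leP (L t i) (L t j).
  rewrite -dij ger0_norm ?mono ?(ltW (dl0 _))//.
  apply: (@le_trans _ _ (2 * dl i / m ^+ 3 * e)); last by rewrite ler_wpM2r ?(ltW e0).
  by apply: pair_le => //; [exact: ltW|exact: Lm|exact: rho_diff].
rewrite -[rho e t i - _]opprB mulrN -mulNr opprB distrC dij ger0_norm ?mono ?(ltW (dl0 _))//.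
apply: (@le_trans _ _ (2 * dl j / m ^+ 3 * e)); last by rewrite ler_wpM2r ?(ltW e0).
by apply: pair_le => //; [exact: ltW|exact: Lm|exact: rho_diff].
Qed.

(** On such a side, up to factors of fixed sign, both [v] and [adj (rho e t)] are differences
    between the two neighbours divided by [s i], so [pair_bound] applies; [|s i| <= 1] allows the
    speed to be measured with [s i ^+ 2] as well. [K] depends on [r] through the least length up to
    [r], which is harmless as it only multiplies [e]. *)
Let zero_bound (r : R) : a <= r -> r < T -> exists2 K, 0 < K &
  forall i e t, 0 < e -> a <= t -> t <= r -> c i = 0 ->
  - (v t i * adj (rho e t) i) + `|v t i| <= K * e.
Proof.
move=> ar rT; have [D D0 DP] := pair_bound.
have r0 : 0 <= r by rewrite (le_trans (ltW a0)).
have [mu mu0 Lmu] : exists2 mu, 0 < mu & forall t i, 0 <= t <= r -> mu <= L t i.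
  by apply: solution_len_lb sh r0 _; rewrite lte_fin.
apply: (@finite_ub _ _ (fun i K => forall e t, 0 < e -> a <= t -> t <= r ->
   c i = 0 -> - (v t i * adj (rho e t) i) + `|v t i| <= K * e)); last first.
  move=> i d e de Hd e' t e'0 at_ tr ci.
  by apply: (le_trans (Hd _ _ e'0 at_ tr ci)); rewrite ler_wpM2r ?(ltW e'0).
move=> i; exists (q i * alpha / (mu * s i ^+ 2) * D) => e t e0 at_ tr ci.
have tT : t < T by exact: le_lt_trans rT.
have [sE kE dE] := c_eq0 ci.
have Lp := L0 i (lt_le_trans a0 at_) tT.
have adjE x : adj x i = (x (pv i) - x (nx i)) / s i.
  by rewrite /(adj _ _) kE sE mulr0 addr0 invrN mulrN -mulrBl.
set w := wgt (L t) (pv i) - wgt (L t) (nx i).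
set rr := rho e t (pv i) - rho e t (nx i).
have vE : v t i = - (q i * alpha / L t i * w / s i).
  by rewrite /v /(vel _ _) ci !mul0r add0r adjE -/w; field; rewrite s0 gt_eqF.
have G0 : 0 <= q i * alpha / (L t i * s i ^+ 2).
  apply: divr_ge0; apply: mulr_ge0; rewrite ?sqr_ge0//; [exact/ltW|exact/ltW|].
  exact: (ltW Lp).
have h1 : - (v t i * adj (rho e t) i) = q i * alpha / (L t i * s i ^+ 2) * (w * rr).
  by rewrite vE adjE -/rr; field; rewrite s0 gt_eqF.
have h2 : `|v t i| <= q i * alpha / (L t i * s i ^+ 2) * `|w|.
  rewrite vE normrN !normrM !normfV (gtr0_norm (q0 i)) (gtr0_norm alpha0) (gtr0_norm Lp).
  rewrite invfM -!mulrA.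
  rewrite ler_pM2l// ler_pM2l// ler_pM2l ?invr_gt0//.
  rewrite mulrC ler_wpM2r// -[s i ^+ 2]ger0_norm ?sqr_ge0// normrX expr2.
  by rewrite lef_pV2 ?posrE ?mulr_gt0 ?normr_gt0// ler_piMr.
apply: (@le_trans _ _ (q i * alpha / (L t i * s i ^+ 2) * (D * e))).
  rewrite h1; apply: (le_trans (lerD (lexx _) h2)).
  by rewrite -mulrDr ler_wpM2l// DP.
rewrite mulrA ler_wpM2r ?(ltW e0)// ler_wpM2r ?(ltW D0)//.
have s20 : 0 < s i ^+ 2 by rewrite lt0r sqr_ge0 sqrf_eq0 s0.
have muL : mu <= L t i by rewrite Lmu// tr andbT (le_trans (ltW a0)).
apply: ler_wpM2l; first by rewrite mulr_ge0// ltW.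
rewrite lef_pV2 ?posrE; [|exact: mulr_gt0..].
by rewrite ler_pM2r.
Qed.

Let nonzero_bound : exists2 C, 0 < C & forall i e t, 0 < e -> a <= t -> t < T ->
  c i != 0 -> - (v t i * adj (rho e t) i) + `|v t i| <= C.
Proof.
have [V V0 VP] := vel_bound.
apply: (@finite_ub _ _ (fun i C => forall e t, 0 < e -> a <= t -> t < T ->
  c i != 0 -> - (v t i * adj (rho e t) i) + `|v t i| <= C)); last first.
  by move=> i d e de Hd e' t e'0 at_ tr ci; apply: le_trans de; exact: Hd.
move=> i; exists (V * ((2 * N + 1) *
  (`|s i|^-1 + `|k i + k (nx i)| + `|s (nx i)|^-1)) + V) => e t e0 at_ tT ci.
apply: lerD; last exact: VP.
apply: (le_trans (ler_norm _)); rewrite normrN normrM ler_pM//; first exact: VP.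
by apply: adj_bound => j; exact: rho_bound.
Qed.

(** The decrease of [Psi e] pays for all speeds, up to a constant and an error of order [e].
    Integrating first and letting [e] tend to 0 afterwards removes the error, whose constant depends
    on [t]; so a single [C] serves up to [T]. *)
Let Psi_mono : exists2 C, 0 < C & forall i (sg r t : R), `|sg| <= 1 ->
  a <= r -> r <= t -> t < T ->
  Psi 0 t + sg * h i t <= Psi 0 r + sg * h i r + C * (t - r).
Proof.
have [C C0 CP] := nonzero_bound.
exists (N * C + 1) => [|i sg r t sg1 ar rt tT].
  by rewrite ltr_wpDl// mulr_ge0 ?(ltW C0).
have [K K0 KP] := zero_bound (le_trans ar rt) tT.
have sum_cond_le (P : pred I) (f : I -> R) : (forall i, 0 <= f i) ->
    \sum_(i | P i) f i <= \sum_i f i.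
  by move=> f0; rewrite [leRHS](bigID P)/= lerDl sumr_ge0.
have Psi0_ge e u : 0 < e -> Psi 0 u <= Psi e u.
  move=> e0; rewrite /Psi lerD2r; apply: ler_sum => j _; apply: ler_sum => l _.
  by rewrite {1}/soft_abs expr0n addr0 sqrtr_sqr soft_abs_ge.
have Psi0_le e u : 0 < e -> Psi e u <= Psi 0 u + N * (N * e).
  move=> e0; rewrite /Psi addrAC lerD2r.
  have -> : N * (N * e) = \sum_(j : I) \sum_(l : I) e.
    by rewrite !sumr_const /N !mulr_natl.
  apply: (@le_trans _ _ (\sum_(j | nz j) \sum_(l | nz l) (soft_abs 0 (L u j - L u l) + e))).
    apply: ler_sum => j _; apply: ler_sum => l _.
    rewrite {2}/soft_abs expr0n addr0 sqrtr_sqr; exact: soft_abs_le.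
  rewrite -[X in _ + X]addr0.
  under eq_bigr => j _ do rewrite big_split/=.
  rewrite big_split/= addr0 lerD2l.
  apply: (@le_trans _ _ (\sum_(j | nz j) \sum_(l : I) e)).
    by apply: ler_sum => j _; apply: sum_cond_le => l; exact: ltW.
  by apply: sum_cond_le => j; rewrite sumr_ge0// => l _; exact: ltW.
have dec e : 0 < e -> Psi e t + sg * h i t <= Psi e r + sg * h i r + (N * C + N * K * e) * (t - r).
  move=> e0.
  pose g u := Psi e u + sg * h i u - (N * C + N * K * e) * u.
  pose g' u := - (\sum_i v u i * adj (rho e u) i) + sg * v u i - (N * C + N * K * e).
  suff : g t <= g r by rewrite /g; lra.
  have gd u : r <= u <= t -> is_derive u 1 g (g' u).
    move=> /andP[ru ut].
    have u0 : 0 < u by exact: lt_le_trans (le_trans ar ru).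
    have uT : u < T by exact: le_lt_trans tT.
    have dP := d_Psi e0 u0 uT; have dhi := dh i u0 uT.
    rewrite /g /g'; apply: is_derive_eq.
    by rewrite /GRing.scale/=; ring.
  apply: (derive_le0_le rt (is_derive_within_continuous gd)) => u /andP[/ltW ru ut].
    by apply: gd; rewrite ru ltW.
  rewrite /g' subr_le0.
  have au := le_trans ar ru; have uT := lt_trans ut tT.
  have svi : sg * v u i <= \sum_j `|v u j|.
    apply: (@le_trans _ _ `|v u i|).
      by apply: (le_trans (ler_norm _)); rewrite normrM ler_piMl.
    by rewrite (bigD1 i)//= lerDl sumr_ge0.
  apply: (le_trans (lerD (lexx _) svi)); rewrite -sumrN -big_split/=.
  apply: (@le_trans _ _ (\sum_(j : I) (C + K * e))).
    apply: ler_sum => j _; have [cj|nj] := eqVneq (c j) 0.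
      by apply: (le_trans (KP _ _ _ e0 au (ltW ut) cj)); rewrite lerDr (ltW C0).
    by apply: (le_trans (CP _ _ _ e0 au uT nj)); rewrite lerDl mulr_ge0 ?(ltW K0) ?(ltW e0).
  by rewrite sumr_const /N -[leLHS]mulr_natl mulrDr !mulrA.
have tr0 : 0 <= t - r by rewrite subr_ge0.
(* The total error per unit of [e]: [N * N] from the values of [Psi], [N * K * (t - r)] from its
   derivative, and 1 to make [Z] positive. *)
pose Z := N * N + N * K * (t - r) + 1.
have Z0 : 0 < Z by rewrite ltr_wpDl// addr_ge0 ?mulr_ge0 ?(ltW K0).
apply/ler_addgt0Pr => e e0.
have eZ : 0 < e / Z by exact: divr_gt0.
have h1 := Psi0_ge _ t eZ; have h2 := Psi0_le _ r eZ; have h3 := dec _ eZ.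
have h4 : (N * N + N * K * (t - r)) * (e / Z) <= e.
  rewrite mulrA ler_pdivrMr// mulrC ler_wpM2l ?(ltW e0)// /Z lerDl//.
move: h1 h2 h3 h4; set x := e / Z; lra.
Qed.

(** The height is a difference of two nonincreasing functions bounded below. In [Psi_mono], [sg = 0]
    gives the monotonicity of [f], [sg = 1] that of [f + h i], and [sg = -1] the lower bound of the
    latter. *)
Lemma cvg_height_aux i : cvg (h i t @[t --> T^'-]).
Proof.
have [C C0 mono] := Psi_mono.
pose f t := Psi 0 t - C * t.
have fdec r t : a <= r -> r <= t -> t < T -> f t <= f r.
  move=> ar rt tT; have := mono i 0 r t; rewrite normr0 ler01 !mul0r !addr0 => /(_ isT ar rt tT).
  by rewrite /f; lra.
have fge t : a <= t < T -> - C * T <= f t.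
  move=> /andP[at_ tT]; rewrite /f mulNr -[leLHS]add0r lerD//; last by rewrite lerN2 ler_pM2l// ltW.
  rewrite addr_ge0// ?mulr_ge0//.
  - apply: sumr_ge0 => j _; apply: sumr_ge0 => l _; exact: sqrtr_ge0.
  - by rewrite addr_ge0// mulr_ge0.
  - by apply: sumr_ge0 => j _; rewrite ltW// L0// (lt_le_trans a0).
have cf := nonincreasing_left_cvg aT fdec fge.
pose g t := f t + h i t.
have cg : cvg (g t @[t --> T^'-]).
  apply: (@nonincreasing_left_cvg _ _ a T (2 * (- C * T) - f a + h i a)) => //.
    move=> r t ar rt tT; have := mono i 1 r t; rewrite normr1 lexx !mul1r => /(_ isT ar rt tT).
    by rewrite /g /f; lra.
  move=> t /andP[at_ tT]; have := mono i (-1) a t.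
  rewrite normrN1 !mulN1r => /(_ (lexx _) (lexx a) at_ tT).
  have := fge t; rewrite at_ tT => /(_ isT); rewrite /g /f; lra.
have -> : h i = g - f by apply/funext => t; rewrite /g !fctE addrC addKr.
exact: is_cvgB.
Qed.

End LowerBound.

Lemma cvg_height i : cvg (h i t @[t --> T^'-]).
Proof. by have [m m0 mP] := len_lb_nonzero; exact: (cvg_height_aux m0). Qed.

(** If all limit lengths were positive, the lengths would be bounded below on the whole of [[0, T)]
    and the solution could be extended. The side that vanishes has [c i = 0] because the others obey
    [len_lb_nonzero]. *)
Lemma maximal_vanish :
  (forall T' h', solution T'%:E h' -> T' <= T) ->
  exists2 i, c i = 0 & L t i @[t --> T^'-] --> (0 : R).
Proof.
move=> Tmax; have T0 : 0 < T by exact: lt_trans aT.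
pose l i := lim (h i t @[t --> T^'-]).
have hl i : h i t @[t --> T^'-] --> l i by exact: cvg_height.
have Ll i : L t i @[t --> T^'-] --> len l i.
  exact: (@lipschitz_cvg _ _ _ _ _ (len ^~ i) h l (len_lipschitz nx pv s k l0 i)).
have l_ge0 i : 0 <= len l i.
  rewrite -(cvg_lim _ (Ll i))//; apply: limr_ge; first by apply/cvg_ex; exists (len l i).
  near=> t; apply: ltW; apply: L0; near: t.
    exact: nbhs_left_gt.
  exact: nbhs_left_lt.
have [[i li0]|pos] := pselect (exists i, len l i = 0).
  exists i; last by rewrite -li0.
  have [ci//|ci] := eqVneq (c i) 0.
  have [m m0 mP] := len_lb_nonzero.
  suff : m <= len l i by rewrite li0 leNgt m0.
  rewrite -(cvg_lim _ (Ll i))//; apply: limr_ge; first by apply/cvg_ex; exists (len l i).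
  near=> t; apply: mP => //; near: t.
  exact: nbhs_left_ge.
exfalso.
have {}pos i : 0 < len l i.
  by rewrite lt0r l_ge0 andbT; apply/eqP => li0; apply: pos; exists i.
have [b [bT [e e0 eP]]] : exists b, b < T /\ exists2 e, 0 < e & forall i t, b < t -> t < T -> e <= L t i.
  have [e e0 eP] : exists2 e, 0 < e & forall i, e < len l i.
    have [||e e0 eP] := @finite_pos_lb R I (fun i e => e < len l i).
    - by move=> i; exists (len l i / 2); [rewrite divr_gt0|rewrite ltr_pdivrMr// ltr_pMr// ltr1n].
    - by move=> i d e; exact: le_lt_trans.
    by exists e.
  have : \forall t \near T^'-, forall i, e <= L t i.
    have H i : \forall t \near T^'-, e <= L t i.
      by apply: (cvgr_ge _ (Ll i)).
    exact: (@filter_forall _ I _ _ _ H).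
  move=> [d /= d0 dP]; exists (T - d); split; first by rewrite ltrBlDr ltrDl.
  exists e => // i t dt tT; apply: dP => //=.
  by rewrite gtr0_norm ?subr_gt0//; lra.
pose b' := Order.max b a.
have b'T : b' < T by rewrite gt_max bT.
have b'0 : 0 <= b' by rewrite le_max (ltW a0) orbT.
have [e' e'0 e'P] : exists2 e', 0 < e' & forall r i, 0 <= r <= b' -> e' <= L r i.
  by apply: (solution_len_lb sh b'0); rewrite lte_fin.
have m0 : 0 < Order.min e e' by rewrite lt_min e0.
have [|T' [h' [TT' sh' _]]] := solution_extend sh T0 m0.
  move=> t i t0 tT; have [tb|bt] := leP t b'.
    by rewrite ge_min e'P ?orbT// t0.
  by rewrite ge_min eP// (le_lt_trans _ bt)// le_max lexx.
by have := Tmax _ _ sh'; rewrite leNgt TT'.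
Unshelve. all: by end_near. Qed.

End Solution.

End Estimates.

(** * Facets, angles and transition numbers *)

Section Plane.
Context {R : realType}.
Implicit Types (u v w : R * R) (S F : (R * R) * (R * R)).

Definition rotl u : R * R := (- u.2, u.1).

Lemma fstD u v : (u + v).1 = u.1 + v.1. Proof. by []. Qed.

Lemma sndD u v : (u + v).2 = u.2 + v.2. Proof. by []. Qed.

Lemma fstN u : (- u).1 = - u.1. Proof. by []. Qed.

Lemma sndN u : (- u).2 = - u.2. Proof. by []. Qed.

Lemma fstZ (a : R) u : (a *: u).1 = a * u.1. Proof. by []. Qed.

Lemma sndZ (a : R) u : (a *: u).2 = a * u.2. Proof. by []. Qed.

Definition pairE := (fstD, sndD, fstN, sndN, fstZ, sndZ).

Lemma eq_pair2 u v : u.1 = v.1 -> u.2 = v.2 -> u = v.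
Proof. by case: u v => [a b] [a' b'] /= -> ->. Qed.

Lemma dotC u v : dot u v = dot v u.
Proof. by rewrite /dot; ring. Qed.

Lemma dotDl u v w : dot (u + v) w = dot u w + dot v w.
Proof. by rewrite /dot !pairE; ring. Qed.

Lemma dotZl a u w : dot (a *: u) w = a * dot u w.
Proof. by rewrite /dot !pairE; ring. Qed.

Lemma dotNl u w : dot (- u) w = - dot u w.
Proof. by rewrite /dot !pairE; ring. Qed.

Lemma dotBl u v w : dot (u - v) w = dot u w - dot v w.
Proof. by rewrite dotDl dotNl. Qed.

Lemma dot0l w : dot 0 w = 0.
Proof. by rewrite /dot /=; ring. Qed.

Lemma dot_ge0 u : 0 <= dot u u.
Proof. by rewrite /dot -!expr2 addr_ge0 ?sqr_ge0. Qed.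

Lemma dot_gt0 u : u != 0 -> 0 < dot u u.
Proof.
move=> u0; rewrite lt0r dot_ge0 andbT /dot -!expr2 paddr_eq0 ?sqr_ge0// !sqrf_eq0.
by apply: contra u0 => /andP[/eqP u1 /eqP u2]; apply/eqP; exact: eq_pair2.
Qed.

Lemma enorm_ge0 u : 0 <= enorm u. Proof. exact: sqrtr_ge0. Qed.

Lemma enorm_gt0 u : u != 0 -> 0 < enorm u.
Proof. by move=> /dot_gt0 u0; rewrite sqrtr_gt0. Qed.

Lemma enorm_sqr u : enorm u ^+ 2 = dot u u.
Proof. by rewrite sqr_sqrtr// dot_ge0. Qed.

Lemma enormZ a u : 0 <= a -> enorm (a *: u) = a * enorm u.
Proof.
move=> a0; rewrite /enorm dotZl dotC dotZl mulrA -expr2 sqrtrM ?sqr_ge0//.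
by rewrite sqrtr_sqr ger0_norm.
Qed.

Lemma dot_cross_sqr u v : dot u v ^+ 2 + cross u v ^+ 2 = dot u u * dot v v.
Proof. by rewrite /dot /cross; ring. Qed.

Lemma dot_le_enorm u v : `|dot u v| <= enorm u * enorm v.
Proof.
rewrite -(@ler_pXn2r _ 2) ?nnegrE ?mulr_ge0 ?enorm_ge0//.
rewrite -normrX ger0_norm ?sqr_ge0// exprMn !enorm_sqr -dot_cross_sqr.
by rewrite lerDl sqr_ge0.
Qed.

Lemma seglen_gt0 S : S.1 != S.2 -> 0 < seglen S.
Proof. by move=> S12; rewrite enorm_gt0// subr_eq0 eq_sym. Qed.

Lemma seglen_tangent S : S.1 != S.2 -> S.2 - S.1 = seglen S *: tangent S.
Proof. by move=> /seglen_gt0 S0; rewrite scalerA divff ?gt_eqF// scale1r. Qed.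

Lemma tangent_unit S : S.1 != S.2 -> dot (tangent S) (tangent S) = 1.
Proof.
move=> /seglen_gt0 S0; rewrite dotZl dotC dotZl -enorm_sqr -/(seglen S).
by field; rewrite gt_eqF.
Qed.

Lemma normal_rotl S : normal S = rotl (tangent S). Proof. by []. Qed.

Lemma tangentE S : tangent S = ((normal S).2, - (normal S).1).
Proof. by apply: eq_pair2; rewrite /= ?opprK. Qed.

Lemma eq_normal S F : normal S = normal F <-> tangent S = tangent F.
Proof.
split=> E; first by rewrite tangentE E -tangentE.
by rewrite normal_rotl E.
Qed.

Lemma dot_rotl u v : dot (rotl u) (rotl v) = dot u v.
Proof. by rewrite /dot/=; ring. Qed.

Lemma dot_rotl_l u v : dot (rotl u) v = cross u v.
Proof. by rewrite /dot /cross/=; ring. Qed.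

Lemma dot_rotl_self u : dot u (rotl u) = 0.
Proof. by rewrite /dot/=; ring. Qed.

Lemma normal_unit S : S.1 != S.2 -> dot (normal S) (normal S) = 1.
Proof. by move=> S12; rewrite normal_rotl dot_rotl tangent_unit. Qed.

Lemma dot_seg_normal S : S.1 != S.2 -> dot S.2 (normal S) = dot S.1 (normal S).
Proof.
move=> S12; apply/subr0_eq; rewrite -dotBl seglen_tangent// dotZl normal_rotl.
by rewrite dot_rotl_self mulr0.
Qed.

Lemma crossC u v : cross u v = - cross v u.
Proof. by rewrite /cross; ring. Qed.

Lemma crossv u : cross u u = 0.
Proof. by rewrite /cross; ring. Qed.

Lemma cross0_unit u v : dot u u = 1 -> dot v v = 1 -> cross u v = 0 ->
  u = v \/ u = - v.
Proof.
move=> u1 v1 uv; have := dot_cross_sqr u v; rewrite uv u1 v1 expr0n addr0 mulr1 => /eqP.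
have sq0 (a b : R) : a ^+ 2 + b ^+ 2 = 0 -> a = 0 /\ b = 0.
  by move/eqP; rewrite paddr_eq0 ?sqr_ge0// !sqrf_eq0 => /andP[/eqP-> /eqP->].
rewrite sqrf_eq1 => /orP[]/eqP uv1; [left|right].
  have [] := sq0 (u.1 - v.1) (u.2 - v.2).
    transitivity (dot u u + dot v v - 2 * dot u v); first by rewrite /dot; ring.
    by rewrite u1 v1 uv1; ring.
  by move=> /subr0_eq e1 /subr0_eq e2; exact: eq_pair2.
have [] := sq0 (u.1 + v.1) (u.2 + v.2).
  transitivity (dot u u + dot v v + 2 * dot u v); first by rewrite /dot; ring.
  by rewrite u1 v1 uv1; ring.
by move=> /eqP e1 /eqP e2; apply: eq_pair2; apply/eqP; rewrite -addr_eq0.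
Qed.

Lemma enorm_normal S : S.1 != S.2 -> enorm (normal S) = 1.
Proof. by move=> S12; rewrite /enorm normal_unit// sqrtr1. Qed.

Lemma segset1 S : segset S S.1.
Proof. by exists 0; rewrite lexx ler01 subr0 scale1r scale0r addr0. Qed.

Lemma segset2 S : segset S S.2.
Proof. by exists 1; rewrite lexx ler01 subrr scale1r scale0r add0r. Qed.

End Plane.

Section Turn.
Context {R : realType}.
Implicit Types (u v : R * R).

(** The angle of the statement as a function of the two unit tangents: both inner normal conditions
    amount to a left turn, [0 < cross u v]. *)
Definition turn u v : R :=
  if 0 < cross u v then acos (dot (- u) v) else 2 * pi - acos (dot (- u) v).

Lemma sin_2piB (x : R) : sin (2 * pi - x) = - sin x.
Proof. by rewrite addrC mulr_natl sinD2pi sinN. Qed.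

Lemma cos_2piB (x : R) : cos (2 * pi - x) = cos x.
Proof. by rewrite addrC mulr_natl cosD2pi cosN. Qed.

Variables u v : R * R.
Hypotheses (u1 : dot u u = 1) (v1 : dot v v = 1) (uv0 : cross u v != 0).

Let dot_uv : -1 < dot (- u) v < 1.
Proof.
have := dot_cross_sqr u v; rewrite u1 v1 mulr1 => E.
have : dot u v ^+ 2 < 1 by rewrite -E ltrDl lt0r sqrf_eq0 uv0 sqr_ge0.
rewrite dotNl -ltr_norml normrN => d1.
by rewrite -(@ltr_pXn2r _ 2) ?nnegrE// expr1n -normrX ger0_norm ?sqr_ge0.
Qed.

Let dot_uvW : -1 <= dot (- u) v <= 1.
Proof. by case/andP: dot_uv => /ltW-> /ltW->. Qed.

Let acos_gt : 0 < acos (dot (- u) v).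
Proof. by apply: acos_gt0; case/andP: dot_uv => /ltW-> ->. Qed.

Let acos_lt : acos (dot (- u) v) < pi.
Proof. by apply: acos_ltpi; case/andP: dot_uv => -> /ltW->. Qed.

Lemma cos_turn : cos (turn u v) = - dot u v.
Proof.
rewrite /turn; case: ifP => _; rewrite ?cos_2piB acosK ?in_itv//=; by rewrite dotNl.
Qed.

Lemma sin_turn : sin (turn u v) = cross u v.
Proof.
have E : 1 - dot (- u) v ^+ 2 = cross u v ^+ 2.
  have := dot_cross_sqr u v; rewrite u1 v1 mulr1 dotNl sqrrN => <-; ring.
rewrite /turn; case: ltP => uv; rewrite ?sin_2piB sin_acos// E sqrtr_sqr.
  by rewrite gtr0_norm.
by rewrite ler0_norm// opprK.
Qed.

Lemma turn_lt_pi : (0 < turn u v < pi) = (0 < cross u v).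
Proof.
rewrite /turn; case: (ltP 0 (cross u v)) => uv; first by rewrite acos_gt acos_lt.
by apply/negbTE; rewrite negb_and -!leNgt; apply/orP; right; move: acos_lt; lra.
Qed.

Lemma turn_gt_pi : (pi < turn u v < 2 * pi) = (cross u v < 0).
Proof.
rewrite /turn; case: (ltgtP 0 (cross u v)) => uv; last by move: uv0; rewrite -uv eqxx.
  by apply/negbTE; rewrite negb_and -!leNgt; apply/orP; left; exact: ltW.
by apply/andP; split; move: acos_lt acos_gt; lra.
Qed.

End Turn.

(** * Cyclic indices, and angles in terms of tangents *)

Section CyclicIndices.
Context {R : realType}.
Implicit Types (G : seq (R * R)) (i : nat).

Lemma vtxD G i m : vtx G (i + m * size G) = vtx G i.
Proof. by rewrite /vtx addnC modnMDl. Qed.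

Lemma vtxDn G i : vtx G (i + size G) = vtx G i.
Proof. by rewrite -[size G]mul1n vtxD. Qed.

Lemma vtx_mod G i : vtx G (i %% size G) = vtx G i.
Proof. by rewrite /vtx modn_mod. Qed.

Lemma eq_vtx G i j : i = j %[mod size G] -> vtx G i = vtx G j.
Proof. by move=> E; rewrite /vtx E. Qed.

Lemma eq_side G i j : i = j %[mod size G] -> side G i = side G j.
Proof.
move=> E; rewrite /side (eq_vtx E) (@eq_vtx _ i.+1 j.+1)//.
by apply/eqP; rewrite -[i.+1]addn1 -[j.+1]addn1 eqn_modDr; apply/eqP.
Qed.

Lemma sideDn G i : side G (i + size G) = side G i.
Proof. by apply: eq_side; rewrite modnDr. Qed.

Lemma side_prev_S G i : side G (prev_idx G i.+1) = side G i.
Proof.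
have [G0|Gp] := posnP (size G); last first.
  by rewrite /prev_idx addSnnS prednK// sideDn.
by rewrite /side /vtx (size0nil G0) !nth_nil.
Qed.

Lemma prev_idxK G i : (0 < size G)%N -> (prev_idx G i).+1 = (i + size G)%N.
Proof. by move=> G0; rewrite /prev_idx -addnS prednK. Qed.

Lemma vtx_prevS G i : (0 < size G)%N -> vtx G (prev_idx G i).+1 = vtx G i.
Proof. by move=> G0; rewrite prev_idxK// vtxDn. Qed.

Definition tau G i := tangent (side G i).

(** The sine of the angle at vertex [i], by [sin_angle]; its sign separates left turns from right
    turns and determines the transition numbers. *)
Definition crs G i := cross (tau G (prev_idx G i)) (tau G i).

Lemma crsS G i : crs G i.+1 = cross (tau G i) (tau G i.+1).
Proof. by rewrite /crs /tau side_prev_S. Qed.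

Lemma angleE G i : angle G i = turn (tau G (prev_idx G i)) (tau G i).
Proof.
rewrite /angle /turn /= !normal_rotl -/(tau _ _).
have -> : dot (tangent (side G i)) (rotl (tangent (side G (prev_idx G i)))) = crs G i.
  by rewrite dotC dot_rotl_l.
have -> : dot (- tangent (side G (prev_idx G i))) (rotl (tangent (side G i))) = crs G i.
  by rewrite dotC dot_rotl_l crossC /crs /tau /cross !pairE; ring.
by rewrite andbb.
Qed.

Section Polygonal.
Variable G : seq (R * R).
Hypothesis pG : polygonal G.

Lemma polygonal_size : (0 < size G)%N. Proof. by case: pG. Qed.

Lemma polygonal_side i : (side G i).1 != (side G i).2.
Proof. by case: pG => _ + _; apply. Qed.

Lemma polygonal_crs i : crs G i != 0.
Proof.
case: pG => G0 _ cG; have := cG (prev_idx G i).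
rewrite prev_idxK// (_ : side G (i + size G) = side G i)// sideDn//.
Qed.

Lemma tau_unit i : dot (tau G i) (tau G i) = 1.
Proof. exact/tangent_unit/polygonal_side. Qed.

Lemma sin_angle i : sin (angle G i) = crs G i.
Proof. by rewrite angleE sin_turn ?tau_unit ?polygonal_crs. Qed.

Lemma cos_angle i : cos (angle G i) = - dot (tau G (prev_idx G i)) (tau G i).
Proof. by rewrite angleE cos_turn ?tau_unit ?polygonal_crs. Qed.

Lemma transitionE i : transition G i =
  if (crs G i < 0) && (crs G i.+1 < 0) then 1
  else if (0 < crs G i) && (0 < crs G i.+1) then -1 else 0.
Proof.
have c j := polygonal_crs j.
by rewrite /transition !angleE !turn_gt_pi ?turn_lt_pi ?tau_unit//; exact: c.
Qed.

Lemma crs_le1 i : `|crs G i| <= 1.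
Proof.
rewrite -(@ler_pXn2r _ 2) ?nnegrE// expr1n -normrX ger0_norm ?sqr_ge0//.
have := dot_cross_sqr (tau G (prev_idx G i)) (tau G i).
by rewrite !tau_unit mulr1 => <-; rewrite lerDr sqr_ge0.
Qed.

End Polygonal.

End CyclicIndices.

(** * Facets of the Wulff shape and their common vertices *)

Section Facets.
Context {R : realType} (phi : R * R -> R).
Hypothesis aphi : anisotropy phi.
Implicit Types (n v y : R * R) (F : (R * R) * (R * R)).

Lemma dual_has_sup n : has_sup [set dot n y | y in wulff phi].
Proof.
case: aphi => [phi0 _ phiZ [c [C [/andP[c0 cC] cphi]]]]; split.
  exists (dot n 0), 0 => //; rewrite /wulff/=.
  have /andP[_] := cphi 0; rewrite (_ : enorm (0 : R * R) = 0) ?mulr0; last first.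
    by rewrite /enorm dot0l sqrtr0.
  by move/le_trans; apply; exact: ler01.
exists (enorm n * c^-1) => _ [y /= yW <-].
apply: (le_trans (ler_norm _)); apply: (le_trans (dot_le_enorm _ _)).
rewrite ler_wpM2l ?enorm_ge0// -[c^-1]mul1r ler_pdivlMr// mulrC.
by apply: le_trans yW; have /andP[] := cphi y.
Qed.

Lemma dot_le_dual n y : wulff phi y -> dot y n <= dual phi n.
Proof.
move=> yW; rewrite dotC; apply: ub_le_sup; last by exists y.
by case: (dual_has_sup n).
Qed.

Lemma dual_gt0 n : enorm n = 1 -> 0 < dual phi n.
Proof.
case: (aphi) => [phi0 _ phiZ [c [C [/andP[c0 cC] cphi]]]] n1.
have C0 : 0 < C by exact: lt_le_trans cC.
have yW : wulff phi (C^-1 *: n).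
  rewrite /wulff/= phiZ ?invr_gt0// ler_pdivrMl// mulr1.
  by have /andP[_] := cphi n; rewrite n1 mulr1.
apply: lt_le_trans (dot_le_dual n yW).
by rewrite dotZl -enorm_sqr n1 expr1n mulr1 invr_gt0.
Qed.

Lemma facet1 F : facet phi F -> wulff phi F.1 /\ dot F.1 (normal F) = dual phi (normal F).
Proof. by case=> _ FE; have := segset1 F; rewrite FE. Qed.

Lemma facet2 F : facet phi F -> wulff phi F.2 /\ dot F.2 (normal F) = dual phi (normal F).
Proof. by case=> _ FE; have := segset2 F; rewrite FE. Qed.

Lemma facet_dual_gt0 F : facet phi F -> 0 < dual phi (normal F).
Proof. by case=> F12 _; exact/dual_gt0/enorm_normal. Qed.

Lemma facet_wulff F v : facet phi F -> v = F.1 \/ v = F.2 -> wulff phi v /\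
  dot v (normal F) = dual phi (normal F).
Proof. by move=> fF [->|->]; [exact: facet1|exact: facet2]. Qed.

(* The facet [F'] lies below the supporting line through [F]. *)
Lemma common_end F F' v : facet phi F -> facet phi F' ->
  common_vertex F F' v -> normal F <> normal F' ->
  (cross (tangent F) (tangent F') < 0 /\ v = F.2 /\ v = F'.1) \/
  (0 < cross (tangent F) (tangent F') /\ v = F.1 /\ v = F'.2).
Proof.
move=> fF fF' [vF vF'] nn.
have [vW vn] := facet_wulff fF vF; have [_ vn'] := facet_wulff fF' vF'.
have F12 := fF.1; have F12' := fF'.1.
have [w1 _] := facet1 fF; have [w2 _] := facet2 fF.
have [w1' _] := facet1 fF'; have [w2' _] := facet2 fF'.
have t1 := tangent_unit F12; have t1' := tangent_unit F12'.
(* Opposite normals are excluded: the common vertex would have a positive product with both of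
   them. *)
have cross0 : cross (tangent F) (tangent F') != 0.
  apply/eqP => /(cross0_unit t1 t1')[/eq_normal//|tN].
  have nN : normal F = - normal F' by rewrite !normal_rotl tN; apply: eq_pair2.
  have := facet_dual_gt0 fF; rewrite -vn nN dotC dotNl dotC vn' ltNge.
  by rewrite oppr_le0 ltW// facet_dual_gt0.
have up E w n : facet phi E -> dot w n = dual phi n ->
    (w = E.1 -> dot (tangent E) n <= 0) /\ (w = E.2 -> 0 <= dot (tangent E) n).
  move=> fE wn; have S0 := seglen_gt0 fE.1; have SE := seglen_tangent fE.1.
  have [W1 _] := facet1 fE; have [W2 _] := facet2 fE.
  split=> wE; rewrite -(pmulr_rle0 _ S0) || rewrite -(pmulr_rge0 _ S0);
    rewrite -dotZl -SE dotBl.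
    by rewrite -wE wn subr_le0 dot_le_dual.
  by rewrite -wE wn subr_ge0 dot_le_dual.
have [A B] := up F v (normal F') fF vn'; have [C D] := up F' v (normal F) fF' vn.
move: A B C D; rewrite [dot (tangent F) _]dotC [dot (tangent F') _]dotC !normal_rotl !dot_rotl_l.
rewrite [cross (tangent F') _]crossC; set X := cross _ _ => A B C D.
case: vF => vE; case: vF' => vE'.
- have X1 := A vE; have X2 := C vE'; rewrite oppr_le0 in X1.
  by have := cross0; rewrite -/X (_ : X = 0) ?eqxx//; apply/eqP; rewrite eq_le X1 X2.
- right; split => //; rewrite lt_neqAle eq_sym cross0 /=; exact: D.
- left; split => //; rewrite lt_neqAle cross0 /=; exact: C.
- have X1 := B vE; have X2 := D vE'; rewrite oppr_ge0 in X1.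
  by have := cross0; rewrite -/X (_ : X = 0) ?eqxx//; apply/eqP; rewrite eq_le X1 X2.
Qed.

End Facets.

Section Admissible.
Context {R : realType} (phi : R * R -> R).
Hypothesis aphi : anisotropy phi.
Implicit Types (G : seq (R * R)) (i : nat).

Definition facet_with (n : R * R) : (R * R) * (R * R) :=
  get [set F | facet phi F /\ normal F = n].

Lemma facet_ofE G i : facet_of phi G i = facet_with (normal (side G i)).
Proof. by []. Qed.

Variable G : seq (R * R).
Hypothesis adG : admissible phi G.

Let pG : polygonal G. Proof. by case: adG. Qed.

Notation Fc := (facet_of phi G).

Notation Nv := (N0_vertex phi G).

Lemma facet_ofP i : facet phi (Fc i) /\ normal (Fc i) = normal (side G i).
Proof.
case: adG => _ /(_ i) exF _; rewrite /facet_of.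
exact: (getPex exF).
Qed.

Lemma tangent_facet_of i : tangent (Fc i) = tau G i.
Proof. by apply/eq_normal; case: (facet_ofP i). Qed.

Lemma eq_facet_of i j : i = j %[mod size G] -> Fc i = Fc j.
Proof. by move=> E; rewrite !facet_ofE (eq_side E). Qed.

Lemma N0_vertexP i : common_vertex (Fc (prev_idx G i)) (Fc i) (Nv i).
Proof.
have exv : exists v, common_vertex (Fc (prev_idx G i)) (Fc i) v.
  case: adG => _ _ /(_ (prev_idx G i))[v]; exists v.
  by rewrite -(@eq_facet_of (prev_idx G i).+1 i)// prev_idxK ?modnDr// polygonal_size.
exact: (getPex exv).
Qed.

Lemma normal_neq i : normal (side G (prev_idx G i)) <> normal (side G i).
Proof.
move=> /eq_normal E; have := polygonal_crs pG i.
by rewrite /crs /tau E crossv eqxx.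
Qed.

(** The boundary of the Wulff shape runs clockwise: a right turn of the curve passes to the facet
    that starts where the previous one ends, a left turn to the facet that ends where the previous
    one starts. *)
Lemma N0_vertex_end i v : common_vertex (Fc (prev_idx G i)) (Fc i) v ->
  (crs G i < 0 /\ v = (Fc (prev_idx G i)).2 /\ v = (Fc i).1) \/
  (0 < crs G i /\ v = (Fc (prev_idx G i)).1 /\ v = (Fc i).2).
Proof.
move=> vP; have [f1 n1] := facet_ofP (prev_idx G i); have [f2 n2] := facet_ofP i.
have := common_end aphi f1 f2 vP; rewrite !tangent_facet_of n1 n2.
by move/(_ (@normal_neq i)).
Qed.

Lemma N0_vertex_unique i v : common_vertex (Fc (prev_idx G i)) (Fc i) v -> v = Nv i.
Proof.
move=> /N0_vertex_end vP; have := N0_vertex_end (N0_vertexP i).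
case: vP => [[c1 [_ ->]]|[c1 [_ ->]]] [[c2 [_ ->]]|[c2 [_ ->]]] //.
  by have := lt_trans c1 c2; rewrite ltxx.
by have := lt_trans c1 c2; rewrite ltxx.
Qed.

Lemma N0_vertexDn i : Nv (i + size G) = Nv i.
Proof.
have G0 := polygonal_size pG.
rewrite /N0_vertex (@eq_facet_of (prev_idx G (i + size G)) (prev_idx G i)).
  by rewrite (@eq_facet_of (i + size G) i)// modnDr.
by rewrite /prev_idx addnAC modnDr.
Qed.

Lemma facet_prevS i : Fc (prev_idx G i.+1) = Fc i.
Proof. by rewrite !facet_ofE side_prev_S. Qed.

(* Both ends of the side carry the same vertex of the Wulff shape, hence its
   neighbours have facets ending or starting at that vertex. *)
Lemma transition0 i : transition G i = 0 ->
  [/\ crs G i.+1 = - crs G i, Nv i.+1 = Nv i,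
      normal (side G (prev_idx G i)) = normal (side G i.+1) &
      cot (angle G i) + cot (angle G i.+1) = 0].
Proof.
rewrite transitionE// => tr0.
have c0 := polygonal_crs pG i; have c1 := polygonal_crs pG i.+1.
have e0 := N0_vertex_end (N0_vertexP i); have := N0_vertex_end (N0_vertexP i.+1).
rewrite facet_prevS => e1.
have [f1 n1] := facet_ofP (prev_idx G i); have [f2 n2] := facet_ofP i.+1.
have cv : Nv i.+1 = Nv i /\ common_vertex (Fc (prev_idx G i)) (Fc i.+1) (Nv i) /\
   ((Nv i = (Fc (prev_idx G i)).2 /\ Nv i = (Fc i.+1).2) \/
    (Nv i = (Fc (prev_idx G i)).1 /\ Nv i = (Fc i.+1).1)).
  move: tr0; case: e0 => [[d0 [a0 b0]]|[d0 [a0 b0]]];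
    case: e1 => [[d1 [a1 b1]]|[d1 [a1 b1]]].
  - by rewrite d0 d1 => /eqP; rewrite oner_eq0.
  - move=> _; have e : Nv i.+1 = Nv i by rewrite a1 b0.
    by split=> //; rewrite e in b1; split; [split; right|left].
  - move=> _; have e : Nv i.+1 = Nv i by rewrite a1 b0.
    by split=> //; rewrite e in b1; split; [split; left|right].
  - by rewrite d0 d1 !ltNge !ltW//= => /eqP; rewrite oppr_eq0 oner_eq0.
case: cv => NE [cv ends].
(* Facets with distinct normals meet end to start. Here [Nv i] is the same end of both, so that one
   of them would be degenerate. *)
have nE : normal (side G (prev_idx G i)) = normal (side G i.+1).
  apply: contrapT => nn.
  have := common_end aphi f1 f2 cv; rewrite n1 n2 => /(_ nn).
  have [F12 _] := f1.
  move=> [[_ [x1 x2]]|[_ [x1 x2]]]; case: ends => [[y1 y2]|[y1 y2]].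
  - by have [F12' _] := f2; rewrite -x2 -y2 eqxx in F12'.
  - by rewrite -x1 -y1 eqxx in F12.
  - by rewrite -x1 -y1 eqxx in F12.
  - by have [F12' _] := f2; rewrite -x2 -y2 eqxx in F12'.
have tE : tau G (prev_idx G i) = tau G i.+1 by exact/eq_normal.
have sE : crs G i.+1 = - crs G i by rewrite crsS {1}/crs tE crossC.
split=> //.
rewrite /cot !sin_angle// !cos_angle// sE.
rewrite /tau side_prev_S -/(tau G i) -/(tau G i.+1) -/(tau G (prev_idx G i)) tE dotC.
by rewrite invrN mulrNN mulNr addNr.
Qed.

End Admissible.

(** * Polygons with given heights *)

Section CurveOfHeights.
Context {R : realType} (G : seq (R * R)).
Hypothesis pG : polygonal G.
Implicit Types (i : nat) (y : nat -> R).

Let G0 : (0 < size G)%N. Proof. exact: polygonal_size. Qed.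

Definition kot i : R := cot (angle G i).

(** The intersection of the lines of the sides [prev_idx G i] and [i], each displaced by its height,
    expressed in the frame of side [i]; [vpos_dot_normal] and [vpos_dot_prev_normal] say that it
    lies on both. *)
Definition vpos y i : R * R := vtx G i +
  (y i *: normal (side G i) + (y (prev_idx G i) / crs G i + y i * kot i) *: tau G i).

(** A signed length: by [vpos_step] it is negative when the displaced side has reversed its
    direction. *)
Definition nlen y i : R := seglen (side G i) -
  (y (prev_idx G i) / crs G i + y i * (kot i + kot i.+1) + y i.+1 / crs G i.+1).

Definition periodic y := forall i, y (i + size G)%N = y i.

Lemma periodic_eq y i j : periodic y -> i = j %[mod size G] -> y i = y j.
Proof.
move=> py; have H k : y k = y (k %% size G)%N.
  rewrite {1}(divn_eq k (size G)) addnC; elim: (k %/ size G)%N => [|m IH].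
    by rewrite mul0n addn0.
  by rewrite mulSn addnCA addnC py.
by move=> E; rewrite H E -H.
Qed.

Lemma periodic_prevS y i : periodic y -> y (prev_idx G i.+1) = y i.
Proof. by move=> py; apply: periodic_eq => //; rewrite /prev_idx addSnnS prednK// modnDr. Qed.

Lemma crsDn i : crs G (i + size G) = crs G i.
Proof. by rewrite /crs /tau sideDn /prev_idx addnAC sideDn. Qed.

Lemma angleDn i : angle G (i + size G) = angle G i.
Proof. by rewrite !angleE /tau sideDn /prev_idx addnAC sideDn. Qed.

Lemma vposDn y i : periodic y -> vpos y (i + size G) = vpos y i.
Proof.
move=> py; rewrite /vpos /kot vtxDn sideDn py crsDn angleDn /tau sideDn.
by rewrite /prev_idx addnAC py.
Qed.

Lemma dot_comb (a b : R) (u v w : R * R) :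
  dot (a *: u + b *: v) w = a * dot u w + b * dot v w.
Proof. by rewrite dotDl !dotZl. Qed.

Let dot_nt i : dot (normal (side G i)) (tau G i) = 0.
Proof. by rewrite normal_rotl dotC dot_rotl_self. Qed.

Let dot_tn i : dot (tau G i) (normal (side G i)) = 0.
Proof. by rewrite dotC dot_nt. Qed.

Let dot_nn_prev i : dot (normal (side G i)) (normal (side G (prev_idx G i))) =
  dot (tau G (prev_idx G i)) (tau G i).
Proof. by rewrite !normal_rotl dot_rotl dotC. Qed.

Let dot_tn_prev i : dot (tau G i) (normal (side G (prev_idx G i))) = crs G i.
Proof. by rewrite dotC normal_rotl dot_rotl_l. Qed.

Let dot_nt_prev i : dot (normal (side G i)) (tau G (prev_idx G i)) = - crs G i.
Proof. by rewrite normal_rotl dot_rotl_l crossC. Qed.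

Lemma kotE i : kot i = - dot (tau G (prev_idx G i)) (tau G i) / crs G i.
Proof. by rewrite /kot /cot sin_angle// cos_angle. Qed.

Lemma tau_pythagoras i :
  dot (tau G (prev_idx G i)) (tau G i) ^+ 2 + crs G i ^+ 2 = 1.
Proof. by rewrite dot_cross_sqr (tau_unit pG i) (tau_unit pG (prev_idx G i)) mulr1. Qed.

Lemma vposB y i : vpos y i - vtx G i = y i *: normal (side G i) +
  (y (prev_idx G i) / crs G i + y i * kot i) *: tau G i.
Proof. by rewrite /vpos addrC addKr. Qed.

Lemma vpos_dot_normal y i : dot (vpos y i - vtx G i) (normal (side G i)) = y i.
Proof.
by rewrite vposB dot_comb normal_unit ?polygonal_side// dot_tn mulr0 addr0 mulr1.
Qed.

Lemma vpos_dot_tau y i : dot (vpos y i - vtx G i) (tau G i) =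
  y (prev_idx G i) / crs G i + y i * kot i.
Proof. by rewrite vposB dot_comb dot_nt (tau_unit pG i) mulr0 add0r mulr1. Qed.

Lemma vpos_dot_prev_normal y i :
  dot (vpos y i - vtx G i) (normal (side G (prev_idx G i))) = y (prev_idx G i).
Proof.
rewrite vposB dot_comb dot_nn_prev dot_tn_prev kotE; field; exact: polygonal_crs.
Qed.

Lemma vpos_dot_prev_tau y i :
  dot (vpos y i - vtx G i) (tau G (prev_idx G i)) =
  - (y i / crs G i + y (prev_idx G i) * kot i).
Proof.
rewrite vposB dot_comb dot_nt_prev [dot (tau G i) _]dotC kotE.
have := tau_pythagoras i; set d := dot _ _ => E.
have c0 := polygonal_crs pG i.
transitivity (- (y i * (d ^+ 2 + crs G i ^+ 2) / crs G i + y (prev_idx G i) * (- d / crs G i))).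
  by field.
by rewrite E mulr1.
Qed.

Lemma plane_decomp (t d : R * R) : dot t t = 1 -> d = dot d t *: t + dot d (rotl t) *: rotl t.
Proof.
move=> t1; have dE : dot t t *: d = dot d t *: t + dot d (rotl t) *: rotl t.
  by apply: eq_pair2; rewrite !pairE /dot /=; ring.
by rewrite -dE t1 scale1r.
Qed.

Lemma vpos_step y i : periodic y -> vpos y i.+1 - vpos y i = nlen y i *: tau G i.
Proof.
move=> py; have S12 := polygonal_side pG i.
have dE : vpos y i.+1 - vpos y i =
    (vpos y i.+1 - vtx G i.+1) - (vpos y i - vtx G i) + seglen (side G i) *: tau G i.
  by rewrite -seglen_tangent//=; apply: eq_pair2; rewrite !pairE; ring.
have hn := vpos_dot_prev_normal y i.+1; have ht := vpos_dot_prev_tau y i.+1.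
rewrite side_prev_S periodic_prevS// in hn.
rewrite /tau side_prev_S -/(tau G i) periodic_prevS// in ht.
rewrite (plane_decomp (vpos y i.+1 - vpos y i) (tau_unit pG i)) dE.
move: hn ht (vpos_dot_normal y i) (vpos_dot_tau y i).
set A := vpos y i.+1 - _; set B := vpos y i - _ => hn ht bn bt.
have E w : dot (A - B + seglen (side G i) *: tau G i) w =
    dot A w - dot B w + seglen (side G i) * dot (tau G i) w.
  by rewrite dotDl dotBl dotZl.
rewrite !E -[rotl (tau G i)]/(normal (side G i)) dot_tn hn bn ht bt (tau_unit pG i).
by rewrite mulr0 addr0 subrr scale0r addr0 /nlen; congr (_ *: _); ring.
Qed.

Definition curve_of y : seq (R * R) := mkseq (vpos y) (size G).

Lemma size_curve_of y : size (curve_of y) = size G.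
Proof. exact: size_mkseq. Qed.

Lemma vtx_curve_of y i : periodic y -> vtx (curve_of y) i = vpos y i.
Proof.
move=> py; rewrite /vtx size_curve_of nth_mkseq ?ltn_mod//.
rewrite [in RHS](divn_eq i (size G)) addnC; elim: (i %/ size G)%N => [|m IH].
  by rewrite mul0n addn0.
by rewrite mulSn addnCA addnC vposDn.
Qed.

Lemma tangent_scale (S : (R * R) * (R * R)) (t : R * R) (l : R) : dot t t = 1 -> 0 < l ->
  S.2 - S.1 = l *: t -> [/\ S.1 != S.2, tangent S = t & seglen S = l].
Proof.
move=> t1 l0 SE; have e1 : enorm t = 1 by rewrite /enorm t1 sqrtr1.
have sl : seglen S = l by rewrite /seglen SE enormZ ?ltW// e1 mulr1.
split=> //; last by rewrite /tangent sl SE scalerA mulVf ?scale1r// gt_eqF.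
apply/eqP => S12; move: sl; rewrite /seglen S12 subrr /enorm dot0l sqrtr0.
by move=> l00; rewrite -l00 ltxx in l0.
Qed.

Lemma curve_of_side y i : periodic y -> 0 < nlen y i ->
  [/\ vtx (curve_of y) i != vtx (curve_of y) i.+1,
      tangent (side (curve_of y) i) = tau G i & seglen (side (curve_of y) i) = nlen y i].
Proof.
move=> py l0; apply: (@tangent_scale (side (curve_of y) i) _ _ (tau_unit pG i)) => //=.
by rewrite !vtx_curve_of// vpos_step.
Qed.

Lemma curve_of_parallel y : periodic y -> (forall i, 0 < nlen y i) ->
  parallel G (curve_of y).
Proof.
move=> py l0; split=> [|i]; first exact: size_curve_of.
by have [-> tE _] := curve_of_side py (l0 i); split => //; apply/eq_normal.
Qed.

Definition hgt (G' : seq (R * R)) i : R := dot (vtx G' i - vtx G i) (normal (side G i)).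

Lemma heightE (Gm : R -> seq (R * R)) i t : height G Gm i t = hgt (Gm t) i.
Proof.
rewrite /height /Hvec dotZl normal_unit ?mulr1//; exact: polygonal_side.
Qed.

Lemma hgt_curve_of y i : periodic y -> hgt (curve_of y) i = y i.
Proof. by move=> py; rewrite /hgt vtx_curve_of// vpos_dot_normal. Qed.

Section Parallel.
Variable G' : seq (R * R).
Hypothesis GG' : parallel G G'.

Lemma parallel_size : size G' = size G. Proof. by case: GG'. Qed.

Lemma parallel_prev i : prev_idx G' i = prev_idx G i.
Proof. by rewrite /prev_idx parallel_size. Qed.

Lemma parallel_normal i : normal (side G' i) = normal (side G i).
Proof. by case: GG' => _ /(_ i)[]. Qed.

Lemma parallel_tau i : tau G' i = tau G i.
Proof. exact/eq_normal/parallel_normal. Qed.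

Lemma parallel_angle i : angle G' i = angle G i.
Proof. by rewrite !angleE parallel_prev !parallel_tau. Qed.

Lemma parallel_transition i : transition G' i = transition G i.
Proof. by rewrite /transition !parallel_angle. Qed.

Lemma parallel_facet_of phi i : facet_of phi G' i = facet_of phi G i.
Proof. by rewrite !facet_ofE parallel_normal. Qed.

Lemma parallel_delta phi i : delta phi G' i = delta phi G i.
Proof. by rewrite /delta parallel_facet_of parallel_normal. Qed.

Lemma parallel_N0_vertex phi i : N0_vertex phi G' i = N0_vertex phi G i.
Proof. by rewrite /N0_vertex parallel_prev !parallel_facet_of. Qed.

Lemma parallel_polygonal : polygonal G'.
Proof.
split=> [|i|i]; first by rewrite parallel_size.
  by case: GG' => _ /(_ i)[].
rewrite -!/(tau _ _) !parallel_tau -crsS; exact: polygonal_crs.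
Qed.

Lemma parallel_admissible phi : admissible phi G -> admissible phi G'.
Proof.
move=> [_ fG cG]; split; first exact: parallel_polygonal.
  by move=> i; have [F] := fG i; exists F; rewrite parallel_normal.
by move=> i; have [v] := cG i; exists v; rewrite !parallel_facet_of.
Qed.

Lemma hgt_periodic : periodic (hgt G').
Proof. by move=> i; rewrite /hgt -{1}parallel_size !vtxDn sideDn. Qed.

(** At each vertex the two candidates differ by a vector orthogonal to the normals of both adjacent
    sides, and these are independent because [crs G i != 0]. *)
Lemma parallel_curve_of : G' = curve_of (hgt G').
Proof.
apply: (@eq_from_nth _ 0); first by rewrite size_curve_of parallel_size.
move=> i; rewrite parallel_size => iG; rewrite nth_mkseq//.
have -> : G'`_i = vtx G' i by rewrite /vtx parallel_size modn_small.
apply/eqP; rewrite -subr_eq0; apply/eqP.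
set d := _ - _.
have dn : dot d (normal (side G i)) = 0.
  have -> : d = (vtx G' i - vtx G i) - (vpos (hgt G') i - vtx G i).
    by rewrite /d; apply: eq_pair2; rewrite !pairE; ring.
  by rewrite dotBl vpos_dot_normal subrr.
have dp : dot d (normal (side G (prev_idx G i))) = 0.
  have -> : d = (vtx G' i - vtx G i) - (vpos (hgt G') i - vtx G i).
    by rewrite /d; apply: eq_pair2; rewrite !pairE; ring.
  rewrite dotBl vpos_dot_prev_normal /hgt.
  have S12' := polygonal_side parallel_polygonal (prev_idx G i).
  have := dot_seg_normal S12'; rewrite parallel_normal /=.
  have := dot_seg_normal (polygonal_side pG (prev_idx G i)) => /=.
  have v' : vtx G' (prev_idx G i).+1 = vtx G' i.
    by rewrite -parallel_prev vtx_prevS// parallel_size.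
  by rewrite v' vtx_prevS// !dotBl => -> ->; rewrite subrr.
rewrite (plane_decomp d (tau_unit pG i)) -[rotl _]/(normal (side G i)) dn scale0r addr0.
have -> : dot d (tau G i) = 0; last by rewrite scale0r.
apply/eqP; have := dp; rewrite {1}(plane_decomp d (tau_unit pG i)).
rewrite -[rotl (tau G i)]/(normal (side G i)) dn scale0r addr0 dotZl => /eqP.
by rewrite dot_tn_prev mulf_eq0 (negbTE (polygonal_crs pG i)) orbF.
Qed.

Lemma parallel_nlen i : nlen (hgt G') i = seglen (side G' i).
Proof.
have S12 := polygonal_side parallel_polygonal i.
have := seglen_tangent S12; rewrite -/(tau G' i) parallel_tau /=.
have E j : vtx G' j = vpos (hgt G') j.
  rewrite {1}parallel_curve_of vtx_curve_of//; exact: hgt_periodic.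
rewrite !E vpos_step; last exact: hgt_periodic.
move=> /(congr1 (dot ^~ (tau G i))); rewrite dotZl [RHS]dotZl (tau_unit pG i) !mulr1.
by move=> ->.
Qed.

End Parallel.

End CurveOfHeights.

(** Supplies the continuity of [h'] that is demanded of a flow: the velocities are rational
    functions of the lengths, which are derivable along a solution. *)
Lemma vel_continuous {R : realType} {I : finType} (nx pv : I -> I)
    (q F c dl s k : I -> R) (alpha : R) (L : R -> I -> R) (t : R) i :
  (forall j, derivable (L ^~ j) t 1) -> (forall j, L t j != 0) ->
  {for t, continuous (fun t => vel nx pv q F c dl s k alpha (L t) i)}.
Proof.
move=> dL L0; apply/differentiable_continuous/derivable1_diffP.
have d1 j := @is_derive1_inv _ (L ^~ j) _ t (L0 j) (derivableP (dL j)).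
have d2 j := @is_derive1_inv _ (fun t => L t j * L t j) _ t (mulf_neq0 (L0 j) (L0 j))
  (derivableP (derivableM (dL j) (dL j))).
have w2 r j : wgt c dl (L r) j = c j ^+ 2 * dl j * (L r j * L r j)^-1.
  by rewrite /wgt [L r j ^+ 2]expr2.
rewrite /vel /adj; under eq_fun do rewrite !w2.
exact: ex_derive.
Qed.

(** * The flow as a differential system for the heights *)

Section System.
Context {R : realType} (phi : R * R -> R) (alpha : R) (G : seq (R * R)).
Hypotheses (aphi : anisotropy phi) (alpha0 : 0 < alpha) (adG : admissible phi G).

Let pG : polygonal G. Proof. by case: adG. Qed.

Let G0 : (0 < size G)%N. Proof. exact: polygonal_size. Qed.

Notation I := 'I_(size G).

Definition idx (i : nat) : I := Ordinal (ltn_pmod i G0).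

Definition idx_next (j : I) : I := idx j.+1.

Definition idx_prev (j : I) : I := idx (prev_idx G j).

Lemma idx_val (j : I) : idx j = j.
Proof. by apply: val_inj; rewrite /= modn_small. Qed.

Lemma idx_prevK : cancel idx_prev idx_next.
Proof.
move=> j; apply: val_inj; rewrite /= -addn1 modnDml addn1 prev_idxK//.
by rewrite modnDr modn_small.
Qed.

(** Passes from the finite index type of the differential system to the cyclic natural indices of a
    curve. *)
Definition ext (x : I -> R) (i : nat) : R := x (idx i).

Lemma ext_val x (j : I) : ext x j = x j.
Proof. by rewrite /ext idx_val. Qed.

Lemma ext_periodic x : periodic G (ext x).
Proof. by move=> i; rewrite /ext; congr x; apply: val_inj; rewrite /= modnDr. Qed.

Lemma mod_invariant (T : Type) (f : nat -> T) i :
  (forall i, f (i + size G)%N = f i) -> f (i %% size G)%N = f i.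
Proof.
move=> fD; rewrite [in RHS](divn_eq i (size G)) addnC.
elim: (i %/ size G)%N => [|m IH]; first by rewrite mul0n addn0.
by rewrite mulSn addnCA addnC fD.
Qed.

Lemma kot_mod i : kot G (i %% size G) = kot G i.
Proof. by apply: mod_invariant => j; rewrite /kot angleDn. Qed.

Lemma crs_mod i : crs G (i %% size G) = crs G i.
Proof. by apply: mod_invariant => j; exact: crsDn. Qed.

Lemma side_mod i : side G (i %% size G) = side G i.
Proof. by apply: mod_invariant => j; exact: sideDn. Qed.

Lemma transition_mod i : transition G (i %% size G) = transition G i.
Proof.
apply: mod_invariant => j; have := angleDn G j.+1; rewrite addSn => E.
by rewrite /transition angleDn E.
Qed.

Lemma delta_mod i : delta phi G (i %% size G) = delta phi G i.
Proof. by rewrite /delta !facet_ofE side_mod. Qed.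

Definition flow_solution (T : \bar R) (h : I -> R -> R) : Prop :=
  solution idx_next idx_prev
    (fun j => dual phi (normal (side G j))) (fun j => seglen (facet_of phi G j))
    (fun j => transition G j) (fun j => delta phi G j) (fun j => crs G j)
    (fun j => kot G j) (fun j => seglen (side G j)) alpha T h.

Definition flow_len (x : I -> R) (j : I) : R :=
  len idx_next idx_prev (fun j => crs G j) (fun j => kot G j)
    (fun j => seglen (side G j)) x j.

Lemma flow_lenE x j : flow_len x j = nlen G (ext x) j.
Proof.
rewrite /flow_len /len /adj /nlen /= kot_mod crs_mod ext_val.
by rewrite /ext /idx_prev /idx_next.
Qed.

Lemma nlen_mod y i : periodic G y -> nlen G y (i %% size G) = nlen G y i.
Proof.
move=> py; apply: mod_invariant => j; rewrite /nlen.
have kS := kot_mod; have := angleDn G j.+1; have := crsDn G j.+1; have := py j.+1.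
rewrite !addSn => -> -> aS; rewrite /kot angleDn aS sideDn py crsDn.
by rewrite /prev_idx addnAC py.
Qed.

Let nlen_gt0 x : (forall j, 0 < flow_len x j) -> forall i, 0 < nlen G (ext x) i.
Proof.
move=> x0 i; rewrite -nlen_mod; last exact: ext_periodic.
by have := x0 (idx i); rewrite flow_lenE.
Qed.

Lemma flow_side x : (forall j, 0 < flow_len x j) -> forall i,
  [/\ vtx (curve_of G (ext x)) i != vtx (curve_of G (ext x)) i.+1,
      tangent (side (curve_of G (ext x)) i) = tau G i &
      seglen (side (curve_of G (ext x)) i) = nlen G (ext x) i].
Proof.
by move=> x0 i; apply: curve_of_side => //; [exact: ext_periodic|exact: nlen_gt0].
Qed.

Lemma flow_parallel x : (forall j, 0 < flow_len x j) -> parallel G (curve_of G (ext x)).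
Proof.
by move=> x0; apply: curve_of_parallel => //; [exact: ext_periodic|exact: nlen_gt0].
Qed.

Lemma elastic_rhsE G' (j : I) : parallel G G' ->
  dual phi (normal (side G j)) * elastic_rhs phi alpha G' j =
  vel idx_next idx_prev
    (fun j => dual phi (normal (side G j))) (fun j => seglen (facet_of phi G j))
    (fun j => transition G j) (fun j => delta phi G j) (fun j => crs G j)
    (fun j => kot G j) alpha (fun j => seglen (side G' j)) j.
Proof.
move=> GG'; rewrite /elastic_rhs /vel /curvature /adj /wgt.
rewrite !(parallel_prev GG') !(parallel_transition GG') !(parallel_angle GG').
rewrite !(parallel_delta GG') !(parallel_facet_of GG') !sin_angle// -!/(kot _ _) /=.
rewrite kot_mod crs_mod !transition_mod !delta_mod.
have sm i : side G' (i %% size G) = side G' i.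
  by apply: eq_side; rewrite (parallel_size GG') modn_mod.
rewrite !sm; ring.
Qed.

Lemma dual_normal_gt0 i : 0 < dual phi (normal (side G i)).
Proof. by apply: dual_gt0 => //; rewrite enorm_normal// polygonal_side. Qed.

Lemma facet_len_gt0 i : 0 < seglen (facet_of phi G i).
Proof. by have [[F12 _] _] := facet_ofP adG i; exact: seglen_gt0. Qed.

Lemma transition01 i : transition G i = 0 \/ transition G i ^+ 2 = 1.
Proof.
rewrite transitionE//; case: ifP => _; first by right; rewrite expr1n.
by case: ifP => _; [right; rewrite sqrrN expr1n|left].
Qed.

Lemma flow_transition0 (j : I) : transition G j = 0 ->
  [/\ crs G (idx_next j) = - crs G j, kot G j + kot G (idx_next j) = 0 &
      delta phi G (idx_prev j) = delta phi G (idx_next j)].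
Proof.
move=> /(transition0 aphi adG)[sE _ nE kE].
rewrite /= crs_mod kot_mod !delta_mod; split=> //.
by rewrite /delta !facet_ofE nE.
Qed.

Lemma flow_solution_curve T h : (0 < T)%E -> flow_solution T h ->
  elastic_flow phi alpha G T (fun t => curve_of G (ext (h ^~ t))).
Proof.
move=> T0 [h0 ch dh hpos].
have par (t : R) : 0 <= t -> (t%:E < T)%E -> parallel G (curve_of G (ext (h ^~ t))).
  by move=> t0 tT; apply: flow_parallel => j; exact: hpos.
split=> // i iG; set Gm := fun t => _.
pose j : I := Ordinal iG.
have hE : height G Gm i = h j.
  apply/funext => t; rewrite (heightE pG) (hgt_curve_of pG); last exact: ext_periodic.
  by rewrite -[i]/(val j) ext_val.
have d1 (t : R) : 0 < t -> (t%:E < T)%E -> derive1 (h j) t = vel idx_next idx_prev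
    (fun j => dual phi (normal (side G j))) (fun j => seglen (facet_of phi G j))
    (fun j => transition G j) (fun j => delta phi G j) (fun j => crs G j)
    (fun j => kot G j) alpha (flow_len (h ^~ t)) j.
  by move=> t0 tT; rewrite derive1E; have [_ ->] := dh j t t0 tT.
rewrite hE; split=> //.
- by move=> t t0 tT; have [] := dh j t t0 tT.
- apply: (@subspace_eq_continuous _ _ _ (fun t => vel idx_next idx_prev
    (fun j => dual phi (normal (side G j))) (fun j => seglen (facet_of phi G j))
    (fun j => transition G j) (fun j => delta phi G j) (fun j => crs G j)
    (fun j => kot G j) alpha (flow_len (h ^~ t)) j)).
    by move=> t; rewrite inE/= => -[t0 tT]; exact/esym/d1.
  apply: continuous_in_subspaceT => t; rewrite inE/= => -[t0 tT].
  apply: vel_continuous => l; last by rewrite gt_eqF//; apply: hpos => //; exact: ltW.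
  by have [] := is_derive_len idx_next idx_prev (fun j => kot G j)
    (fun j => seglen (side G j)) (fun j : I => polygonal_crs pG j) l
    (fun i => dh i t t0 tT).
- move=> t t0 tT; rewrite d1//.
  have pt := par t (ltW t0) tT.
  have -> : normal (side (Gm t) i) = normal (side G j) by rewrite (parallel_normal pt).
  have q0 := dual_normal_gt0 j.
  rewrite -[elastic_rhs _ _ _ _](mulKf (lt0r_neq0 q0)) mulrC; congr (_ * _).
  rewrite -[i]/(val j) (elastic_rhsE _ pt) -!/(flow_len _ _); congr (vel _ _ _ _ _ _ _ _ _ _ _).
  apply/funext => l; rewrite flow_lenE.
  by have [|_ _ ->] := @flow_side (h ^~ t) _ l; first by move=> l'; apply: hpos => //; exact: ltW.
Qed.

(** The converse of [flow_solution_curve]: every flow comes from a solution, so that uniqueness and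
    maximality can be decided on the differential system. *)
Lemma elastic_flow_solution T Gm : elastic_flow phi alpha G T Gm ->
  flow_solution T (fun j t => height G Gm j t) /\
  forall t : R, 0 <= t -> (t%:E < T)%E ->
    Gm t = curve_of G (ext (fun j => height G Gm j t)).
Proof.
move=> [T0 par fl].
have extE (t : R) : 0 <= t -> (t%:E < T)%E ->
    ext (fun j => height G Gm j t) = hgt G (Gm t).
  move=> t0 tT; apply/funext => i; rewrite /ext /= (heightE pG).
  by apply: mod_invariant => k; apply: hgt_periodic; exact: par.
have cE (t : R) : 0 <= t -> (t%:E < T)%E ->
    Gm t = curve_of G (ext (fun j => height G Gm j t)).
  by move=> t0 tT; rewrite extE//; exact/parallel_curve_of/par.
have lE (t : R) j : 0 <= t -> (t%:E < T)%E ->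
    flow_len (fun j => height G Gm j t) j = seglen (side (Gm t) j).
  by move=> t0 tT; rewrite flow_lenE extE// parallel_nlen//; exact: par.
split=> //; split.
- by move=> j; have [] := fl j (ltn_ord j).
- by move=> j; have [] := fl j (ltn_ord j).
- move=> j t t0 tT; have [_ _ dh _ hE] := fl j (ltn_ord j).
  have pt := par t (ltW t0) tT.
  have := derivableP (dh t t0 tT); rewrite -derive1E => H.
  suff <- : derive1 (height G Gm j) t = vel idx_next idx_prev
    (fun j => dual phi (normal (side G j))) (fun j => seglen (facet_of phi G j))
    (fun j => transition G j) (fun j => delta phi G j) (fun j => crs G j)
    (fun j => kot G j) alpha (flow_len (fun j => height G Gm j t)) j by [].
  have := hE t t0 tT; rewrite (parallel_normal pt) => /(canRL (divfK _)) ->; last first.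
    by rewrite gt_eqF// dual_normal_gt0.
  rewrite mulrC (elastic_rhsE _ pt); congr (vel _ _ _ _ _ _ _ _ _ _ _).
  by apply/funext => l; rewrite lE// ltW.
- move=> j t t0 tT; rewrite -/(flow_len _ _) lE//.
  by apply: seglen_gt0; exact: (polygonal_side (parallel_polygonal pG (par t t0 tT))).
Qed.

End System.

(** * Maximal flows *)

Section MaximalFlow.
Context {R : realType} (phi : R * R -> R) (alpha : R) (G : seq (R * R)).
Hypotheses (aphi : anisotropy phi) (alpha0 : 0 < alpha) (adG : admissible phi G).

Let pG : polygonal G. Proof. by case: adG. Qed.

Notation I := 'I_(size G).

Lemma vpos_cvg (S : Type) (F : set_system S) {FF : Filter F} (h : I -> S -> R)
    (a : I -> R) i : (forall j, h j t @[t --> F] --> a j) ->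
  vpos G (ext adG (h ^~ t)) i @[t --> F] --> vpos G (ext adG a) i.
Proof.
move=> ha; rewrite /vpos.
apply: cvgD; first exact: cvg_cst.
apply: cvgD; first by apply: cvgZr_tmp; exact: ha.
apply: cvgZr_tmp; apply: cvgD; first by apply: cvgMr_tmp; exact: ha.
by apply: cvgMr_tmp; exact: ha.
Qed.

Lemma curve_cvg (S : Type) (F : set_system S) {FF : Filter F} (h : I -> S -> R)
    (a : I -> R) i : (forall j, h j t @[t --> F] --> a j) ->
  vtx (curve_of G (ext adG (h ^~ t))) i @[t --> F] --> vtx (curve_of G (ext adG a)) i.
Proof.
move=> ha; rewrite vtx_curve_of//; last exact: ext_periodic.
under eq_fun do rewrite (vtx_curve_of pG _ (ext_periodic adG _)).
exact: vpos_cvg.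
Qed.

(* [lam i] is the length left on the [i]-th side of the limit polygon. *)
Definition degenerate_limit (q : seq (R * R)) (lam : nat -> R) : Prop :=
  [/\ size q = size G,
      forall i, vtx q i.+1 - vtx q i = lam i *: tau G i,
      forall i, 0 <= lam i,
      forall i, transition G i != 0 -> 0 < lam i &
      exists2 j, (j < size G)%N & lam j = 0].

Definition stops_at (T : R) (Gm : R -> seq (R * R)) : Prop :=
  exists q lam, [/\ degenerate_limit q lam,
    forall i, vtx (Gm t) i @[t --> T^'-] --> vtx q i,
    exists2 j, (j < size G)%N &
      transition G j = 0 /\ seglen (side (Gm t) j) @[t --> T^'-] --> (0 : R) &
    exists2 eps, 0 < eps & \forall t \near T^'-, forall j, (j < size G)%N ->
      transition G j != 0 -> eps <= seglen (side (Gm t) j)].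

Lemma curve_of0 : curve_of G (ext adG (fun=> 0)) = G.
Proof.
have GG : parallel G G by split=> // i; rewrite (polygonal_side pG i).
rewrite [RHS](parallel_curve_of pG GG); congr curve_of; apply/funext => i.
by rewrite /ext /hgt subrr dot0l.
Qed.

Lemma nlen_flow_len (x : I -> R) i : nlen G (ext adG x) i = flow_len adG x (idx adG i).
Proof. by rewrite flow_lenE nlen_mod//; exact: ext_periodic. Qed.

Theorem maximal_flow_ex : exists T Gm,
  [/\ unique_maximal_flow phi alpha G T Gm, Gm 0 = G,
      forall (t : R) i, 0 <= t -> (t%:E < T)%E ->
        vtx (Gm u) i @[u --> within [set u | 0 <= u /\ (u%:E < T)%E] (nbhs t)]
          --> vtx (Gm t) i &
      T = +oo%E \/ exists2 b : R, T = b%:E & stops_at b Gm].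
Proof.
have l0pos (j : I) : 0 < seglen (side G j) by apply: seglen_gt0; exact: polygonal_side.
have [T [h [T0 sh Tmax]]] := maximal_solution_ex (idx_next adG) (idx_prev adG)
  (fun j => dual phi (normal (side G j))) (fun j => seglen (facet_of phi G j))
  (fun j => transition G j) (fun j => delta phi G j) (fun j => crs G j)
  (fun j => kot G j) alpha l0pos.
pose Gm t := curve_of G (ext adG (h ^~ t)).
have fl : elastic_flow phi alpha G T Gm := flow_solution_curve aphi T0 sh.
have par (t : R) : 0 <= t -> (t%:E < T)%E -> parallel G (Gm t).
  by move=> t0 tT; case: fl => _ par _; exact: par.
exists T, Gm; split.
- split; first split=> //.
    move=> [T' [G' [TT' fl' _]]].
    have [sh' _] := elastic_flow_solution aphi adG fl'.
    have T'0 : (0 < T')%E by case: fl'.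
    by have := Tmax _ _ T'0 sh'; rewrite leNgt TT'.
  move=> T' G' [fl' max'].
  have [sh' G'E] := elastic_flow_solution aphi adG fl'.
  have T'0 : (0 < T')%E by case: fl'.
  have T'T := Tmax _ _ T'0 sh'.
  have agree (t : R) : 0 <= t -> (t%:E < T')%E -> G' t = Gm t.
    move=> t0 tT'; rewrite G'E// /Gm.
    by rewrite (solution_unique sh' sh t0 tT' (lt_le_trans tT' T'T)).
  (* Otherwise [Gm] itself would extend the maximal flow [G'] beyond [T']. *)
  have TT' : T' = T.
    apply/eqP; rewrite eq_le T'T /= leNgt; apply/negP => T'ltT.
    apply: max'; exists T, Gm; split=> // t t0 tT'.
    by rewrite agree.
  by split=> // t t0 tT; apply: agree; rewrite ?TT'.
- rewrite /Gm (_ : h ^~ 0 = fun=> 0); first exact: curve_of0.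
  by apply/funext => j; case: sh => ->.
- move=> t i t0 tT; apply: curve_cvg => j.
  case: sh => _ ch _ _; move/subspace_continuousP: (ch j); exact.
case: T T0 sh Tmax fl par => [b|_ _ _ _ _|//]; last by left.
rewrite lte_fin => b0 sh Tmax fl par; right; exists b => //.
have sl (t : R) j : 0 <= t -> t < b -> seglen (side (Gm t) j) = nlen G (ext adG (h ^~ t)) j.
  move=> t0 tb; have [] := @flow_side _ _ _ adG (h ^~ t) _ j.
    by move=> l; case: sh => _ _ _; apply; rewrite ?lte_fin.
  by [].
have a0 : 0 < b / 2 by rewrite divr_gt0.
have ab : b / 2 < b by rewrite ltr_pdivrMr// ltr_pMr// ltr1n.
have crs1 (j : I) : `|crs G j| <= 1 by exact: crs_le1.
have q0 (j : I) := dual_normal_gt0 aphi adG j.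
have F0 (j : I) := facet_len_gt0 adG j.
have c01 (j : I) := transition01 adG j.
have s0 (j : I) := polygonal_crs pG j.
have c0 (j : I) := @flow_transition0 _ _ _ aphi adG j.
have dE (j : I) : delta phi G j =
  seglen (facet_of phi G j) ^+ 2 * dual phi (normal (side G j)) by [].
pose l j := lim (h j t @[t --> b^'-]).
have hl j : h j t @[t --> b^'-] --> l j.
  exact: (cvg_height (idx_prevK adG) q0 alpha0 F0 dE c01 s0 crs1 c0 sh a0 ab).
have [e e0 le] := len_lb_nonzero (idx_prevK adG) q0 alpha0 F0 dE c01 s0 sh a0 ab.
have [|z cz Lz] := maximal_vanish (idx_prevK adG) q0 alpha0 F0 dE c01 s0 crs1 c0 sh a0 ab.
  move=> T' h' sh'; have [T'0|T'0] := leP T' 0; first by rewrite (le_trans T'0)// ltW.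
  by have := Tmax T'%:E h'; rewrite !lte_fin lee_fin; apply.
pose lam i := nlen G (ext adG l) i.
have nl i : nlen G (ext adG (h ^~ t)) i @[t --> b^'-] --> lam i.
  rewrite /lam nlen_flow_len; under eq_fun do rewrite nlen_flow_len.
  exact: (@lipschitz_cvg _ _ _ _ _ (fun x => flow_len adG x (idx adG i)) h l
    (len_lipschitz _ _ _ _ _ _)).
have Lz' : nlen G (ext adG (h ^~ t)) z @[t --> b^'-] --> (0 : R).
  by under eq_fun do rewrite nlen_flow_len idx_val; exact: Lz.
have near0 : \forall t \near b^'-, 0 <= t < b.
  near=> t; apply/andP; split; first by near: t; exact: nbhs_left_ge.
  by near: t; exact: nbhs_left_lt.
have nearsl i : \forall t \near b^'-, nlen G (ext adG (h ^~ t)) i = seglen (side (Gm t) i).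
  by apply: filterS near0 => t /andP[t0 tb]; rewrite sl.
have lbnz i : transition G i != 0 -> \forall t \near b^'-, e <= nlen G (ext adG (h ^~ t)) i.
  move=> ci; near=> t.
  rewrite nlen_flow_len; apply: le; last by rewrite /= transition_mod.
    by near: t; exact: nbhs_left_ge.
  by near: t; exact: nbhs_left_lt.
exists (curve_of G (ext adG l)), lam; split.
- split.
  + exact: size_curve_of.
  + by move=> i; rewrite !vtx_curve_of ?vpos_step//; exact: ext_periodic.
  + move=> i; rewrite -(cvg_lim _ (nl i))//; apply: limr_ge; first by apply/cvg_ex; exists (lam i).
    near=> t; have t0b : 0 <= t < b by near: t.
    case/andP: t0b => t0 tb; rewrite -sl//; exact: enorm_ge0.
  + move=> i ci; apply: (lt_le_trans e0).
    rewrite -(cvg_lim _ (nl i))//; apply: limr_ge; first by apply/cvg_ex; exists (lam i).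
    exact: lbnz.
  + exists z => //; exact: (@cvg_unique _ (@Rhausdorff R) _ _ _ _ (nl z) Lz').
- by move=> i; exact: curve_cvg.
- exists z => //; split=> //.
  apply: (@cvg_trans _ (nlen G (ext adG (h ^~ t)) z @[t --> b^'-])).
    exact: near_eq_cvg.
  exact: Lz'.
exists e => //; near=> t => j jG cj.
have t0b : 0 <= t < b by near: t.
case/andP: t0b => t0 tb; rewrite sl// nlen_flow_len; apply: le => //.
  by near: t; exact: nbhs_left_ge.
by rewrite /= transition_mod.
Unshelve. all: by end_near. Qed.

End MaximalFlow.

(** * Relabelling the limit polygon *)

Section PeriodicEnumeration.
Variables (P : pred nat) (n : nat).
Hypotheses (n0 : (0 < n)%N) (PD : forall i, P (i + n)%N = P i).
Hypothesis exP : exists i, P i.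

Let cnt j := count P (iota 0 j).

Let cntS j : cnt j.+1 = (cnt j + P j)%N.
Proof. by rewrite /cnt -addn1 iotaD count_cat /= addn0. Qed.

Let cnt_mono i j : (i <= j)%N -> (cnt i <= cnt j)%N.
Proof.
move=> ij; rewrite -(subnKC ij) /cnt iotaD count_cat; exact: leq_addr.
Qed.

Let cntD j : cnt (j + n)%N = (cnt j + cnt n)%N.
Proof. by elim: j => [|j IH]; rewrite ?add0n// addSn !cntS IH PD addnAC. Qed.

Let cntM k : cnt (k * n)%N = (k * cnt n)%N.
Proof. by elim: k => [|k IH]; rewrite ?mul0n// !mulSn addnC cntD IH addnC. Qed.

Lemma periodic_count_gt0 : (0 < cnt n)%N.
Proof.
have [i Pi] := exP.
have PM k : P (i + k * n)%N.
  by elim: k => [|k IH]; [rewrite addn0|rewrite mulSn addnCA addnC PD].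
have /(leq_trans _) : (cnt i.+1 <= cnt (i.+1 * n)%N)%N.
  by apply: cnt_mono; rewrite leq_pmulr.
rewrite cntM cntS Pi addn1 => /(_ _ (ltn0Sn _)).
by rewrite muln_gt0.
Qed.

(** Both [drop_vanished] and [merge_aligned] filter one period of indices. The map [kap] lists the
    selected indices of all periods in increasing order, and the last clause reads the filtered list
    cyclically through it. *)
Lemma periodic_enum : exists kap : nat -> nat,
  [/\ forall i, P (kap i), forall i, (kap i < kap i.+1)%N,
      forall i j, (kap i < j < kap i.+1)%N -> ~~ P j,
      forall i, kap (i + cnt n)%N = (kap i + n)%N &
      forall (T : Type) (x0 : T) (f : nat -> T), (forall i, f (i + n)%N = f i) ->
        forall i, nth x0 [seq f j | j <- iota 0 n & P j] (i %% cnt n) = f (kap i)].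
Proof.
have m0 := periodic_count_gt0.
have ex i : exists j, (i < cnt j.+1)%N.
  exists (i.+1 * n)%N; apply: leq_trans (cnt_mono (leqnSn _)).
  by rewrite cntM leq_pmulr.
pose kap i := ex_minn (ex i).
have kapP i : P (kap i) /\ cnt (kap i) = i.
  rewrite /kap; case: ex_minnP => j ij jmin.
  have ji : (cnt j <= i)%N.
    case: j ij jmin => [//|j] ij jmin; rewrite leqNgt; apply/negP => /jmin.
    by rewrite ltnn.
  have := ij; rewrite cntS; case: (P j) => /=; last by rewrite addn0 ltnNge ji.
  by rewrite addn1 ltnS => ij'; split => //; apply/eqP; rewrite eqn_leq ji.
have kap_lt i j : (cnt i < cnt j)%N -> (i < j)%N.
  by move=> ij; rewrite ltnNge; apply/negP => /cnt_mono; rewrite leqNgt ij.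
have kap_uniq i j : P j -> cnt j = i -> kap i = j.
  move=> Pj cj; have [Pk ck] := kapP i; apply/eqP; rewrite eqn_leq; apply/andP; split.
    by rewrite -ltnS; apply: kap_lt; rewrite cntS Pj ck cj addn1.
  by rewrite -ltnS; apply: kap_lt; rewrite cntS Pk ck cj addn1.
have kapD i : kap (i + cnt n)%N = (kap i + n)%N.
  by have [Pk ck] := kapP i; apply: kap_uniq; rewrite ?PD// cntD ck.
have kapM i k : kap (i + k * cnt n)%N = (kap i + k * n)%N.
  elim: k => [|k IH]; first by rewrite !addn0.
  by rewrite !mulSn addnCA addnC kapD IH addnAC addnA.
exists kap; split=> //.
- by move=> i; case: (kapP i).
- by move=> i; apply: kap_lt; have [_ ->] := kapP i; have [_ ->] := kapP i.+1.
- move=> i j /andP[ij ji]; apply/negP => Pj.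
  have [Pk ck] := kapP i; have [Pk' ck'] := kapP i.+1.
  have := cnt_mono ij; have := cnt_mono ji.
  by rewrite !cntS ck ck' Pj Pk !addn1 ltnS => h1 h2; have := leq_trans h2 h1; rewrite ltnn.
move=> T x0 f fD i.
have fM k j : f (j + k * n)%N = f j.
  by elim: k => [|k IH]; [rewrite addn0|rewrite mulSn addnCA addnC fD].
rewrite {2}(divn_eq i (cnt n)) addnC kapM fM.
set r := (i %% cnt n)%N.
have rm : (r < cnt n)%N by rewrite ltn_mod.
have [Pk ck] := kapP r.
have kn : (kap r < n)%N by apply: kap_lt; rewrite ck.
rewrite (nth_map 0%N) ?size_filter//; congr f.
have -> : iota 0 n = iota 0 (kap r).+1 ++ iota (kap r).+1 (n - (kap r).+1).
  by rewrite -{1}(subnKC kn) iotaD.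
rewrite filter_cat nth_cat size_filter.
rewrite -/(cnt _) cntS ck Pk addn1 ltnSn.
by rewrite -addn1 iotaD filter_cat nth_cat size_filter -/(cnt _) ck ltnn subnn /= Pk.
Qed.

End PeriodicEnumeration.

(** * Removing the vanished sides and merging the aligned ones *)

Section Merge.
Context {R : realType} (phi : R * R -> R) (G : seq (R * R)).
Hypotheses (aphi : anisotropy phi) (adG : admissible phi G).

Let pG : polygonal G. Proof. by case: adG. Qed.

Let G0 : (0 < size G)%N. Proof. exact: polygonal_size. Qed.

Notation nrm i := (normal (side G i)).

Lemma N0_vertex_facet i : wulff phi (N0_vertex phi G i) /\
  dot (N0_vertex phi G i) (nrm i) = dual phi (nrm i).
Proof.
have [_ vF] := N0_vertexP adG i; have [fF nF] := facet_ofP adG i.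
by have := facet_wulff fF vF; rewrite nF.
Qed.

(* Otherwise a fixed vertex of the Wulff shape has positive product with every
   normal, so the curve cannot close up. *)
Lemma transition_neq0_ex : exists j, transition G j != 0.
Proof.
apply: contrapT => no.
have tr0 j : transition G j = 0.
  by apply/eqP/negPn/negP => nj; apply: no; exists j.
pose v := N0_vertex phi G 0.
have vE j : N0_vertex phi G j = v.
  by elim: j => [//|j IH]; have [_ -> _ _] := transition0 aphi adG (tr0 j).
(* [v] rotated, so that the product of [w] with a tangent is the product of [v] with the normal. *)
pose w : R * R := (v.2, - v.1).
have inc j : dot w (vtx G j) < dot w (vtx G j.+1).
  rewrite -subr_gt0 ![dot w _]dotC -dotBl.
  rewrite (seglen_tangent (polygonal_side pG j)) dotZl mulr_gt0//.
    exact/seglen_gt0/polygonal_side.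
  have -> : dot (tangent (side G j)) w = dot v (nrm j).
    by rewrite normal_rotl /dot /w/=; ring.
  rewrite -(vE j); have [_ ->] := N0_vertex_facet j.
  exact: dual_normal_gt0.
have pos j : dot w (vtx G 0) < dot w (vtx G j.+1).
  by elim: j => [|j IH]; [exact: inc|exact: lt_trans IH (inc _)].
have := pos (size G).-1; rewrite prednK// -[size G]add0n vtxDn.
by rewrite ltxx.
Qed.

Variables (q : seq (R * R)) (lam : nat -> R).
Hypothesis dq : degenerate_limit G q lam.

Let szq : size q = size G. Proof. by case: dq. Qed.

Let q_step i : vtx q i.+1 - vtx q i = lam i *: tau G i. Proof. by case: dq. Qed.

Let lam_ge0 i : 0 <= lam i. Proof. by case: dq. Qed.

Let lam_gt0 i : transition G i != 0 -> 0 < lam i. Proof. by case: dq => _ _ _ + _; apply. Qed.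

Let vanish i : (vtx q i != vtx q i.+1) = (0 < lam i).
Proof.
rewrite eq_sym -subr_eq0 q_step lt0r lam_ge0 andbT.
have [->|l0] := eqVneq (lam i) 0; first by rewrite scale0r eqxx.
apply/eqP => lt0; have := tau_unit pG i.
have -> : tau G i = 0 by rewrite -[tau G i]scale1r -(mulVf l0) -scalerA lt0 scaler0.
by rewrite dot0l => /esym/eqP; rewrite oner_eq0.
Qed.

Let lam0_transition i : lam i = 0 -> transition G i = 0.
Proof. by move=> l0; apply/eqP/negPn/negP => /lam_gt0; rewrite l0 ltxx. Qed.

Let D := drop_vanished q.

Let G1 := merge_aligned D.

(* [kap] lists the indices of the sides of [G] that start a side of the
   relabelled curve. *)
Lemma merge_blocks : exists kap : nat -> nat,
  [/\ (0 < size G1 < size G)%N,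
      (forall i, (kap i < kap i.+1)%N) /\ (forall i, kap (i + size G1)%N = (kap i + size G)%N),
      forall i, vtx G1 i = vtx q (kap i) /\ 0 < lam (kap i),
      forall i j, (kap i <= j < kap i.+1)%N -> lam j = 0 \/ nrm j = nrm (kap i) &
      forall i, nrm (kap i.+1) <> nrm (kap i)].
Proof.
pose Pd j := vtx q j != vtx q j.+1.
have PdD i : Pd (i + size q)%N = Pd i by rewrite /Pd -addSn !vtxDn.
have exd : exists i, Pd i.
  by have [i ni] := transition_neq0_ex; exists i; rewrite /Pd vanish lam_gt0.
have q0 : (0 < size q)%N by rewrite szq.
have [kd [kdP kd_lt kd_gap kdD kdE]] := periodic_enum q0 PdD exd.
have mD := periodic_count_gt0 q0 PdD exd.
have szD : size D = count Pd (iota 0 (size q)) by rewrite size_map size_filter.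
rewrite -szD in mD kdD kdE.
have vD i : vtx D i = vtx q (kd i).
  by rewrite {1}/vtx; apply: kdE => j; exact: vtxDn.
have vDS i : vtx q (kd i).+1 = vtx q (kd i.+1).
  have : forall j, (kd i < j <= kd i.+1)%N -> vtx q j = vtx q (kd i).+1.
    elim=> [//|j IH] /andP[ij ji]; have [->//|ji'] := eqVneq j (kd i).
    have ij' : (kd i < j)%N by rewrite ltn_neqAle eq_sym ji' -ltnS.
    have := kd_gap i j; rewrite ij' ji => /(_ isT); rewrite negbK => /eqP <-.
    by rewrite IH// ij' ltnW.
  by move/(_ (kd i.+1)); rewrite kd_lt leqnn => ->.
have lamk i : 0 < lam (kd i) by rewrite -vanish; exact: kdP.
have tD i : tangent (side D i) = tau G (kd i).
  have [] // := @tangent_scale _ (side D i) _ _ (tau_unit pG (kd i)) (lamk i).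
  by rewrite /= !vD -vDS q_step.
have nD i : normal (side D i) = nrm (kd i) by exact/eq_normal.
pose Pm j := normal (side D (prev_idx D j)) != normal (side D j).
have PmD i : Pm (i + size D)%N = Pm i.
  by rewrite /Pm sideDn /prev_idx addnAC sideDn.
(* Were all remaining sides aligned, the product with their tangent would increase strictly along
   the closed polygon [D]. *)
have exm : exists i, Pm i.
  apply: contrapT => no.
  have tc a : tau G (kd a) = tau G (kd 0).
    elim: a => [//|a IH]; rewrite -IH -!tD.
    have /negP : ~ Pm a.+1 by move=> Pa; apply: no; exists a.+1.
    by rewrite negbK side_prev_S => /eqP/eq_normal.
  pose t := tau G (kd 0).
  have inc j : dot t (vtx D j) < dot t (vtx D j.+1).
    rewrite -subr_gt0 ![dot t _]dotC -dotBl !vD -vDS q_step tc dotZl (tau_unit pG (kd 0)).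
    by rewrite mulr1.
  have pos j : dot t (vtx D 0) < dot t (vtx D j.+1).
    by elim: j => [|j IH]; [exact: inc|exact: lt_trans IH (inc _)].
  by have := pos (size D).-1; rewrite prednK// -(vtxDn D 0) add0n ltxx.
have [km [kmP km_lt km_gap kmD kmE]] := periodic_enum mD PmD exm.
have mG1 := periodic_count_gt0 mD PmD exm.
have szG1 : size G1 = count Pm (iota 0 (size D)) by rewrite size_map size_filter.
rewrite -szG1 in mG1 kmD kmE.
have kd_mono i j : (i <= j)%N -> (kd i <= kd j)%N.
  move=> ij; rewrite -(subnKC ij); elim: (j - i)%N => [|k IH]; first by rewrite addn0.
  by rewrite addnS; apply: leq_trans IH _; exact: ltnW.
have same i a : (km i <= a < km i.+1)%N -> nrm (kd a) = nrm (kd (km i)).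
  elim: a => [|a IH] /andP[ia ai]; first by move: ia; rewrite leqn0 => /eqP->.
  have [->//|ia'] := eqVneq (km i) a.+1.
  have {}ia : (km i < a.+1)%N by rewrite ltn_neqAle ia'.
  have := km_gap i a.+1; rewrite ia ai => /(_ isT); rewrite negbK side_prev_S !nD => /eqP <-.
  by apply: IH; rewrite -ltnS ia ltnW.
exists (kd \o km); split=> //=.
- rewrite mG1 /= szG1.
  (* The side [j] with [lam j = 0] fails [Pd], so already the first filter shortens the list
     strictly. *)
  apply: leq_ltn_trans (count_size _ _) _; rewrite size_iota szD -szq.
  have [_ _ _ _ [j jG lj0]] := dq.
  rewrite -{2}[size q](size_iota 0) -(count_predC Pd) -[X in (X < _)%N]addn0 ltn_add2l.
  rewrite -has_count; apply/hasP; exists j; first by rewrite mem_iota szq.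
  by rewrite /= /Pd vanish lj0 ltxx.
- split=> i; last by rewrite kmD kdD szq.
  apply: leq_trans (kd_mono _ _ (km_lt i)); exact: kd_lt.
- move=> i; split=> //; rewrite -vD {1}/vtx; apply: kmE => j; exact: vtxDn.
- move=> i j /andP[ij ji].
  have [a [ia ai aj ja]] : exists a, [/\ (km i <= a)%N, (a < km i.+1)%N, (kd a <= j)%N & (j < kd a.+1)%N].
    have : forall b, (km i < b)%N -> (j < kd b)%N -> exists a, [/\ (km i <= a)%N, (a < b)%N, (kd a <= j)%N & (j < kd a.+1)%N].
      elim=> [//|b IH] ib jb; have [bj|jb'] := leqP (kd b) j.
        by exists b; rewrite -ltnS ib ltnSn.
      have ib' : (km i < b)%N.
        rewrite ltn_neqAle -ltnS ib andbT; apply/eqP => E.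
        by move: ij; rewrite E leqNgt jb'.
      have [a [h1 h2 h3 h4]] := IH ib' jb'; exists a; split=> //; exact: ltnW.
    by apply=> //; exact: km_lt.
  have [ja'|ja'] := eqVneq j (kd a); first by right; rewrite ja' (same i a)// ia ai.
  left; have := kd_gap a j; rewrite ltn_neqAle eq_sym ja' aj ja => /(_ isT).
  by rewrite /Pd vanish -leNgt => lj; apply/eqP; rewrite eq_le lj lam_ge0.
move=> i E; have := kmP i.+1; rewrite /Pm => /negP; apply; apply/eqP.
have [k kE] : exists k, km i.+1 = k.+1 by case: (km i.+1) (km_lt i) => // k _; exists k.
rewrite kE side_prev_S !nD -kE E; apply: same; rewrite kE ltnSn andbT -ltnS -kE.
exact: km_lt.
Qed.

Section Blocks.
Variable kap : nat -> nat.
Hypotheses (szG1 : (0 < size G1)%N) (kap_lt : forall i, (kap i < kap i.+1)%N).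
Hypothesis kapD : forall i, kap (i + size G1)%N = (kap i + size G)%N.
Hypotheses (vG1 : forall i, vtx G1 i = vtx q (kap i)) (lam_kap : forall i, 0 < lam (kap i)).
Hypothesis block : forall i j, (kap i <= j < kap i.+1)%N ->
  lam j = 0 \/ nrm j = nrm (kap i).
Hypothesis kap_neq : forall i, nrm (kap i.+1) <> nrm (kap i).

Notation Nv := (N0_vertex phi G).

Notation Fc := (facet_of phi G).

(** The portion of the merged side [i] covered before vertex [j] of [q]. *)
Definition arc i j : R := \sum_(kap i <= l < j) lam l.

Let q_block i j : (kap i <= j <= kap i.+1)%N ->
  vtx q j = vtx q (kap i) + arc i j *: tau G (kap i).
Proof.
rewrite /arc; elim: j => [|j IH] /andP[ij ji].
  by move: ij; rewrite leqn0 => /eqP->; rewrite big_geq// scale0r addr0.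
have [<-|ij'] := eqVneq (kap i) j.+1; first by rewrite big_geq// scale0r addr0.
have {}ij : (kap i <= j)%N by rewrite -ltnS ltn_neqAle ij'.
rewrite big_nat_recr//= scalerDl addrA -IH; last by rewrite ij (ltnW ji).
rewrite -[LHS](subrK (vtx q j)) q_step addrC; congr (_ + _).
have [->|nE] := block (introT andP (conj ij ji)); first by rewrite !scale0r.
by rewrite (_ : tau G j = tau G (kap i))//; exact/eq_normal.
Qed.

Let arc_gt0 i : 0 < arc i (kap i.+1).
Proof.
rewrite /arc big_ltn//; apply: (lt_le_trans (lam_kap i)).
by rewrite lerDl sumr_ge0.
Qed.

Let G1_step i : vtx G1 i.+1 - vtx G1 i = arc i (kap i.+1) *: tau G (kap i).
Proof.
rewrite !vG1 (@q_block i (kap i.+1)); first by rewrite addrC addKr.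
by rewrite leqnn (ltnW (kap_lt i)).
Qed.

Let G1_side i : vtx G1 i != vtx G1 i.+1 /\ tau G1 i = tau G (kap i).
Proof.
by have [] := @tangent_scale _ (side G1 i) _ _ (tau_unit pG (kap i)) (arc_gt0 i) (G1_step i).
Qed.

Let G1_normal i : normal (side G1 i) = nrm (kap i).
Proof. by apply/eq_normal; have [] := G1_side i. Qed.

Let G1_facet i : facet_of phi G1 i = Fc (kap i).
Proof. by rewrite !facet_ofE G1_normal. Qed.

(** A side of length 0 has transition number 0, so [N^0] has the same value at both of its ends; the
    other sides of the block share one normal and thus one facet. *)
Lemma block_vertex i j : (kap i <= j <= kap i.+1)%N ->
  Nv j = (Fc (kap i)).1 \/ Nv j = (Fc (kap i)).2.
Proof.
elim: j => [|j IH] /andP[ij ji].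
  by move: ij; rewrite leqn0 => /eqP<-; have [] := N0_vertexP adG (kap i).
have [<-|ij'] := eqVneq (kap i) j.+1; first by have [] := N0_vertexP adG (kap i).
have {}ij : (kap i <= j)%N by rewrite -ltnS ltn_neqAle ij'.
have [l0|nE] := block (introT andP (conj ij ji)).
  have [_ -> _ _] := transition0 aphi adG (lam0_transition l0).
  by apply: IH; rewrite ij (ltnW ji).
have -> : Fc (kap i) = Fc j by rewrite !facet_ofE nE.
by have [] := N0_vertexP adG j.+1; rewrite facet_prevS.
Qed.

Lemma block_common i : common_vertex (Fc (kap i)) (Fc (kap i.+1)) (Nv (kap i.+1)).
Proof.
split; first by apply: block_vertex; rewrite leqnn (ltnW (kap_lt i)).
by have [] := N0_vertexP adG (kap i.+1).
Qed.

(** Consecutive merged sides have distinct facets with a common vertex; [common_end] then also shows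
    that they are not parallel. *)
Lemma merge_admissible : admissible phi G1.
Proof.
split.
- split=> [//|i|i]; first by case: (G1_side i).
  rewrite -!/(tau _ _); have [_ ->] := G1_side i; have [_ ->] := G1_side i.+1.
  have [f1 n1] := facet_ofP adG (kap i); have [f2 n2] := facet_ofP adG (kap i.+1).
  have := common_end aphi f1 f2 (block_common i); rewrite n1 n2 !(tangent_facet_of adG).
  move=> /(_ (fun E => kap_neq (esym E))) [[c _]|[c _]]; first by rewrite lt_eqF.
  by rewrite gt_eqF.
- by move=> i; exists (Fc (kap i)); rewrite G1_normal; exact: facet_ofP.
by move=> i; exists (Nv (kap i.+1)); rewrite !G1_facet; exact: block_common.
Qed.

Lemma merge_N0_vertex i : N0_vertex phi G1 i = Nv (kap i).
Proof.
have adG1 := merge_admissible.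
(* Adding a period turns the index into a successor, so that [block_common] at its predecessor
   identifies the vertex. *)
rewrite -(N0_vertexDn adG1) -(N0_vertexDn adG (kap i)) -kapD.
have -> : (i + size G1 = (i + (size G1).-1).+1)%N by rewrite -addnS prednK.
apply/esym/(N0_vertex_unique aphi adG1).
by rewrite facet_prevS !G1_facet; exact: block_common.
Qed.

(** An antisymmetric function that vanishes on the diagonal is additive over two points, and inside
    a block [N^0] only takes the two ends of one facet; the sum over a block thus collapses to its
    end values. With [inc := sangle] this preserves the total turning. *)
Lemma block_sum (inc : R * R -> R * R -> R) : (forall u, inc u u = 0) ->
  (forall u v, inc u v = - inc v u) ->
  \sum_(0 <= i < size G1) inc (N0_vertex phi G1 i) (N0_vertex phi G1 i.+1) =
  \sum_(0 <= j < size G) inc (Nv j) (Nv j.+1).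
Proof.
move=> inc0 incN.
have add3 a b u v w : u = a \/ u = b -> v = a \/ v = b -> w = a \/ w = b ->
    inc u w = inc u v + inc v w.
  by move=> [->|->] [->|->] [->|->]; rewrite ?inc0 ?addr0 ?add0r// [inc b a]incN ?subrr ?addNr.
have blk i j : (kap i <= j <= kap i.+1)%N ->
    inc (Nv (kap i)) (Nv j) = \sum_(kap i <= l < j) inc (Nv l) (Nv l.+1).
  elim: j => [|j IH] /andP[ij ji].
    by move: ij; rewrite leqn0 => /eqP->; rewrite big_geq.
  have [<-|ij'] := eqVneq (kap i) j.+1; first by rewrite big_geq.
  have {}ij : (kap i <= j)%N by rewrite -ltnS ltn_neqAle ij'.
  rewrite big_nat_recr//= -IH; last by rewrite ij (ltnW ji).
  apply: (@add3 (Fc (kap i)).1 (Fc (kap i)).2); apply: block_vertex.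
  - by rewrite leqnn (ltnW (kap_lt i)).
  - by rewrite ij (ltnW ji).
  - by rewrite ji (leqW ij).
have tot m : \sum_(0 <= i < m) inc (Nv (kap i)) (Nv (kap i.+1)) =
    \sum_(kap 0 <= l < kap m) inc (Nv l) (Nv l.+1).
  elim: m => [|m IH]; first by rewrite !big_geq.
  have kap0 k : (kap 0 <= kap k)%N by elim: k => [//|k /leq_trans]; apply; exact: (ltnW (kap_lt k)).
  rewrite big_nat_recr//= IH (@blk m (kap m.+1)).
    by rewrite -big_cat_nat ?kap0// (ltnW (kap_lt m)).
  by rewrite leqnn (ltnW (kap_lt m)).
under eq_bigr do rewrite !merge_N0_vertex.
rewrite tot -[size G1]add0n kapD.
(* The sum over one period does not depend on the index at which the period starts. *)
elim: (kap 0) => [|k IH]; first by rewrite add0n.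
have kn : (k < k + size G)%N by rewrite -[X in (X < _)%N]addn0 ltn_add2l.
rewrite -IH [RHS]big_ltn// addSn big_nat_recr//= addrC; congr (_ + _).
by rewrite -addSn !(N0_vertexDn adG).
Qed.

Let segset_ray (S : (R * R) * (R * R)) (t : R * R) (l : R) x : 0 <= l ->
  S.2 - S.1 = l *: t -> segset S x <-> exists2 mu, 0 <= mu <= l & x = S.1 + mu *: t.
Proof.
move=> l0 SE; have S2 : S.2 = S.1 + l *: t by rewrite -SE addrC subrK.
have pt s : (1 - s) *: S.1 + s *: S.2 = S.1 + (s * l) *: t.
  by rewrite S2 scalerDr addrA -scalerDl subrK scale1r scalerA.
split=> [[s [/andP[s0 s1] ->]]|[mu /andP[mu0 mul] ->]].
  by exists (s * l); rewrite ?pt// mulr_ge0//= ler_piMl.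
have [l00|ln0] := eqVneq l 0.
  exists 0; rewrite lexx ler01 pt mul0r; split=> //.
  by move: mul; rewrite l00 => mul; have -> : mu = 0 by apply/eqP; rewrite eq_le mul.
exists (mu / l); rewrite divr_ge0//= pt divfK//; split=> //.
by rewrite ler_pdivrMr ?mul1r// lt0r ln0.
Qed.

(** A point at distance [mu] along a merged side lies on the side of [q] across which [arc] passes
    [mu]; conversely, after a shift by whole periods, every side of [q] lies in some block. *)
Lemma merge_trace : trace G1 = trace q.
Proof.
have kap_ge j : (j <= kap j)%N by elim: j => [//|j IH]; exact: leq_ltn_trans IH _.
have find_block (f : nat -> bool) a b : (a < b)%N -> f a -> ~~ f b ->
    exists j, [/\ (a <= j)%N, (j < b)%N, f j & ~~ f j.+1].
  move=> ab fa; elim: b ab => [//|b IH] ab fb.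
  have [fb'|fb'] := boolP (f b); first by exists b; rewrite -ltnS ab ltnSn.
  have ab' : (a < b)%N.
    by rewrite ltn_neqAle -ltnS ab andbT; apply: contraNneq fb' => <-.
  by have [j [h1 h2 h3 h4]] := IH ab' fb'; exists j; split=> //; exact: leqW.
rewrite eqEsubset; split=> x [i [iG xi]].
- have [mu /andP[mu0 mul] ->] :=
    (@segset_ray (side G1 i) _ _ x (ltW (arc_gt0 i)) (G1_step i)).1 xi.
  have [j [ij ji muj]] : exists j, [/\ (kap i <= j)%N, (j < kap i.+1)%N &
      arc i j <= mu <= arc i j.+1].
    have [mul'|mul'] := eqVneq mu (arc i (kap i.+1)).
      exists (kap i.+1).-1; have k0 : (0 < kap i.+1)%N by exact: leq_ltn_trans (kap_lt i).
      rewrite -ltnS prednK//; split=> //.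
      rewrite {2}mul' lexx andbT mul' /arc -{2}(prednK k0) big_nat_recr/=; last first.
        by rewrite -ltnS prednK.
      by rewrite lerDl.
    have [||j [h1 h2 h3 h4]] := find_block (fun j => arc i j <= mu) _ _ (kap_lt i).
    - by rewrite /arc big_geq.
    - by rewrite -ltNge lt_neqAle mul'.
    exists j; split=> //; rewrite h3 ltW//.
    by move: h4; rewrite -ltNge.
  exists (j %% size q)%N; rewrite ltn_mod szq; split=> //.
  have -> : side q (j %% size G) = side q j by apply: eq_side; rewrite szq modn_mod.
  apply: (@segset_ray (side q j) _ _ _ (lam_ge0 j) (q_step j)).2.
  have arcS : arc i j.+1 = arc i j + lam j by rewrite /arc big_nat_recr.
  case/andP: muj => mu1 mu2; exists (mu - arc i j).
    by rewrite subr_ge0 mu1 lerBlDl -arcS.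
  rewrite /= vG1 (@q_block i j) ?ij ?(ltnW ji)// -addrA; congr (_ + _).
  have [l0|nE] := block (introT andP (conj ij ji)).
    have -> : mu = arc i j by apply/eqP; rewrite eq_le mu1 andbT -[leRHS]addr0 -l0 -arcS.
    by rewrite subrr scale0r addr0.
  rewrite (_ : tau G j = tau G (kap i)); last exact/eq_normal.
  by rewrite -scalerDl addrC subrK.
(* Adding [kap 0] periods moves the index past [kap 0], where the blocks begin. *)
pose j := (i + kap 0 * size q)%N.
have sq0 : (0 < size q)%N by rewrite szq.
have [||k [_ _ kj jk]] := find_block (fun k => kap k <= j)%N 0%N j.+1 (ltn0Sn j).
- by rewrite /j; apply: leq_trans (leq_addl _ _); rewrite leq_pmulr.
- by rewrite -ltnNge; exact: kap_ge.
rewrite -ltnNge in jk.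
have sj : side q i = side q j by apply: eq_side; rewrite /j addnC modnMDl.
rewrite sj in xi.
have [mu /andP[mu0 mul] ->] := (@segset_ray (side q j) _ _ x (lam_ge0 j) (q_step j)).1 xi.
exists (k %% size G1)%N; rewrite ltn_mod; split=> //.
have -> : side G1 (k %% size G1) = side G1 k by apply: eq_side; rewrite modn_mod.
apply: (@segset_ray (side G1 k) _ _ _ (ltW (arc_gt0 k)) (G1_step k)).2.
exists (arc k j + mu).
  rewrite addr_ge0//=; last by rewrite /arc sumr_ge0.
  apply: (@le_trans _ _ (arc k j.+1)); first by rewrite /arc big_nat_recr//= lerD2l.
  by rewrite /arc (big_cat_nat (leqW kj) jk)/= lerDl sumr_ge0.
rewrite /= vG1 (@q_block k j) ?kj ?(ltnW jk)// -addrA; congr (_ + _).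
have [l0|nE] := block (introT andP (conj kj jk)).
  have -> : mu = 0 by apply/eqP; rewrite eq_le mu0 andbT -l0.
  by rewrite scale0r !addr0.
by rewrite (_ : tau G j = tau G (kap k)) ?scalerDl//; exact/eq_normal.
Qed.

End Blocks.

End Merge.

(** * The index as a total turning angle *)

Section TurningAngle.
Context {R : realType}.
Implicit Types (u v n : R * R).

(* The signed angle from [u] to [v], by the half-angle formula; junk when
   they are opposite. *)
Definition sangle u v : R :=
  2 * atan (cross u v / (enorm u * enorm v + dot u v)).

Lemma sanglevv u : sangle u u = 0.
Proof. by rewrite /sangle crossv mul0r atan0 mulr0. Qed.

Lemma sangleN u v : sangle u v = - sangle v u.
Proof.
by rewrite /sangle crossC mulNr atanN mulrN (dotC u v) (mulrC (enorm u)).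
Qed.

(** Vectors in a common open half-plane are not opposite: a zero value would be equality in the
    Cauchy-Schwarz inequality with the negative sign. This keeps [sangle] away from its junk
    value. *)
Lemma halfspace_gt0 u v n : 0 < dot u n -> 0 < dot v n ->
  0 < enorm u * enorm v + dot u v.
Proof.
move=> un vn.
have cs := dot_le_enorm u v; rewrite ler_norml in cs; case/andP: cs => cs _.
have PD : 0 <= enorm u * enorm v + dot u v by move: cs; lra.
rewrite lt0r PD andbT; apply/eqP => E.
have uv : dot u v = - (enorm u * enorm v) by move: E; lra.
have cr : cross u v = 0.
  have := dot_cross_sqr u v; rewrite uv sqrrN exprMn !enorm_sqr => /eqP.
  by rewrite -subr_eq0 addrC addKr sqrf_eq0 => /eqP.
have e1 : dot u v * dot u n = dot u u * dot v n.
  have : dot u v * dot u n - dot u u * dot v n = cross u v * (u.2 * n.1 - u.1 * n.2).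
    by rewrite /dot /cross; ring.
  by rewrite cr mul0r => /subr0_eq.
have u0 : u != 0 by apply/eqP => u0; rewrite u0 dot0l ltxx in un.
have : 0 < dot u u * dot v n by rewrite mulr_gt0// dot_gt0.
by rewrite -e1 pmulr_lgt0// uv oppr_gt0 ltNge mulr_ge0 ?enorm_ge0.
Qed.

(** The double-angle formulas turn the arctangent into [cos = dot / (|u| |v|)] and
    [sin = cross / (|u| |v|)], and the addition formulas then rotate [u] onto the direction of
    [v]. *)
Lemma sangle_polar u v n (a : R) : 0 < dot u n -> 0 < dot v n ->
  u = enorm u *: (cos a, sin a) ->
  v = enorm v *: (cos (a + sangle u v), sin (a + sangle u v)).
Proof.
move=> un vn ua; have P := halfspace_gt0 un vn.
have u0 : u != 0 by apply/eqP => u0; rewrite u0 dot0l ltxx in un.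
have v0 : v != 0 by apply/eqP => v0; rewrite v0 dot0l ltxx in vn.
have eu := enorm_gt0 u0; have ev := enorm_gt0 v0.
set x := cross u v / (enorm u * enorm v + dot u v).
have x1 : 1 + x ^+ 2 = 2 * (enorm u * enorm v) / (enorm u * enorm v + dot u v).
  have L := dot_cross_sqr u v; rewrite -!enorm_sqr in L.
  have : cross u v ^+ 2 = enorm u ^+ 2 * enorm v ^+ 2 - dot u v ^+ 2 by rewrite -L; ring.
  rewrite /x exprMn => ->; field; exact: lt0r_neq0.
have s1 : 0 < 1 + x ^+ 2 by rewrite ltr_wpDr ?sqr_ge0.
have c0 : cos (atan x) != 0 by rewrite cos_atan invr_eq0 gt_eqF// sqrtr_gt0.
have sE : sin (atan x) = x * cos (atan x) by rewrite -[X in X * _](atanK x) /tan divfK.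
have c2 : cos (atan x) ^+ 2 = (enorm u * enorm v + dot u v) / (2 * (enorm u * enorm v)).
  by rewrite cos_atan exprVn sqr_sqrtr ?ltW// x1 invf_div.
have dbl : sangle u v = atan x *+ 2 by rewrite /sangle mulr_natl.
have cE : cos (sangle u v) = dot u v / (enorm u * enorm v).
  by rewrite dbl cos_mulr2n c2 -mulr_natl; field; rewrite !gt_eqF.
have siE : sin (sangle u v) = cross u v / (enorm u * enorm v).
  rewrite dbl sin_mulr2n sE -mulr_natl.
  rewrite (_ : cos (atan x) * _ = x * cos (atan x) ^+ 2); last by ring.
  rewrite c2 /x.
  by field; rewrite !gt_eqF.
rewrite cosD sinD cE siE.
have ca : cos a = u.1 / enorm u by rewrite (congr1 fst ua) /= mulrC mulKf ?gt_eqF.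
have sa : sin a = u.2 / enorm u by rewrite (congr1 snd ua) /= mulrC mulKf ?gt_eqF.
have U2 : dot u u != 0 by rewrite gt_eqF// dot_gt0.
apply: eq_pair2; rewrite /= ca sa; apply: (mulIf U2).
  transitivity (u.1 * dot u v - u.2 * cross u v); first by rewrite /dot /cross; ring.
  by rewrite /GRing.scale/= -enorm_sqr; field; rewrite !gt_eqF.
transitivity (u.2 * dot u v + u.1 * cross u v); first by rewrite /dot /cross; ring.
by rewrite /GRing.scale/= -enorm_sqr; field; rewrite !gt_eqF.
Qed.

Lemma polar_ex u : u != 0 -> exists a : R, u = enorm u *: (cos a, sin a).
Proof.
move=> u0; have e0 := enorm_gt0 u0.
pose x := u.1 / enorm u; pose y := u.2 / enorm u.
have xy : x ^+ 2 + y ^+ 2 = 1.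
  rewrite !exprMn exprVn -mulrDl enorm_sqr /dot -!expr2 divff// gt_eqF//.
  by have := dot_gt0 u0; rewrite /dot -!expr2.
have ux : u.1 = enorm u * x by rewrite mulrC divfK// gt_eqF.
have uy : u.2 = enorm u * y by rewrite mulrC divfK// gt_eqF.
have x1 : -1 <= x <= 1.
  by rewrite -ler_norml -(@ler_pXn2r _ 2) ?nnegrE// expr1n -normrX ger0_norm ?sqr_ge0// -xy lerDl sqr_ge0.
have s1 : sin (acos x) = `|y| by rewrite sin_acos// -xy addrC addKr sqrtr_sqr.
have c1 : cos (acos x) = x by rewrite acosK ?in_itv.
have [y0|/ltW y0] := leP 0 y.
  by exists (acos x); apply: eq_pair2; rewrite /= ?c1 ?s1 ?ger0_norm.
exists (- acos x); apply: eq_pair2; rewrite /= ?cosN ?sinN ?c1 ?s1//.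
by rewrite ler0_norm// opprK.
Qed.

Lemma cos_eq1 (d : R) : cos d = 1 -> exists k : int, d = k%:~R * (2 * pi).
Proof.
move=> cd; have pi2 : 0 < 2 * pi :> R by rewrite mulr_gt0// pi_gt0.
pose k := Num.floor (d / (2 * pi)); exists k.
pose r := d - k%:~R * (2 * pi).
have r0 : 0 <= r.
  by rewrite subr_ge0 -ler_pdivlMr// floor_le_tmp.
have r1 : r < 2 * pi.
  have := floorD1_gt (d / (2 * pi)); rewrite -/k ltr_pdivrMr// intrD mulrDl mul1r.
  by rewrite /r ltrBlDl.
have per (n : nat) (y : R) : cos (y + n%:R * (2 * pi)) = cos y.
  by rewrite mulr_natl (mulr_natl pi 2) periodicn//; exact: cosD2pi.
have cr : cos r = 1.
  rewrite -cd /r; case: k {r r0 r1} => n.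
    by have := per n (d - n%:R * (2 * pi)); rewrite subrK => ->.
  rewrite NegzE mulrNz mulNr opprK -[X in X * _]pmulrn; exact: per.
have [rpi|pir] := leP r pi.
  have : r = 0; last by move/subr0_eq.
  by apply: (@cos_inj R); rewrite ?in_itv/= ?r0 ?rpi ?lexx ?pi_ge0// cr cos0.
have : 2 * pi - r = 0.
  apply: (@cos_inj R); rewrite ?in_itv/= ?lexx ?pi_ge0//.
    by rewrite subr_ge0 ltW//=; move: pir; lra.
  by rewrite cos_2piB cr cos0.
by move=> /subr0_eq E; move: r1; rewrite -E ltxx.
Qed.

Lemma continuous_bigsum (J : Type) (s : seq J) (f : J -> R -> R) :
  (forall j, continuous (f j)) -> continuous (fun x => \sum_(j <- s) f j x).
Proof.
move=> cf x; elim: s => [|j s IH].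
  by under eq_fun do rewrite big_nil; exact: cvg_cst.
under eq_fun do rewrite big_cons.
by apply: cvgD; [exact: cf|exact: IH].
Qed.

(** The projection onto [[0, 1]], written with absolute values so that continuity is immediate. *)
Definition clamp (r : R) : R := (`|r| - `|r - 1| + 1) / 2.

Lemma clamp_id (r : R) : 0 <= r <= 1 -> clamp r = r.
Proof. by move=> /andP[r0 r1]; rewrite /clamp ger0_norm// ler0_norm ?subr_le0//; field. Qed.

Lemma clamp0 (r : R) : r <= 0 -> clamp r = 0.
Proof.
move=> r0; have r1 : r - 1 <= 0 by lra.
by rewrite /clamp ler0_norm// ler0_norm//; field.
Qed.

Lemma clamp1 (r : R) : 1 <= r -> clamp r = 1.
Proof.
move=> r1; have r0 : 0 <= r by lra.
by rewrite /clamp ger0_norm// ger0_norm ?subr_ge0//; field.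
Qed.

Lemma clamp01 (r : R) : 0 <= clamp r <= 1.
Proof.
have [/ltW r0|r0] := ltP r 0; first by rewrite clamp0// lexx ler01.
have [/ltW r1|r1] := ltP 1 r; first by rewrite clamp1// lexx ler01.
by rewrite clamp_id r0 r1.
Qed.

Lemma clamp_continuous : continuous clamp.
Proof.
move=> x; rewrite /clamp; apply: cvgMr_tmp; apply: cvgD; last exact: cvg_cst.
apply: cvgB; first exact: (@norm_continuous _ R).
apply: (@cvg_comp _ _ _ (fun r => r - 1) (fun r : R => `|r|)); last exact: (@norm_continuous _ R).
by apply: cvgB; [exact: cvg_id|exact: cvg_cst].
Qed.

Lemma sangle_continuous u v n (r : R) : 0 < dot u n -> 0 < dot v n -> 0 <= r <= 1 ->
  {for r, continuous (fun r : R => sangle u ((1 - r) *: u + r *: v))}.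
Proof.
move=> un vn /andP[r0 r1]; rewrite /sangle.
pose p (r : R) := (1 - r) *: u + r *: v.
have pn : 0 < dot (p r) n.
  rewrite /p dotDl !dotZl; have [->|rn0] := eqVneq r 0.
    by rewrite mul0r subr0 mul1r addr0.
  by rewrite ltr_wpDl// ?mulr_ge0 ?subr_ge0 ?(ltW un)// mulr_gt0// lt0r rn0.
have D0 := halfspace_gt0 un pn.
have p1 : (p x).1 @[x --> r] --> (p r).1.
  apply: cvgD; last by apply: cvgMr_tmp; exact: cvg_id.
  by apply: cvgMr_tmp; apply: cvgB; [exact: cvg_cst|exact: cvg_id].
have p2 : (p x).2 @[x --> r] --> (p r).2.
  apply: cvgD; last by apply: cvgMr_tmp; exact: cvg_id.
  by apply: cvgMr_tmp; apply: cvgB; [exact: cvg_cst|exact: cvg_id].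
have cc : cross u (p x) @[x --> r] --> cross u (p r).
  by apply: cvgB; apply: cvgMl_tmp.
have cd : dot u (p x) @[x --> r] --> dot u (p r).
  by apply: cvgD; apply: cvgMl_tmp.
have ce : enorm (p x) @[x --> r] --> enorm (p r).
  apply: (@cvg_comp _ _ _ (fun x => dot (p x) (p x)) Num.sqrt); last exact: sqrt_continuous.
  by apply: cvgD; apply: cvgM.
apply: cvgMl_tmp; apply: (@cvg_comp _ _ _ (fun x => cross u (p x) / (enorm u * enorm (p x) + dot u (p x))) atan); last exact: continuous_atan.
apply: cvgM => //; apply: cvgV; first by rewrite gt_eqF.
by apply: cvgD => //; exact: cvgMl_tmp.
Qed.

End TurningAngle.

Section Index.
Context {R : realType} (phi : R * R -> R) (G : seq (R * R)).
Hypotheses (aphi : anisotropy phi) (adG : admissible phi G).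

Let pG : polygonal G. Proof. by case: adG. Qed.

Notation V i := (N0_vertex phi G i).

Notation nrm i := (normal (side G i)).

Let V_dot i : 0 < dot (V i) (nrm i).
Proof. by have [_ ->] := N0_vertex_facet adG i; exact: dual_normal_gt0. Qed.

Let VS_dot i : 0 < dot (V i.+1) (nrm i).
Proof.
have [vF _] := N0_vertexP adG i.+1; rewrite facet_prevS in vF.
have [fF nF] := facet_ofP adG i.
by have [_] := facet_wulff fF vF; rewrite nF => ->; exact: dual_normal_gt0.
Qed.

(** Equal to [- 2 * pi] times the index, but computed from the vertices alone: along side [i] the
    field stays in the open half-plane of the normal of that side, so it turns by the angle
    [sangle]. *)
Definition total_turn : R := \sum_(0 <= i < size G) sangle (V i) (V i.+1).

Let polar (a : R) : V 0 = enorm (V 0) *: (cos a, sin a) -> forall j,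
  let b := a + \sum_(0 <= i < j) sangle (V i) (V i.+1) in
  V j = enorm (V j) *: (cos b, sin b).
Proof.
move=> a0; elim=> [|j IH] /=; first by rewrite big_geq// addr0.
rewrite big_nat_recr//= addrA; exact: sangle_polar (V_dot j) (VS_dot j) IH.
Qed.

Let V0_neq0 : V 0 != 0.
Proof. by apply/eqP => V0; have := V_dot 0; rewrite V0 dot0l ltxx. Qed.

(** After one period the vertex value of [N^0] is the initial one, so its polar angle has changed by
    a multiple of [2 * pi]. *)
Lemma total_turn_int : exists k : int, total_turn = - (k%:~R * (2 * pi)).
Proof.
have [a a0] := polar_ex V0_neq0.
have := polar a0 (size G); rewrite -[size G]add0n (N0_vertexDn adG) add0n -/total_turn /=.
have e0 := enorm_gt0 V0_neq0; rewrite {1}a0 => /(congr1 (fun u => (enorm (V 0))^-1 *: u)).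
rewrite !scalerA mulVf ?gt_eqF// !scale1r => -[ca sa].
have [k kE] : exists k : int, total_turn = k%:~R * (2 * pi).
  apply: cos_eq1; have -> : total_turn = (a + total_turn) - a by rewrite addrC addKr.
  by rewrite cosB -ca -sa -!expr2 cos2Dsin2.
by exists (- k); rewrite kE intrN mulNr opprK.
Qed.

Lemma total_turn_index (k : int) : total_turn = - (k%:~R * (2 * pi)) -> is_index phi G k.
Proof.
move=> kE; have [a a0] := polar_ex V0_neq0.
pose f i (r : R) := sangle (V i) ((1 - clamp r) *: V i + clamp r *: V i.+1).
have f0 i r : r <= 0 -> f i r = 0.
  by move=> r0; rewrite /f clamp0// subr0 scale1r scale0r addr0 sanglevv.
have f1 i r : 1 <= r -> f i r = sangle (V i) (V i.+1).
  by move=> r1; rewrite /f clamp1// subrr scale0r scale1r add0r.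
have cf i : continuous (f i).
  move=> r; apply: (@continuous_comp _ _ _ clamp
    (fun r => sangle (V i) ((1 - r) *: V i + r *: V i.+1))); first exact: clamp_continuous.
  by apply: (sangle_continuous (V_dot i) (VS_dot i)); exact: clamp01.
(* Side [i] contributes nothing before the parameter [i] and its full angle after [i + 1]; the
   clamping makes this one continuous formula on the whole line. *)
pose theta (x : R) := a + \sum_(0 <= i < size G) f i (x - i%:R).
exists theta; split.
- apply: continuous_subspaceT => x; apply: cvgD; first exact: cvg_cst.
  apply: (@continuous_bigsum _ _ _ (fun i x => f i (x - i%:R))) => i y.
  apply: (@cvg_comp _ _ _ (fun x : R => x - i%:R) (f i)); last exact: cf.
  by apply: cvgB; [exact: cvg_id|exact: cvg_cst].
- move=> i r iG r01; rewrite /N0.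
  have thE : theta (i%:R + r) = a + \sum_(0 <= l < i) sangle (V l) (V l.+1) + f i r.
    rewrite /theta (@big_cat_nat _ _ _ i)//= ?(ltnW iG)// (@big_ltn _ _ _ i)//=.
    rewrite addrAC subrr add0r -!addrA; congr (_ + _).
    rewrite [X in _ + (_ + X)]big_nat_cond [X in _ + (_ + X)]big1 ?addr0; last first.
      move=> l /andP[/andP[il _] _]; apply: f0.
      rewrite -(subnKC il) natrD -natr1; have := ler0n R (l - i.+1); case/andP: r01; lra.
    congr (_ + _); apply: eq_big_nat => l /andP[_ li]; apply: f1.
    rewrite -(subnKC li) natrD -natr1; have := ler0n R (i - l.+1); case/andP: r01; lra.
  rewrite thE /f clamp_id//; apply: (@sangle_polar _ _ _ (nrm i)) => //.
    case/andP: r01 => r0 r1; rewrite dotDl !dotZl; have [->|rn0] := eqVneq r 0.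
      by rewrite mul0r subr0 mul1r addr0.
    by rewrite ltr_wpDl// ?mulr_ge0 ?subr_ge0 ?(ltW (V_dot i))// mulr_gt0// lt0r rn0.
  exact: (polar a0 i).
rewrite /theta opprD addrACA subrr add0r -kE /total_turn.
rewrite [X in _ - X]big1_seq ?subr0; last first.
  by move=> l _; apply: f0; rewrite sub0r oppr_le0.
apply: eq_big_nat => l /andP[_ lG]; apply: f1.
rewrite -(subnKC lG) natrD -natr1; have := ler0n R (size G - l.+1); lra.
Qed.

End Index.

(** * Kuratowski convergence of traces *)

Section Kuratowski.
Context {R : realType}.
Implicit Types (x y : R * R) (q : seq (R * R)).

(** The lower limit is contained in the upper one since the filter is proper; only two inclusions
    remain to be checked. *)
Lemma kuratowski_cvgP {I : Type} (F : set_system I) {PF : ProperFilter F}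
    (K : I -> set (R * R)) (L : set (R * R)) :
  kuratowski_cvg F K L <->
  (forall x, L x -> forall U, nbhs x U -> \forall i \near F, K i `&` U !=set0) /\
  (forall x, ~ L x -> exists2 U, nbhs x U & \forall i \near F, ~ (K i `&` U !=set0)).
Proof.
split=> [[li ls]|[li ls]].
  split=> [x|x]; first by rewrite -li.
  rewrite -ls => /existsNP[U /not_implyP[xU /contrapT nU]]; by exists U.
have lis x : kuratowski_liminf F K x -> kuratowski_limsup F K x.
  move=> xi U xU nU; have H := @filterI _ F _ _ _ (xi U xU) nU.
  by have [i [Ki /(_ Ki)]] := filter_ex (H _).
have lsL x : kuratowski_limsup F K x -> L x.
  move=> xs; apply: contrapT => /ls[U xU nU]; exact: (xs U xU).
split; rewrite eqEsubset; split=> x.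
- by move=> /lis /lsL.
- exact: li.
- exact: lsL.
- by move=> Lx; apply: lis; exact: li.
Qed.

Lemma segset_closed (S : (R * R) * (R * R)) : closed (segset S).
Proof.
apply: compact_closed; first exact: norm_hausdorff.
have -> : segset S = (fun s : R => (1 - s) *: S.1 + s *: S.2) @` [set` `[0, 1]].
  rewrite eqEsubset; split=> x /=.
    by move=> [s [s01 ->]]; exists s => //; rewrite in_itv.
  by move=> [s]; rewrite in_itv /= => s01 <-; exists s.
apply: continuous_compact; last exact: segment_compact.
apply: continuous_subspaceT => s; apply: cvgD.
  by apply: cvgZr_tmp; apply: cvgB; [exact: cvg_cst|exact: cvg_id].
by apply: cvgZr_tmp; exact: cvg_id.
Qed.

Lemma trace_closed q : closed (trace q).
Proof.
have -> : trace q = \bigcup_(i in `I_(size q)) segset (side q i).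
  rewrite eqEsubset; split=> x; first by move=> [i [iq xi]]; exists i.
  by move=> [i iq xi]; exists i.
by apply: closed_bigcup => // i _; exact: segset_closed.
Qed.

Lemma trace_kuratowski_cvg {I : Type} (F : set_system I) {PF : ProperFilter F}
    (Gm : I -> seq (R * R)) q :
  (\forall t \near F, size (Gm t) = size q) ->
  (forall i, vtx (Gm t) i @[t --> F] --> vtx q i) ->
  kuratowski_cvg F (fun t => trace (Gm t)) (trace q).
Proof.
move=> sz cv; apply/kuratowski_cvgP; split=> x.
  move=> [i [iq [s [s01 xE]]]] U xU.
  have cx : (1 - s) *: vtx (Gm t) i + s *: vtx (Gm t) i.+1 @[t --> F] --> x.
    by rewrite xE; apply: cvgD; apply: cvgZl_tmp; exact: cv.
  have := cx U xU => H; near=> t; exists ((1 - s) *: vtx (Gm t) i + s *: vtx (Gm t) i.+1).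
  split; last by near: t; exact: H.
  exists i; split; last by exists s.
  by have -> : size (Gm t) = size q by near: t.
move=> xq; have : nbhs x (~` trace q) by apply: open_nbhs_nbhs; split=> //; exact/closed_openC/trace_closed.
move=> /nbhs_ballP[e /= e0 ex].
have e20 : 0 < e / 2 by rewrite divr_gt0.
exists (ball x (e / 2)); first exact: nbhsx_ballx.
(* The indices go up to [size q] inclusive, because the last side ends at the vertex of that
   index. *)
have close : \forall t \near F, forall i : 'I_(size q).+1, `|vtx q i - vtx (Gm t) i| < e / 2.
  have H (i : 'I_(size q).+1) : \forall t \near F, `|vtx q i - vtx (Gm t) i| < e / 2.
    by have /cvgrPdist_lt/(_ _ e20) := cv i.
  exact: (@filter_forall _ _ _ _ _ H).
near=> t; move=> [y [[i [iG [s [s01 yE]]]] xy]].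
have szt : size (Gm t) = size q by near: t.
have ct : forall i : 'I_(size q).+1, `|vtx q i - vtx (Gm t) i| < e / 2 by near: t.
rewrite szt in iG.
pose z := (1 - s) *: vtx q i + s *: vtx q i.+1.
have qz : trace q z by exists i; split=> //; exists s.
have zy : `|z - y| < e / 2.
  have -> : z - y = (1 - s) *: (vtx q i - vtx (Gm t) i) + s *: (vtx q i.+1 - vtx (Gm t) i.+1).
    by rewrite yE /z; apply: eq_pair2; rewrite !pairE/=; ring.
  apply: (le_lt_trans (ler_normD _ _)); rewrite !normrZ.
  have h1 := ct (Ordinal (leqW iG)); have h2 := ct (Ordinal (iG : (i.+1 < (size q).+1)%N)).
  rewrite /= in h1 h2; case/andP: s01 => s0 s1.
  rewrite (ger0_norm s0) (ger0_norm (_ : 0 <= 1 - s)) ?subr_ge0//.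
  have : 0 <= (1 - s) * (e / 2 - `|vtx q i - vtx (Gm t) i|).
    by rewrite mulr_ge0 ?subr_ge0// ltW.
  have : 0 <= s * (e / 2 - `|vtx q i.+1 - vtx (Gm t) i.+1|).
    by rewrite mulr_ge0 ?subr_ge0// ltW.
  have [s2|s2] := leP s (2^-1).
    have : 0 < (1 - s) * (e / 2 - `|vtx q i - vtx (Gm t) i|).
      by rewrite mulr_gt0 ?subr_gt0//; lra.
    lra.
  have : 0 < s * (e / 2 - `|vtx q i.+1 - vtx (Gm t) i.+1|).
    by rewrite mulr_gt0 ?subr_gt0//; lra.
  lra.
have yz : ball y (e / 2) z by rewrite -ball_normE /= distrC.
by apply: (ex z) => //; rewrite (splitr e); exact: (ball_triangle xy yz).
Unshelve. all: by end_near. Qed.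

End Kuratowski.

(** * Cyclic relabelling *)

Section Rotation.
Context {R : realType}.
Implicit Types (G q : seq (R * R)).

Lemma vtx_rot k G i : (k <= size G)%N -> vtx (rot k G) i = vtx G (i + k).
Proof.
move=> kG; rewrite /vtx size_rot.
have [G0|Gp] := posnP (size G); first by rewrite (size0nil G0) !nth_nil.
rewrite /rot nth_cat size_drop -modnDml.
have : (i %% size G < size G)%N by rewrite ltn_mod.
move: (i %% size G)%N => r rG; case: ltnP => rk.
  have kr : (r + k < size G)%N by rewrite -(subnK kG) ltn_add2r.
  by rewrite nth_drop (modn_small kr) addnC.
rewrite nth_take; last by rewrite ltn_subLR// subnK.
have -> : (r + k = r - (size G - k) + size G)%N by move: kG rk; move: (size G) => n kG rk; lia.
by rewrite modnDr modn_small//; apply: leq_ltn_trans rG; exact: leq_subr.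
Qed.

Lemma same_curveP G G' : same_curve G G' <->
  size G' = size G /\ exists k, forall i, vtx G' i = vtx G (i + k).
Proof.
split=> [[k ->]|[sz [k kP]]].
  split; first exact: size_rot.
  have [kG|Gk] := leqP k (size G); first by exists k => i; exact: vtx_rot.
  by exists 0%N => i; rewrite rot_oversize ?addn0// ltnW.
have [G0|Gp] := posnP (size G).
  by exists 0%N; rewrite (size0nil G0) (size0nil (etrans sz G0)).
exists (k %% size G)%N; have kG : (k %% size G <= size G)%N by rewrite ltnW// ltn_mod.
apply: (@eq_from_nth _ 0); first by rewrite size_rot.
move=> i iG; have := kP i; rewrite {1}/vtx (modn_small iG) => ->.
have -> : (rot (k %% size G) G)`_i = vtx (rot (k %% size G) G) i.
  by rewrite sz in iG; rewrite /vtx size_rot (modn_small iG).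
by rewrite vtx_rot//; apply: eq_vtx; rewrite modnDmr.
Qed.

Lemma same_curve_sym G G' : same_curve G G' -> same_curve G' G.
Proof.
move=> /same_curveP[sz [k kP]]; apply/same_curveP; split=> //.
have [G0|Gp] := posnP (size G).
  exists 0%N => i; rewrite addn0.
  by rewrite (size0nil G0) (size0nil (etrans sz G0)).
exists (k * (size G).-1)%N => i; rewrite kP -addnA -[X in (_ + X)%N]mulnSr prednK//.
by rewrite vtxD.
Qed.

Lemma same_curve_trans G G' G'' : same_curve G G' -> same_curve G' G'' -> same_curve G G''.
Proof.
move=> /same_curveP[sz [k kP]] /same_curveP[sz' [k' kP']]; apply/same_curveP.
by split; [rewrite sz'|exists (k' + k)%N => i; rewrite kP' kP addnA].
Qed.

Lemma same_curve_refl G : same_curve G G. Proof. by exists 0%N; rewrite rot0. Qed.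

(** Shifting the window by [k] moves the entries selected among the first [k] positions to the end,
    whence a rotation by their number. *)
Lemma enum_shift (T : Type) (f : nat -> T) (P : pred nat) n k : (k <= n)%N ->
  (forall i, f (i + n)%N = f i) -> (forall i, P (i + n)%N = P i) ->
  [seq f (j + k)%N | j <- iota 0 n & P (j + k)%N] =
  rot (count P (iota 0 k)) [seq f j | j <- iota 0 n & P j].
Proof.
move=> kn fD PD.
have -> : [seq f (j + k)%N | j <- iota 0 n & P (j + k)%N] = [seq f j | j <- iota k n & P j].
  have -> : iota k n = map (addn k) (iota 0 n) by rewrite -iotaDl addn0.
  rewrite filter_map -map_comp.
  by rewrite (eq_filter (a2 := preim (addn k) P))//;
    [apply: eq_map => j /=; rewrite addnC|move=> j /=; rewrite addnC].
have -> : iota 0 n = iota 0 k ++ iota k (n - k) by rewrite -{1}(subnKC kn) iotaD.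
rewrite filter_cat map_cat -[X in rot X _](_ : size [seq f j | j <- iota 0 k & P j] = _); last first.
  by rewrite size_map size_filter.
rewrite rot_size_cat -{1}(subnK kn) iotaD filter_cat map_cat subnKC//; congr (_ ++ _).
have -> : iota n k = map (addn n) (iota 0 k) by rewrite -iotaDl addn0.
rewrite filter_map -map_comp.
rewrite (eq_filter (a2 := P)); last by move=> j /=; rewrite addnC PD.
by apply: eq_map => j /=; rewrite addnC fD.
Qed.

Lemma same_curve_drop q q' : same_curve q q' -> same_curve (drop_vanished q) (drop_vanished q').
Proof.
move=> [k ->]; have [kq|qk] := leqP k (size q); last first.
  by rewrite rot_oversize ?(ltnW qk)//; exact: same_curve_refl.
rewrite /drop_vanished size_rot.
exists (count (fun j => vtx q j != vtx q j.+1) (iota 0 k)).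
apply: etrans (@enum_shift _ (vtx q) (fun j => vtx q j != vtx q j.+1) (size q) k kq _ _).
- rewrite (eq_filter (a2 := fun j => vtx q (j + k) != vtx q (j + k).+1)).
    by apply: eq_map => j; exact: vtx_rot.
  by move=> j /=; rewrite !vtx_rot// addSn.
- by move=> i; exact: vtxDn.
- by move=> i; rewrite -addSn !vtxDn.
Qed.

Lemma side_rot k G i : (k <= size G)%N -> side (rot k G) i = side G (i + k).
Proof. by move=> kG; rewrite /side !vtx_rot. Qed.

Lemma prev_rot k G i : (prev_idx (rot k G) i + k)%N = prev_idx G (i + k).
Proof. by rewrite /prev_idx size_rot addnAC. Qed.

Lemma same_curve_merge q q' : same_curve q q' -> same_curve (merge_aligned q) (merge_aligned q').
Proof.
move=> [k ->]; have [kq|qk] := leqP k (size q); last first.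
  by rewrite rot_oversize ?(ltnW qk)//; exact: same_curve_refl.
rewrite /merge_aligned size_rot.
exists (count (fun j => normal (side q (prev_idx q j)) != normal (side q j)) (iota 0 k)).
apply: etrans (@enum_shift _ (vtx q)
  (fun j => normal (side q (prev_idx q j)) != normal (side q j)) (size q) k kq _ _).
- rewrite (eq_filter (a2 := fun j => normal (side q (prev_idx q (j + k))) != normal (side q (j + k)))).
    by apply: eq_map => j; exact: vtx_rot.
  by move=> j /=; rewrite !side_rot// prev_rot.
- by move=> i; exact: vtxDn.
- by move=> i; rewrite sideDn /prev_idx addnAC sideDn.
Qed.

End Rotation.

(** * Flows under cyclic relabelling *)

Section Shift.
Context {R : realType}.
Implicit Types (G q : seq (R * R)) (k : nat).

(** [same_curve] with its shift made explicit: along a flow a single [k] has to serve for all times,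
    so that the height of each side is followed through time. *)
Definition shifted k G G' := size G' = size G /\ forall i, vtx G' i = vtx G (i + k).

Lemma shifted0 G : shifted 0 G G. Proof. by split=> // i; rewrite addn0. Qed.

Lemma shifted_period m G : shifted (m * size G) G G.
Proof. by split=> // i; rewrite vtxD. Qed.

(** The shift [k * (size G).-1] is [- k] modulo [size G]. *)
Lemma shifted_sym k G G' : (0 < size G)%N -> shifted k G G' -> shifted (k * (size G).-1) G' G.
Proof.
move=> G0 [sz kP]; split=> // i; rewrite kP -addnA.
by rewrite -[X in (_ + X)%N]mulnSr prednK// vtxD.
Qed.

Lemma shifted_rot k G : (0 < size G)%N -> shifted k G (rot (k %% size G) G).
Proof.
move=> G0; split=> [|i]; first exact: size_rot.
rewrite vtx_rot; last by rewrite ltnW// ltn_mod.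
by apply: eq_vtx; rewrite modnDmr.
Qed.

Section Shifted.
Variables (k : nat) (G G' : seq (R * R)).
Hypothesis kG : shifted k G G'.

Lemma shifted_side i : side G' i = side G (i + k).
Proof. by case: kG => _ v; rewrite /side !v. Qed.

Lemma shifted_prev i : (prev_idx G' i + k)%N = prev_idx G (i + k).
Proof. by case: kG => s _; rewrite /prev_idx s addnAC. Qed.

Lemma shifted_elastic_rhs phi (alpha : R) i :
  elastic_rhs phi alpha G' i = elastic_rhs phi alpha G (i + k).
Proof.
have aE j : angle G' j = angle G (j + k).
  by rewrite !angleE /tau !shifted_side shifted_prev.
have tE j : transition G' j = transition G (j + k) by rewrite /transition !aE.
have fE j : facet_of phi G' j = facet_of phi G (j + k) by rewrite !facet_ofE shifted_side.
rewrite /elastic_rhs /curvature /delta !(tE, fE, shifted_side, aE) !shifted_prev.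
by rewrite !addSn.
Qed.

Lemma shifted_parallel H H' : shifted k H H' -> parallel G H -> parallel G' H'.
Proof.
case: kG => s _ kH [sH pH]; split; first by case: kH => -> _; rewrite sH s.
move=> i; have [vH nH] := pH (i + k)%N; rewrite !shifted_side.
by have [_ v] := kH; rewrite -nH !v addSn; split=> //; rewrite /side !v.
Qed.

End Shifted.

Lemma is_derive1_congr (f g : R -> R) (t : R) : {near t, f =1 g} ->
  (derivable f t 1 -> derivable g t 1) /\ derive1 g t = derive1 f t.
Proof.
move=> fg; split; first exact: near_eq_derivable.
by rewrite !derive1E; apply/esym/near_eq_derive.
Qed.

Lemma near_open_time (T : \bar R) (t : R) : 0 < t -> (t%:E < T)%E ->
  \forall u \near t, 0 <= u /\ (u%:E < T)%E.
Proof.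
move=> t0; have t00 : \forall u \near t, 0 <= u.
  by apply: filterS (lt_nbhsr t0) => u /ltW.
case: T => [b||//]; rewrite ?lte_fin => tb; near=> u; (split; first by near: u).
  by rewrite lte_fin; near: u; exact: lt_nbhsl.
by rewrite ltry.
Unshelve. all: by end_near. Qed.

Lemma elastic_flow_shift phi (alpha : R) k G G' T Gm Gm' : (0 < size G)%N ->
  shifted k G G' ->
  (forall t : R, 0 <= t -> (t%:E < T)%E -> shifted k (Gm t) (Gm' t)) ->
  elastic_flow phi alpha G T Gm -> elastic_flow phi alpha G' T Gm'.
Proof.
move=> G0 kG kGm [T0 pG fl]; split=> //.
  by move=> t t0 tT; apply: (shifted_parallel kG (kGm t t0 tT)); exact: pG.
move=> i iG' /=; pose j := ((i + k) %% size G)%N.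
have jG : (j < size G)%N by rewrite ltn_mod.
have [/=] := fl j jG; set h := height G Gm j => h0 ch dh cdh Eh.
have ikE : (i + k = j + ((i + k) %/ size G) * size G)%N by rewrite [RHS]addnC /j -divn_eq.
have sG : side G' i = side G j.
  by rewrite (shifted_side kG) (eq_side (esym (modn_mod _ _))).
have sGm (t : R) : 0 <= t -> (t%:E < T)%E -> side (Gm' t) i = side (Gm t) j.
  move=> t0 tT; rewrite (shifted_side (kGm t t0 tT)); apply: eq_side.
  by have [-> _] := pG t t0 tT; rewrite modn_mod.
have hE (t : R) : 0 <= t -> (t%:E < T)%E -> h t = height G' Gm' i t.
  by move=> t0 tT; rewrite /h /height sG sGm.
have nearh (t : R) : 0 < t -> (t%:E < T)%E -> {near t, h =1 height G' Gm' i}.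
  by move=> t0 tT; apply: filterS (near_open_time t0 tT) => u [u0 uT]; exact: hE.
split.
- by rewrite -hE.
- apply: subspace_eq_continuous ch => t /set_mem[t0 tT]; exact: hE.
- by move=> t t0 tT; have [+ _] := is_derive1_congr (nearh t t0 tT); apply; exact: dh.
- apply: subspace_eq_continuous cdh => t /set_mem[t0 tT].
  by have [_ /esym] := is_derive1_congr (nearh t t0 tT).
move=> t t0 tT; have [_ ->] := is_derive1_congr (nearh t t0 tT).
rewrite sGm ?(ltW t0)// Eh// (shifted_elastic_rhs (kGm t (ltW t0) tT)) ikE.
have [<- _] := pG t (ltW t0) tT.
exact: (shifted_elastic_rhs (shifted_period _ _)).
Qed.

Lemma maximal_flow_shift phi (alpha : R) k G G' T Gm Gm' : (0 < size G)%N ->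
  shifted k G G' ->
  (forall t : R, 0 <= t -> (t%:E < T)%E -> shifted k (Gm t) (Gm' t)) ->
  maximal_flow phi alpha G T Gm -> maximal_flow phi alpha G' T Gm'.
Proof.
move=> G0 kG kGm [fl mx]; split; first exact: (elastic_flow_shift G0 kG kGm fl).
move=> [T' [H' [TT' fl' HE]]]; apply: mx.
pose k' := (k * (size G).-1)%N.
(* The extension, rotated back. Before [T] the values [Gm t] are kept, since an extension must agree
   with them as lists and not only up to rotation. *)
exists T', (fun t => if (t%:E < T)%E then Gm t else rot (k' %% size G) (H' t)); split=> //.
  have G'0 : (0 < size G')%N by case: kG => ->.
  apply: (@elastic_flow_shift _ _ k' G' G T' H') => //; first exact: shifted_sym.
  move=> t t0 tT'; case: ifPn => tT.
    have [s _] : parallel G (Gm t) by case: fl => _ + _; apply.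
    by rewrite HE// /k' -s; apply: shifted_sym; [rewrite s|exact: kGm].
  have [s _] : parallel G' (H' t) by case: fl' => _ + _; apply.
  have -> : size G = size (H' t) by rewrite s; case: kG.
  by apply: shifted_rot; rewrite s.
by move=> t t0 ->.
Qed.

Lemma maximal_flow_eq phi (alpha : R) G T Gm Gm' : (0 < size G)%N ->
  (forall t : R, 0 <= t -> (t%:E < T)%E -> Gm' t = Gm t) ->
  maximal_flow phi alpha G T Gm -> maximal_flow phi alpha G T Gm'.
Proof.
move=> G0 E; apply: (@maximal_flow_shift _ _ 0) => //; first exact: shifted0.
by move=> t t0 tT; rewrite E//; exact: shifted0.
Qed.

Lemma unique_maximal_flow_eq phi (alpha : R) G T Gm Gm' : (0 < size G)%N ->
  (forall t : R, 0 <= t -> (t%:E < T)%E -> Gm' t = Gm t) ->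
  unique_maximal_flow phi alpha G T Gm -> unique_maximal_flow phi alpha G T Gm'.
Proof.
move=> G0 E [mx un]; split; first exact: maximal_flow_eq mx.
move=> T' G' /un[-> G'E]; split=> // t t0 tT.
by rewrite E// G'E.
Qed.

Lemma same_curve_shifted G G' : same_curve G G' <-> exists k, shifted k G G'.
Proof.
rewrite same_curveP; split=> [[s [k v]]|[k [s v]]]; first by exists k.
by split=> //; exists k.
Qed.

End Shift.

Section KuratowskiFilters.
Context {R : realType}.

Lemma kuratowski_cvg_map {I J : Type} (F : set_system I) {PF : ProperFilter F}
    (H : set_system J) {PH : ProperFilter H} (g : J -> I) (K : I -> set (R * R))
    (K' : J -> set (R * R)) (L : set (R * R)) :
  (forall P, F P -> H (g @^-1` P)) -> (\forall u \near H, K' u = K (g u)) ->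
  kuratowski_cvg F K L -> kuratowski_cvg H K' L.
Proof.
move=> FH KE /kuratowski_cvgP[li ls]; apply/kuratowski_cvgP; split=> x.
  move=> Lx U xU; have := FH _ (li x Lx U xU) => Hn; near=> u.
  have -> : K' u = K (g u) by near: u.
  by near: u.
move=> Lx; have [U xU Fn] := ls x Lx; exists U => //; have Hn := FH _ Fn; near=> u.
have -> : K' u = K (g u) by near: u.
by near: u.
Unshelve. all: by end_near. Qed.

(** Serves at a restart time, where the limits from the left and from the right come from different
    stages. *)
Lemma kuratowski_cvg_join {I : Type} (F F1 F2 : set_system I) {PF : ProperFilter F}
    {PF1 : ProperFilter F1} {PF2 : ProperFilter F2} (K : I -> set (R * R)) (L : set (R * R)) :
  (forall P, F1 P -> F2 P -> F P) ->
  kuratowski_cvg F1 K L -> kuratowski_cvg F2 K L -> kuratowski_cvg F K L.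
Proof.
move=> F12 /kuratowski_cvgP[li1 ls1] /kuratowski_cvgP[li2 ls2].
apply/kuratowski_cvgP; split=> x Lx.
  by move=> U xU; apply: F12; [exact: (li1 x Lx U xU)|exact: (li2 x Lx U xU)].
have [U1 xU1 n1] := ls1 x Lx; have [U2 xU2 n2] := ls2 x Lx.
exists (U1 `&` U2); first exact: filterI.
apply: F12.
  by apply: filterS n1 => i n1 [y [Ky [y1 y2]]]; apply: n1; exists y.
by apply: filterS n2 => i n2 [y [Ky [y1 y2]]]; apply: n2; exists y.
Qed.

End KuratowskiFilters.

(** * Restarted flows *)

Section Concatenation.
Context {R : realType} (X : Type).
Variables (b : R) (Gam Gam1 : R -> X).
Hypothesis GamE : forall t : R, b <= t -> Gam t = Gam1 (t - b).

Lemma near_left_shift (a : R) (P : X -> Prop) : 0 < a ->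
  (\forall t \near a^'-, P (Gam1 t)) -> \forall t \near (b + a)^'-, P (Gam t).
Proof.
move=> a0 aP; have {}aP : \forall u \near (b + a)^'-, P (Gam1 (u - b)).
  have cv : (fun u : R => u - b) @ (b + a)^'- --> a^'-.
    move=> U [e /= e0 eU]; exists e => //= u /= ue ub; apply: eU => /=.
      by move: ue; rewrite opprB addrCA addrA.
    by rewrite ltrBlDl.
  exact: cv aP.
near=> t; rewrite GamE; first by near: t.
by near: t; apply: nbhs_left_ge; rewrite ltrDl.
Unshelve. all: by end_near. Qed.

Lemma cvg_left_shift (a : R) (V : topologicalType) (f : X -> V) (l : V) : 0 < a ->
  f (Gam1 t) @[t --> a^'-] --> l -> f (Gam t) @[t --> (b + a)^'-] --> l.
Proof.
move=> a0 fl U lU; exact: (@near_left_shift a (fun x => U (f x)) a0 (fl U lU)).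
Qed.

End Concatenation.

Section Restart.
Context {R : realType} (phi : R * R -> R) (alpha : R).
Hypotheses (aphi : anisotropy phi) (alpha0 : 0 < alpha).
Implicit Types (G q : seq (R * R)).

Lemma total_turn_parallel G G' : parallel G G' -> total_turn phi G' = total_turn phi G.
Proof.
move=> GG'; rewrite /total_turn (parallel_size GG').
by apply: eq_bigr => i _; rewrite !(parallel_N0_vertex GG').
Qed.

Lemma restart G q lam : admissible phi G -> degenerate_limit G q lam ->
  let G1 := merge_aligned (drop_vanished q) in
  [/\ admissible phi G1, (size G1 < size G)%N, trace G1 = trace q &
      total_turn phi G1 = total_turn phi G].
Proof.
move=> adG dq G1; have [kap [/andP[s0 s1] [kapS kapD] kap1 blk nblk]] := merge_blocks aphi adG dq.
have v i : vtx G1 i = vtx q (kap i) by case: (kap1 i).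
have l i : 0 < lam (kap i) by case: (kap1 i).
split=> //.
- exact: (merge_admissible aphi adG dq s0 kapS v l blk nblk).
- exact: (merge_trace adG dq s0 kapS v l blk).
- exact: (block_sum aphi adG dq s0 kapS kapD v l blk nblk (@sanglevv R) (@sangleN R)).
Qed.

Lemma evolution_time_ge0 G Gam m T : elastic_evolution phi alpha G Gam m T ->
  forall i, (i <= m)%N -> 0 <= T i.
Proof.
move=> ev; elim=> [_|i IH im]; first by rewrite (evol_time0 ev).
by apply: (le_trans (IH (ltnW im))); apply: ltW; exact: (evol_times ev).
Qed.

Lemma curvature_neq0 G i : curvature phi G i != 0 -> transition G i != 0.
Proof. by apply: contra => /eqP; rewrite /curvature => ->; rewrite !mul0r. Qed.

Lemma maximal_flow_admissible G T Gm : admissible phi G ->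
  unique_maximal_flow phi alpha G T Gm -> forall t : R, 0 <= t -> (t%:E < T)%E ->
  parallel G (Gm t) /\ admissible phi (Gm t).
Proof.
move=> adG [[[_ par _] _] _] t t0 tT; have pG := par t t0 tT; split=> //.
by apply: (parallel_admissible _ pG adG); case: adG.
Qed.

Lemma nonneg_proper (t : R) : 0 <= t -> ProperFilter (within [set u : R | 0 <= u] (nbhs t)).
Proof. by move=> t0; apply: within_nbhs_proper; exact: subset_closure. Qed.

Lemma trace_flow_cvg G T Gm (t : R) : (0 <= t) -> (t%:E < T)%E ->
  unique_maximal_flow phi alpha G T Gm ->
  (forall i, vtx (Gm u) i @[u --> within [set u | 0 <= u /\ (u%:E < T)%E] (nbhs t)]
    --> vtx (Gm t) i) ->
  kuratowski_cvg (within [set u : R | 0 <= u] (nbhs t)) (fun u => trace (Gm u)) (trace (Gm t)).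
Proof.
move=> t0 tT [[[_ par _] _] _] cv.
have nT : \forall u \near t, (u%:E < T)%E.
  case: (T) tT => [b||//]; last by move=> _; near=> u; rewrite ltry.
  by rewrite lte_fin => tb; near=> u; rewrite lte_fin; near: u; exact: lt_nbhsl.
have pF := nonneg_proper t0.
apply: (@trace_kuratowski_cvg _ _ (within [set u : R | 0 <= u] (nbhs t))).
  by apply: filterS nT => u uT u0; rewrite !(parallel_size (par _ _ _)).
move=> i U tU; apply: filterS2 nT (cv i U tU) => u uT + u0; apply; split=> //.
Unshelve. all: by end_near. Qed.

(** The total turning is carried through the induction because [evol_index] only provides some
    common index of the later curves; equality of total turnings identifies it with that of [G]
    without any uniqueness of the index. *)
Lemma evolution_ex n G : (size G <= n)%N -> admissible phi G -> exists Gam m T,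
  elastic_evolution phi alpha G Gam m T /\
  forall t : R, 0 <= t -> total_turn phi (Gam t) = total_turn phi G.
Proof.
elim: n G => [|n IH] G Gn adG.
  by case: (adG) => -[+ _ _] _ _; rewrite ltnNge Gn.
have [k kE] := total_turn_int aphi adG.
have G0 : (0 < size G)%N by case: adG => -[].
have [T [Gm [um Gm0 cv [TE|[b TE [q [lam [dq qcv [j jG [cj lj]] [e e0 le]]]]]]]]] :=
  maximal_flow_ex aphi alpha0 adG.
  subst T; have ad := maximal_flow_admissible adG um.
  have tt (t : R) : 0 <= t -> total_turn phi (Gm t) = total_turn phi G.
    by move=> t0; have [pt _] := ad t t0 (ltry _); exact: total_turn_parallel.
  exists Gm, 0%N, (fun=> 0); split=> //; split=> //.
  - by move=> t t0; have [] := ad t t0 (ltry _).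
  - move=> t /= t0; apply: trace_flow_cvg um _ => //; first exact: ltry.
    by move=> i; apply: cv => //; exact: ltry.
  - move=> i; rewrite leqn0 => /eqP->; rewrite /end_time /= Gm0 sube0.
    by apply: unique_maximal_flow_eq um => // t _ _; rewrite add0r.
  - exists k; split; first exact: total_turn_index.
    move=> t t0; have [_ adt] := ad t t0 (ltry _).
    by apply: total_turn_index => //; rewrite tt.
subst T; have b0 : 0 < b by case: um => -[[+ _ _] _] _; rewrite lte_fin.
have ad := maximal_flow_admissible adG um.
pose G1 := merge_aligned (drop_vanished q).
have [ad1 sG1 tr1 tt1] := restart adG dq.
have [Gam1 [m1 [T1 [ev1 tot1]]]] := IH G1 (leq_trans sG1 Gn) ad1.
pose Gam t := if t < b then Gm t else Gam1 (t - b).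
pose T i := if i is i'.+1 then b + T1 i' else 0.
have GamE (t : R) : b <= t -> Gam t = Gam1 (t - b) by rewrite /Gam ltNge => ->.
have Gamlt (t : R) : t < b -> Gam t = Gm t by rewrite /Gam => ->.
have T10 i : (i <= m1)%N -> 0 <= T1 i := evolution_time_ge0 ev1 (i := i).
have GamT i (s : R) : (i <= m1)%N -> 0 <= s -> Gam (b + T1 i + s) = Gam1 (T1 i + s).
  move=> im s0; rewrite GamE; first by congr Gam1; ring.
  by rewrite -addrA lerDl addr_ge0// T10.
have GamT0 i : (i <= m1)%N -> Gam (b + T1 i) = Gam1 (T1 i).
  by move=> im; have := GamT i 0 im (lexx _); rewrite !addr0.
have nearb : \forall t \near b^'-, 0 <= t < b.
  near=> t; apply/andP; split; first by near: t; exact: nbhs_left_ge.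
  by near: t; exact: nbhs_left_lt.
have T1S i : (i < m1)%N -> 0 < T1 i.+1.
  by move=> im; apply: (le_lt_trans (T10 i (ltnW im))); exact: (evol_times ev1).
have adGam (t : R) : 0 <= t -> admissible phi (Gam t).
  move=> t0; have [tb|bt] := ltP t b; first by rewrite Gamlt//; have [] := ad t t0 tb.
  by rewrite GamE//; apply: (evol_admissible ev1); rewrite subr_ge0.
have totGam (t : R) : 0 <= t -> total_turn phi (Gam t) = total_turn phi G.
  move=> t0; have [tb|bt] := ltP t b.
    by rewrite Gamlt//; have [pt _] := ad t t0 tb; exact: total_turn_parallel.
  by rewrite GamE// tot1 ?subr_ge0.
have szq : size q = size G by case: dq.
have Gamsz : \forall t \near b^'-, parallel G (Gam t).
  apply: filterS nearb => t /andP[t0 tb].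
  by rewrite Gamlt//; have [] := ad t t0 tb.
have Gamcv (V : topologicalType) (f : seq (R * R) -> V) (l : V) :
    f (Gm t) @[t --> b^'-] --> l -> f (Gam t) @[t --> b^'-] --> l.
  move=> fl U lU; apply: filterS2 nearb (fl U lU) => t /andP[_ tb].
  by rewrite /= Gamlt.
exists Gam, m1.+1, T; split=> //; split=> //.
- by rewrite Gamlt.
- by apply: leq_ltn_trans sG1; exact: (evol_bound ev1).
- case=> [_|i im] /=; first by rewrite (evol_time0 ev1) addr0.
  by rewrite ltrD2l; exact: (evol_times ev1).
- case=> [_|i im] /=.
    rewrite (evol_time0 ev1) addr0 GamE// subrr (evol_init ev1).
    exists q; split; last exact: same_curve_refl.
      by apply: filterS Gamsz => t /parallel_size ->.
    by move=> l _; apply: (Gamcv _ (vtx ^~ l)); exact: qcv.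
  have [q' [sq' cq' mq']] := evol_relabel ev1 im.
  exists q'; rewrite GamT0//; split=> //.
    exact: (@near_left_shift _ _ _ _ _ GamE _ (fun x => size x = size q') (T1S i im)) sq'.
  move=> l lq; apply: (@cvg_left_shift _ _ _ _ _ GamE _ _ (vtx ^~ l)); first exact: T1S.
  exact: cq'.
- have A0 (t : R) := @nonneg_proper t.
  move=> t /= t0; have At := A0 t t0; have [tb|bt|tb] := ltgtP t b.
  + rewrite Gamlt//.
    apply: (@kuratowski_cvg_map _ _ _ _ _ _ _ id _ _ _ _ _
      (trace_flow_cvg t0 _ um (fun i => cv t i t0 _))); rewrite ?lte_fin//.
    by apply: filterS (lt_nbhsl tb) => u ub _; rewrite Gamlt.
  + have At' : ProperFilter (within [set u : R | 0 <= u] (nbhs (t - b))).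
      by apply: A0; rewrite subr_ge0 ltW.
    rewrite (GamE t (ltW bt)).
    apply: (@kuratowski_cvg_map _ _ _ _ _ _ _ (fun u => u - b) _ _ _ _ _
      (evol_kuratowski ev1 (_ : 0 <= t - b))); last by rewrite subr_ge0 ltW.
      move=> P; have cb : (fun u : R => u - b) @ t --> t - b.
        by apply: cvgB; [exact: cvg_id|exact: cvg_cst].
      move=> /cb; apply: filterS2 (lt_nbhsr bt) => u bu Pu u0; apply: Pu.
      by rewrite /= subr_ge0 ltW.
    by apply: filterS (lt_nbhsr bt) => u bu _; rewrite GamE// ltW.
  (* At [t = b] the vertices converge from the left to those of [q], whose trace is that of [G1];
     from the right the evolution of [G1] is continuous at its time 0. *)
  subst t; have A00 := A0 0 (lexx _).
  have KE : trace (Gam b) = trace G1 by rewrite GamE// subrr (evol_init ev1).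
  rewrite KE; apply: (@kuratowski_cvg_join _ _ _ (b^'-)
    ((fun u => b + u) @ within [set u : R | 0 <= u] (nbhs 0))).
  + move=> P leftP rightP.
    have cb : (fun u : R => u - b) @ b --> (0 : R).
      by rewrite -[X in _ --> X](subrr b); apply: cvgB; [exact: cvg_id|exact: cvg_cst].
    have leftP' : nbhs b (fun u : R => u < b -> P u) := leftP.
    have rightP' : nbhs b (fun u : R => 0 <= u - b -> P (b + (u - b))) := cb _ rightP.
    apply: filterS2 leftP' rightP' => u ub bu _.
    have [/ub//|bu'] := ltP u b.
    by have := bu; rewrite subr_ge0 addrC subrK; apply.
  + rewrite tr1; apply: trace_kuratowski_cvg.
      by apply: filterS Gamsz => u /parallel_size ->.
    by move=> i; apply: (Gamcv _ (vtx ^~ i)); exact: qcv.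
  + change (kuratowski_cvg (within [set u : R | 0 <= u] (nbhs 0))
      (fun u => trace (Gam (b + u))) (trace G1)).
    have := evol_kuratowski ev1 (lexx 0); rewrite (evol_init ev1).
    apply: (@kuratowski_cvg_map _ _ _ _ _ _ _ id) => //.
    rewrite near_withinE; near=> u => u0; rewrite /= GamE ?lerDl//.
    by rewrite addrC addKr.
- case=> [_|i im].
    rewrite /= Gamlt// Gm0 /end_time /= (evol_time0 ev1) addr0 sube0.
    apply: unique_maximal_flow_eq um => // t t0; rewrite lte_fin => tb.
    by rewrite add0r Gamlt.
  have -> : (end_time m1.+1 T i.+1 - (T i.+1)%:E)%E = (end_time m1 T1 i - (T1 i)%:E)%E.
    rewrite /end_time ltnS; case: ifP => _ //=.
    by rewrite -!EFinB; congr EFin; rewrite opprD addrACA subrr add0r.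
  rewrite /= GamT0//; apply: unique_maximal_flow_eq (evol_flow ev1 im).
    by have := evol_admissible ev1 (T10 i im); case=> -[].
  by move=> t t0 _; rewrite GamT.
- case=> [_|i im] /=.
    rewrite (evol_time0 ev1) addr0 Gamlt// Gm0; exists j; split=> //.
      by apply: filterS Gamsz => t pt; rewrite /curvature (parallel_transition pt) cj !mul0r.
    exact: (Gamcv _ (fun x => seglen (side x j))).
  have [l [lG cl sl]] := evol_vanish ev1 im; exists l; rewrite (GamT0 i (ltnW (im : (i < m1)%N))); split=> //.
    exact: (@near_left_shift _ _ _ _ _ GamE _ (fun x => curvature phi x l = 0) (T1S i im)) cl.
  exact: (@cvg_left_shift _ _ _ _ _ GamE _ _ (fun x => seglen (side x l)) _ (T1S i im)) sl.
- case=> [_|i im] /=.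
    rewrite (evol_time0 ev1) addr0; exists e; split=> //.
    apply: filterS3 nearb Gamsz le => t /andP[_ tb] pt + l; rewrite (parallel_size pt) => + lG.
    move=> /(_ l lG) + /curvature_neq0; rewrite (parallel_transition pt) => + cl.
    by rewrite Gamlt//; apply.
  have [e' [e'0 le']] := evol_bounded ev1 im; exists e'; split=> //.
  exact: (@near_left_shift _ _ _ _ _ GamE _ (fun x => forall l, (l < size x)%N ->
    curvature phi x l != 0 -> e' <= seglen (side x l)) (T1S i im)) le'.
- exists k; split; first exact: total_turn_index.
  by move=> t t0; apply: total_turn_index; rewrite ?totGam//; exact: adGam.
Unshelve. all: by end_near. Qed.

End Restart.

(** * Uniqueness *)

Section Uniqueness.
Context {R : realType} (phi : R * R -> R) (alpha : R) (G0 : seq (R * R)).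

(** Uniqueness of limits passes the shift [k] from the curves to their vertexwise limits [q] and
    [q'], and dropping and merging respect it. *)
Lemma limit_shift k (Gam Gam' : R -> seq (R * R)) (t : R) G1 G1' :
  (\forall u \near t^'-, (0 < size (Gam u))%N /\ shifted k (Gam u) (Gam' u)) ->
  relabelled_limit Gam t G1 -> relabelled_limit Gam' t G1' -> same_curve G1 G1'.
Proof.
move=> kGam [q [sq cq mq]] [q' [sq' cq' mq']].
have [u [[su [[Gu [su' _]]] ]] su2] : exists u, (size (Gam u) = size q /\
    ((0 < size (Gam u))%N /\ shifted k (Gam u) (Gam' u))) /\ size (Gam' u) = size q'.
  by apply: (@filter_ex _ (t^'-)); apply: filterS3 sq kGam sq' => u.
have sqq : size q' = size q by rewrite -su2 su'.
have q0 : (0 < size q)%N by rewrite -su.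
have qq : shifted k q q'.
  split=> // i; rewrite -(vtx_mod q') sqq -(vtx_mod q (i + k)).
  have iq : (i %% size q < size q)%N by rewrite ltn_mod.
  have ikq : ((i + k) %% size q < size q)%N by rewrite ltn_mod.
  have ci := cq' _ (leq_trans iq (eq_leq (esym sqq))).
  have cik := cq _ ikq.
  apply: (@cvg_unique _ (@norm_hausdorff R (R * R)%type) (vtx (Gam' u) (i %% size q) @[u --> t^'-]));
    first exact: ci.
  apply: cvg_trans cik; apply: near_eq_cvg.
  apply: filterS2 sq kGam => v sv [_ [_ ->]]; apply: eq_vtx.
  by rewrite sv modn_mod modnDml.
have /same_curve_drop/same_curve_merge mm : same_curve q q'.
  by apply/same_curve_shifted; exists k.
by apply: same_curve_trans (same_curve_sym mq) _; exact: same_curve_trans mm mq'.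
Qed.

Variables (Gam Gam' : R -> seq (R * R)) (m m' : nat) (T T' : nat -> R).
Hypotheses (ev : elastic_evolution phi alpha G0 Gam m T)
           (ev' : elastic_evolution phi alpha G0 Gam' m' T').

(** The flow of [Gam], rotated by a fixed [k], is a maximal flow from [Gam' (T i)]; the uniqueness
    clause of [ev'] identifies it with the flow of [Gam']. *)
Lemma stage_unique i : (i <= m)%N -> (i <= m')%N -> T' i = T i ->
  same_curve (Gam (T i)) (Gam' (T i)) ->
  end_time m' T' i = end_time m T i /\ exists k, forall t : R, T i <= t ->
    (t%:E < end_time m T i)%E -> shifted k (Gam t) (Gam' t).
Proof.
move=> im im' TT /same_curve_shifted[k kG].
have [mx _] := evol_flow ev im; have [_ un'] := evol_flow ev' im'.
have Ti0 := evolution_time_ge0 ev im.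
have sz (t : R) : 0 <= t -> (0 < size (Gam t))%N.
  by move=> t0; have := evol_admissible ev t0; case=> -[].
pose rt s := rot (k %% size (Gam (T i + s))) (Gam (T i + s)).
have rtk (s : R) : 0 <= s -> shifted k (Gam (T i + s)) (rt s).
  by move=> s0; apply: shifted_rot; apply: sz; rewrite addr_ge0.
have mx' : maximal_flow phi alpha (Gam' (T' i)) (end_time m T i - (T i)%:E)%E rt.
  rewrite TT; apply: (maximal_flow_shift _ kG _ mx); first exact: sz.
  by move=> s s0 _; exact: rtk.
have [dE rE] := un' _ _ mx'.
have -> : end_time m' T' i = end_time m T i.
  move: dE; rewrite TT /end_time; case: ifP => _; case: ifP => _ //=; rewrite -?EFinB => -[].
  by move=> /addIr ->.
split=> //; exists k => t Tt te.
have s0 : 0 <= t - T i by rewrite subr_ge0.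
have tE : T i + (t - T i) = t by rewrite addrC subrK.
have := rE _ s0; rewrite -dE TT tE => <-; first by have := rtk _ s0; rewrite tE.
by rewrite EFinB lteBlDr// subeK.
Qed.

Lemma stages_unique i : (i <= m)%N ->
  [/\ (i <= m')%N, T' i = T i & same_curve (Gam (T i)) (Gam' (T i))].
Proof.
elim: i => [_|i IH im].
  rewrite (evol_time0 ev) (evol_time0 ev') (evol_init ev) (evol_init ev').
  by split=> //; exact: same_curve_refl.
have [im' TT sc] := IH (ltnW im).
have [eE [k kE]] := stage_unique (ltnW im) im' TT sc.
have Tlt := evol_times ev im.
(* A finite end time of this stage in one evolution forces [i < m'] in the other. *)
move: (eE); rewrite /end_time im; case: ifPn => // im1 [TTS].
split=> //; rewrite -{2}TTS in kE *; rewrite -{1}TTS.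
apply: (@limit_shift k Gam Gam' (T' i.+1)); last exact: (evol_relabel ev' im1).
  rewrite TTS; near=> u.
  have Tu : T i <= u by near: u; exact: nbhs_left_ge.
  have u0 : 0 <= u by apply: le_trans Tu; exact: (evolution_time_ge0 ev (ltnW im)).
  split; first by have := evol_admissible ev u0; case=> -[].
  by apply: kE => //; rewrite /end_time im lte_fin; near: u; exact: nbhs_left_lt.
by rewrite TTS; exact: (evol_relabel ev im).
Unshelve. all: by end_near. Qed.

Lemma stage_ex (t : R) : 0 <= t ->
  exists2 i, (i <= m)%N & T i <= t /\ (t%:E < end_time m T i)%E.
Proof.
move=> t0.
have H k : forall i, (i + k)%N = m -> T i <= t ->
    exists2 i, (i <= m)%N & T i <= t /\ (t%:E < end_time m T i)%E.
  elim: k => [|k IH] i im Tt.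
    exists i; first by rewrite -im addn0.
    by split=> //; rewrite /end_time -im addn0 ltnn ltry.
  have ilt : (i < m)%N by rewrite -im addnS ltnS leq_addr.
  have [tT|Tt'] := ltP t (T i.+1); last by apply: IH Tt'; rewrite addSnnS.
  by exists i; [exact: ltnW|rewrite /end_time ilt lte_fin].
by apply: (H m 0%N (add0n m)); rewrite (evol_time0 ev).
Qed.

Lemma evolution_unique (t : R) : 0 <= t -> same_curve (Gam t) (Gam' t).
Proof.
move=> /stage_ex[i im [Tt te]]; have [im' TT sc] := stages_unique im.
have [_ [k kE]] := stage_unique im im' TT sc.
by apply/same_curve_shifted; exists k; exact: kE.
Qed.

End Uniqueness.

Theorem theorem4p2 (R : realType) (phi : R * R -> R) (alpha : R)
    (G0 : seq (R * R)) :
  anisotropy phi -> crystalline phi -> 0 < alpha -> admissible phi G0 ->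
  exists Gam : R -> seq (R * R),
    (exists (m : nat) (T : nat -> R), elastic_evolution phi alpha G0 Gam m T) /\
    (forall Gam' : R -> seq (R * R),
      (exists (m : nat) (T : nat -> R),
        elastic_evolution phi alpha G0 Gam' m T) ->
      forall t : R, 0 <= t -> same_curve (Gam t) (Gam' t)).
Proof.
move=> aphi _ alpha0 ad0.
have [Gam [m [T [ev _]]]] := evolution_ex aphi alpha0 (leqnn (size G0)) ad0.
exists Gam; split; first by exists m, T.
by move=> Gam' [m' [T' ev']] t t0; exact: (evolution_unique ev ev').
Qed.
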